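(* Consider the Rician block-fading channel and codes defined in the context, with parameters $\ell\ge1$, $n_c\ge2$, $\epsilon\in(0,1)$, $\rho>0$, $\kappa\ge0$, and fix an integer $n_p$ with $1\le n_p\le n_c-1$; set $n_d=n_c-n_p$, $\sigma_e^2=1/(n_p\rho)$, $\sigma_p^2=\frac{\sigma_H^2\sigma_e^2}{\sigma_H^2+\sigma_e^2}$, and $\mu_p(\hat h)=\frac{\sigma_H^2\hat h+\sigma_e^2\mu_H}{\sigma_H^2+\sigma_e^2}$ for $\hat h\in\mathbb{C}$. Then \[ R^*\ \ge\ \max\Big\{\tfrac{\log_2M}{n_c\ell}:\ M\ge2\text{ integer},\ \epsilon^{(n_p)}_{\mathrm{ub}}(M)\le\epsilon\Big\}, \] where \[ \epsilon^{(n_p)}_{\mathrm{ub}}(M)=\mathbb{E}\Big[\exp\Big\{-\Big[\sum_{k=1}^\ell\bar S_k(\hat H_k)-\ln\tfrac{M-1}{2}\Big]^+\Big\}\Big]. \] Here $\hat H_1,\dots,\hat H_\ell$ are i.i.d. with $\hat H_k\sim\mathcal{CN}(\mu_H,\sigma_H^2+\sigma_e^2)$ (the distribution of $H_k+E_k$ with $E_k\sim\mathcal{CN}(0,\sigma_e^2)$ independent of $H_k$), and, conditionally on $\hat H_k=\hat h_k$ ($k=1,\dots,\ell$), the random variables $\bar S_1(\hat h_1),\dots,\bar S_\ell(\hat h_\ell)$ are independent, with $\bar S_k(\hat h_k)$ defined as the random variable $S_k$ of the context with block length $n_d$ in place of $n_c$, $\mu=\mu_p(\hat h_k)$ and $\sigma^2=\sigma_p^2$.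 The expectation is over both $\{\hat H_k\}$ and the $\{\bar S_k\}$.
   Context: Channel model: fix integers $\ell\ge1$ (number of coherence blocks) and $n_c\ge1$ (block length of each coherence block), a Rician factor $\kappa\ge0$, and $\rho>0$. Set $\mu_H=\sqrt{\kappa/(1+\kappa)}$ and $\sigma_H^2=1/(1+\kappa)$. The channel maps an input $(\mathbf{x}_1,\dots,\mathbf{x}_\ell)\in(\mathbb{C}^{n_c})^\ell$ to $\mathbf{Y}_k=H_k\mathbf{x}_k+\mathbf{W}_k$, $k=1,\dots,\ell$, where $H_k\sim\mathcal{CN}(\mu_H,\sigma_H^2)$ (i.e., $\mu_H$ plus a circularly-symmetric complex Gaussian of variance $\sigma_H^2$) and $\mathbf{W}_k\sim\mathcal{CN}(\mathbf{0},\mathbf{I}_{n_c})$, all of $H_1,\dots,H_\ell,\mathbf{W}_1,\dots,\mathbf{W}_\ell$ mutually independent and independent of the input; neither transmitter nor receiver knows the realizations of $H_k$ (the receiver knows $\mu_H,\sigma_H^2$). Codes: an $(\ell,n_c,M,\epsilon,\rho)$-code consists of an encoder mapping each message $j\in\{1,\dots,M\}$ to a codeword $\mathbf{c}_j=(\mathbf{c}_{j,1},\dots,\mathbf{c}_{j,\ell})$ with $\mathbf{c}_{j,k}\in\mathbb{C}^{n_c}$ and $\|\mathbf{c}_{j,k}\|^2=n_c\rho$ for every $k$, and a decoder $g:\mathbb{C}^{n_c\ell}\to\{1,\dots,M\}$ such that, with message $J$ uniform on $\{1,\dots,M\}$, $\frac1M\sum_{j=1}^M\Pr\{g(\mathbf{Y}_1,\dots,\mathbf{Y}_\ell)\ne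 J\mid J=j\}\le\epsilon$. The maximum coding rate is $R^*=\sup\{\log_2(M)/(\ell n_c):\exists\ (\ell,n_c,M,\epsilon,\rho)\text{-code}\}$. Definition of $S_k$ (for given $\mu\in\mathbb{C}$, $\sigma^2>0$, and block length $m$ in place of $n_c$): let $\mathbf{e}_1=[1,0,\dots,0]^{T}\in\mathbb{C}^{m}$; let $f_{\mathbf{Y}\mid\mathbf{e}_1}$ be the density of $\mathcal{CN}\big(\mu\sqrt{m\rho}\,\mathbf{e}_1,\ \sigma^2 m\rho\,\mathbf{e}_1\mathbf{e}_1^{H}+\mathbf{I}_{m}\big)$, and let \[ f_{\mathbf{Y}}(\mathbf{y})=\frac{\Gamma(m)}{\sigma^2\pi^{m}}e^{-\|\mathbf{y}\|^2}e^{-|\mu|^2/\sigma^2}\int_0^\infty\frac{e^{-(\rho m+\sigma^{-2})z}}{(\sqrt{\|\mathbf{y}\|^2\rho m z})^{m-1}}I_0\big(2\sqrt{z|\mu|^2/\sigma^4}\big)I_{m-1}\big(2\sqrt{\|\mathbf{y}\|^2\rho m z}\big)\,\mathrm{d}z \] (the output density when the input is uniform on the sphere of radius $\sqrt{m\rho}$ and the fading is $\mathcal{CN}(\mu,\sigma^2)$). With $\mathbf{W}_k\sim\mathcal{CN}(\mathbf{0},\mathbf{I}_{m})$, set $\widetilde{\mathbf{W}}_k=\begin{bmatrix}\mu\sqrt{m\rho}\\ \mathbf{0}_{m-1}\end{bmatrix}+\begin{bmatrix}\sqrt{\sigma^2m\rho+1}\\ \mathbf{1}_{m-1}\end{bmatrix}\odot\mathbf{W}_k$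 (where $\odot$ is the entrywise product and $\mathbf{0}_{j},\mathbf{1}_j$ are the all-zero/all-one vectors of length $j$) and $S_k=\ln\dfrac{f_{\mathbf{Y}\mid\mathbf{e}_1}(\widetilde{\mathbf{W}}_k)}{f_{\mathbf{Y}}(\widetilde{\mathbf{W}}_k)}$. Also $[a]^+=\max\{0,a\}$ and $\ln$ is the natural logarithm. Pilot-assisted scheme underlying the bound (for interpretation): in each coherence block $n_p$ channel uses carry known pilot symbols of power $\rho$ each and the remaining $n_d$ carry data of total energy $n_d\rho$; the receiver forms the maximum-likelihood estimate $\hat H_k$ of $H_k$ from the pilot outputs, so that given $H_k=h_k$, $\hat H_k\sim\mathcal{CN}(h_k,\sigma_e^2)$, and given $\hat H_k=\hat h_k$ the fading coefficient is $\mathcal{CN}(\mu_p(\hat h_k),\sigma_p^2)$. *)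

(* Defs.v *)
From HB Require Import structures.
From mathcomp Require Import all_boot all_order all_algebra.
From mathcomp Require Import all_classical all_reals all_analysis.
From mathcomp Require Import complex.

Set Implicit Arguments.
Unset Strict Implicit.
Unset Printing Implicit Defensive.

Import Order.TTheory GRing.Theory Num.Theory.
Import numFieldNormedType.Exports.
Local Open Scope classical_set_scope.
Local Open Scope ring_scope.

Section defs.
Variable R : realType.

Definition cnorm2 (z : R[i]) : R := complex.Re z ^+ 2 + complex.Im z ^+ 2.

Definition vnorm2 (m : nat) (y : 'I_m -> R[i]) : R := \sum_(i < m) cnorm2 (y i).

Definition mkC (a b : R) : R[i] := Complex a b.

Definition rC (x : R) : R[i] := Complex x 0.

Definition log2 (x : R) : R := ln x / ln 2.

Definition besselI (nu : nat) (x : R) : R :=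
  limn (series (fun k : nat =>
     (x / 2) ^+ (2 * k + nu)%N / ((k`!)%:R * ((k + nu)`!)%:R))).

(* Density of CN(a, diag(v)) on C^m (covariance diagonal with entries v i > 0):
   prod_i 1/(pi v_i) exp(-|y_i - a_i|^2 / v_i)
   = 1/(pi^m det K) exp(-(y-a)^H K^{-1} (y-a)) for K = diag(v). *)
Definition cn_diag_pdf (m : nat) (a : 'I_m -> R[i]) (v : 'I_m -> R)
    (y : 'I_m -> R[i]) : R :=
  \prod_(i < m) ((pi * v i)^-1 * expR (- (cnorm2 (y i - a i) / v i))).

Section Sdef.
Variables (m : nat) (rho : R) (mu : R[i]) (sigma2 : R).

Definition f_Y_e1 (y : 'I_m -> R[i]) : R :=
  cn_diag_pdf
    (fun i => if (i : nat) == 0%N then mu * rC (Num.sqrt (m%:R * rho)) else 0)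
    (fun i => if (i : nat) == 0%N then sigma2 * m%:R * rho + 1 else 1) y.

Definition f_Y_integrand (y : 'I_m -> R[i]) (z : R) : R :=
  expR (- ((rho * m%:R + sigma2^-1) * z))
  / (Num.sqrt (vnorm2 y * rho * m%:R * z)) ^+ m.-1
  * besselI 0 (2 * Num.sqrt (z * cnorm2 mu / sigma2 ^+ 2))
  * besselI m.-1 (2 * Num.sqrt (vnorm2 y * rho * m%:R * z)).

(* f_Y, with Gamma(m) = (m-1)! *)
Definition f_Y (y : 'I_m -> R[i]) : R :=
  (m.-1)`!%:R / (sigma2 * pi ^+ m) * expR (- vnorm2 y)
  * expR (- (cnorm2 mu / sigma2))
  * fine (\int[lebesgue_measure]_(z in `[0%R, +oo[%classic)
            (f_Y_integrand y z)%:E)%E.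

Definition Wtilde (w : 'I_m -> R[i]) : 'I_m -> R[i] :=
  fun i => if (i : nat) == 0%N
           then mu * rC (Num.sqrt (m%:R * rho))
                + rC (Num.sqrt (sigma2 * m%:R * rho + 1)) * w i
           else w i.

Definition Sfun (w : 'I_m -> R[i]) : R :=
  ln (f_Y_e1 (Wtilde w) / f_Y (Wtilde w)).
End Sdef.

Definition muH (kappa : R) : R := Num.sqrt (kappa / (1 + kappa)).
Definition sigmaH2 (kappa : R) : R := (1 + kappa)^-1.
Definition sigmae2 (np : nat) (rho : R) : R := (np%:R * rho)^-1.
Definition sigmap2 (kappa : R) (np : nat) (rho : R) : R :=
  sigmaH2 kappa * sigmae2 np rho / (sigmaH2 kappa + sigmae2 np rho).
Definition mup (kappa : R) (np : nat) (rho : R) (hh : R[i]) : R[i] :=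
  (rC (sigmaH2 kappa) * hh + rC (sigmae2 np rho * muH kappa))
  / rC (sigmaH2 kappa + sigmae2 np rho).

Section proba.
Variables (d : measure_display) (T : measurableType d) (P : probability T R).

Definition mutually_independent (I : eqType) (X : I -> T -> R) : Prop :=
  forall (J : seq I) (A : I -> set R), uniq J ->
    (forall i, measurable (A i)) ->
    P (\bigcap_(i in [set` J]) (X i @^-1` A i))
    = (\prod_(i <- J) P (X i @^-1` A i))%E.

(* X is a real random variable with law N(m, s^2) (s = standard deviation) *)
Definition has_normal_law (X : T -> R) (m s : R) : Prop :=
  measurable_fun setT X /\
  forall A : set R, measurable A -> P (X @^-1` A) = normal_prob m s A.

(* (Xre + i Xim) ~ CN(mu, s2): real and imaginary parts independent
   (independence is imposed separately, at the level of the whole family)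
   with laws N(Re mu, s2/2) and N(Im mu, s2/2) *)
Definition has_CN_law (Xre Xim : T -> R) (mu : R[i]) (s2 : R) : Prop :=
  has_normal_law Xre (complex.Re mu) (Num.sqrt (s2 / 2)) /\
  has_normal_law Xim (complex.Im mu) (Num.sqrt (s2 / 2)).

Definition chan_family (l n : nat) (Hre Him : 'I_l -> T -> R)
    (Wre Wim : 'I_l -> 'I_n -> T -> R) :
    ('I_l * bool + 'I_l * 'I_n * bool)%type -> T -> R :=
  fun x => match x with
           | inl (k, b) => if b then Him k else Hre k
           | inr (k, i, b) => if b then Wim k i else Wre k i
           end.

Definition rician_model (l n : nat) (mu s2 : R) (Hre Him : 'I_l -> T -> R)
    (Wre Wim : 'I_l -> 'I_n -> T -> R) : Prop :=
  (forall k, has_CN_law (Hre k) (Him k) (rC mu) s2) /\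
  (forall k i, has_CN_law (Wre k i) (Wim k i) 0 1) /\
  mutually_independent (chan_family Hre Him Wre Wim).

Definition chan_out (l n : nat) (Hre Him : 'I_l -> T -> R)
    (Wre Wim : 'I_l -> 'I_n -> T -> R) (x : 'I_l -> 'I_n -> R[i]) (t : T) :
    'I_l -> 'I_n -> R[i] :=
  fun k i => mkC (Hre k t) (Him k t) * x k i + mkC (Wre k i t) (Wim k i t).
End proba.

Record code (l n M : nat) := Code {
  codeword : 'I_M -> 'I_l -> 'I_n -> R[i];
  decoder : ('I_l -> 'I_n -> R[i]) -> 'I_M }.

Section codes.
Variables (d : measure_display) (T : measurableType d) (P : probability T R).
Variables (l n : nat) (Hre Him : 'I_l -> T -> R) (Wre Wim : 'I_l -> 'I_n -> T -> R).

Definition err_event (M : nat) (c : code l n M) (j : 'I_M) : set T :=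
  [set t | decoder c (chan_out Hre Him Wre Wim (codeword c j) t) != j].

Definition is_code (M : nat) (eps rho : R) (c : code l n M) : Prop :=
  (forall j k, vnorm2 (codeword c j k) = n%:R * rho) /\
  (forall j, measurable (err_event c j)) /\
  ((M%:R^-1)%:E * \sum_(j < M) P (err_event c j) <= eps%:E)%E.

Definition Rstar (eps rho : R) : \bar R :=
  ereal_sup [set (log2 M%:R / (l * n)%:R)%:E |
             M in [set M : nat | (0 < M)%N /\
                   exists c : code l n M, is_code eps rho c]].
End codes.

Section bound.
Variables (d : measure_display) (T : measurableType d) (P : probability T R).
Variables (l nc np : nat) (kappa rho : R).
Variables (HHre HHim : 'I_l -> T -> R) (Vre Vim : 'I_l -> 'I_(nc - np) -> T -> R).

(* Hhat_1..Hhat_l i.i.d. CN(muH, sigmaH2 + sigmae2), and, independent of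
   them, i.i.d. CN(0, I_{n_d}) noise vectors V_1..V_l used to realise
   Sbar_k(Hhat_k) = S_k(block length n_d, mu = mup(Hhat_k), sigma^2 = sigmap2) *)
Definition bound_model : Prop :=
  (forall k, has_CN_law P (HHre k) (HHim k) (rC (muH kappa))
                        (sigmaH2 kappa + sigmae2 np rho)) /\
  (forall k i, has_CN_law P (Vre k i) (Vim k i) 0 1) /\
  mutually_independent P (chan_family HHre HHim Vre Vim).

Definition Sbar (k : 'I_l) (t : T) : R :=
  Sfun rho (mup kappa np rho (mkC (HHre k t) (HHim k t))) (sigmap2 kappa np rho)
       (fun i => mkC (Vre k i t) (Vim k i t)).

Definition eps_ub (M : nat) : \bar R :=
  (\int[P]_t (expR (- Num.max 0 (\sum_(k < l) Sbar k t
                                 - ln ((M%:R - 1) / 2))))%:E)%E.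
End bound.

End defs.

(* Main.v *)
Require Import Defs.
From HB Require Import structures.
From mathcomp Require Import all_boot all_order all_algebra.
From mathcomp Require Import all_classical all_reals all_analysis.
From mathcomp Require Import complex.
From mathcomp Require Import measurable_realfun.
From mathcomp Require Import ring lra.
Import Order.TTheory GRing.Theory Num.Theory.
Import numFieldNormedType.Exports.
Import HBNNSimple.
Local Open Scope classical_set_scope.
Local Open Scope ring_scope.

Set Implicit Arguments.
Unset Strict Implicit.
Unset Printing Implicit Defensive.

(* Random coding with codewords uniform on a sphere in each block. Given the pilots, block k of
   the data is [H x + W] with [H ~ CN(mup hhat, sigmap2)]; let [r] be the product over k of the
   output density given the codeword divided by [f_Y]. The decoder returns the first message
   whose [r] exceeds [g = (M - 1) / 2].
   - Since the noise is unitarily invariant, [r] for the transmitted codeword has the law of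
     [exp S], [S = sum_k Sbar_k], whatever the codeword.
   - Averaging a Cameron-Martin shift over the transmitted codeword replaces the output by pure
     noise of density ratio [prod_k f_Y]; shifting back towards a wrong codeword x' shows that x'
     exceeds [g] with average probability [E (1_{exp S > g} exp (- S))], for every fixed x'.
   - Hence codewords can be chosen one at a time, the j-th one being confused with its
     predecessors with total probability at most [j E (1_{exp S > g} exp (- S))]. The average
     error is at most [P (exp S <= g) + g E (1_{exp S > g} exp (- S)) = E exp (- [S - ln g]^+)].
   All laws are expressed through finite families of i.i.d. [N(0, 1/2)] variables on the given
   probability space ([gfam]); the random codewords are read off the channel noise itself, and
   [f_Y] is recognised as a spherical average by matching power series. *)

(** * Measurability and one-dimensional Gaussian integrals *)

(** All steps are identities between integrals of nonnegative functions, so exchanges of sums and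
    integrals need measurability only; finiteness is proved where a real number is wanted. No
    surface measure appears: a uniform point is a normalised Gaussian vector, and polar coordinates
    give way to a scaling identity expressing E F, for F homogeneous, as a rational multiple of E (F
    |X|^2). Unitary invariance is used through explicit products of plane rotations, enough to align
    a given vector with an axis. The pilot step is also a rotation: the pilot noises of a block are
    condensed into their normalised sum, and turning the plane of that sum and the fading yields the
    normalised estimate and an independent residual, whence [mup] and [sigmap2]. Choosing codewords
    one by one needs a single random codeword at a time, never [M] independent ones. The decoder
    prefers the smallest index, so message [j] competes with [j] others only; the mean of [j] is (M
    - 1) / 2, which is why this number is both the threshold and the weight of the confusion
    term. *)

Section measurability.
Context d (T : measurableType d) (R : realType).
Implicit Types f g : T -> R.

Lemma mfun_expR f : measurable_fun setT f -> measurable_fun setT (fun x => expR (f x)).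
Proof. exact: measurableT_comp. Qed.

Lemma mfun_ln f : measurable_fun setT f -> measurable_fun setT (fun x => ln (f x)).
Proof. exact: measurableT_comp. Qed.

Lemma mfun_sqrt f : measurable_fun setT f -> measurable_fun setT (fun x => Num.sqrt (f x)).
Proof.
move=> mf; apply: (measurableT_comp _ mf).
exact: (continuous_measurable_fun (@sqrt_continuous R)).
Qed.

Lemma mfun_inv f : measurable_fun setT f -> measurable_fun setT (fun x => (f x)^-1).
Proof.
(* [powR] is measurable but agrees with the inverse only on positive arguments, hence the form x *
   (x ^ 2)^(-1); at 0 the factor x makes both sides 0. *)
move=> mf; rewrite (_ : (fun x => _) = (fun x => f x * (f x ^+ 2) `^ (-1))).
  apply: measurable_funM => //.
  have mf2 : measurable_fun setT (fun x => f x ^+ 2) by exact: measurable_funX.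
  exact: (measurableT_comp (measurable_powR (-1)) mf2).
apply/funext => x; have [->|fx0] := eqVneq (f x) 0; first by rewrite invr0 mul0r.
by rewrite powR_inv1 ?sqr_ge0//; field.
Qed.

Lemma mfun_norm f : measurable_fun setT f -> measurable_fun setT (fun x => `|f x|).
Proof. exact: measurableT_comp. Qed.

Lemma mfun_EFin f : measurable_fun setT f -> measurable_fun setT (fun x => (f x)%:E).
Proof. exact: measurableT_comp. Qed.

Lemma mfun_opp f : measurable_fun setT f -> measurable_fun setT (fun x => - f x).
Proof. exact: measurableT_comp. Qed.

Lemma mfun_add f g : measurable_fun setT f -> measurable_fun setT g ->
  measurable_fun setT (fun x => f x + g x).
Proof. exact: measurable_funD. Qed.

Lemma mfun_mul f g : measurable_fun setT f -> measurable_fun setT g ->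
  measurable_fun setT (fun x => f x * g x).
Proof. exact: measurable_funM. Qed.

Lemma mfun_exp f n : measurable_fun setT f -> measurable_fun setT (fun x => f x ^+ n).
Proof. exact: measurable_funX. Qed.

Lemma mfun_natmul f n : measurable_fun setT f -> measurable_fun setT (fun x => f x *+ n).
Proof.
move=> mf; under eq_fun do rewrite -mulr_natr.
exact: measurable_funM.
Qed.

Lemma mfun_sum I (s : seq I) (p : pred I) (h : I -> T -> R) :
  (forall i, measurable_fun setT (h i)) ->
  measurable_fun setT (fun x => \sum_(i <- s | p i) h i x).
Proof.
move=> mh; under eq_fun do rewrite -big_filter.
exact: measurable_sum.
Qed.

Lemma mfun_prod I (s : seq I) (p : pred I) (h : I -> T -> R) :
  (forall i, measurable_fun setT (h i)) ->
  measurable_fun setT (fun x => \prod_(i <- s | p i) h i x).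
Proof.
move=> mh; elim: s => [|i s IH]; first by (under eq_fun do rewrite big_nil); exact: measurable_cst.
under eq_fun do rewrite big_cons.
by case: (p i) => //; exact: measurable_funM.
Qed.

Lemma mfun_sumT I (s : seq I) (h : I -> T -> R) :
  (forall i, measurable_fun setT (h i)) ->
  measurable_fun setT (fun x => \sum_(i <- s) h i x).
Proof. exact: mfun_sum. Qed.

Lemma mfun_prodT I (s : seq I) (h : I -> T -> R) :
  (forall i, measurable_fun setT (h i)) ->
  measurable_fun setT (fun x => \prod_(i <- s) h i x).
Proof. exact: mfun_prod. Qed.

Lemma mfun_eprod I (s : seq I) (h : I -> T -> \bar R) :
  (forall i, measurable_fun setT (h i)) ->
  measurable_fun setT (fun x => \prod_(i <- s) h i x)%E.
Proof.
move=> mh; elim: s => [|i s IH]; first by (under eq_fun do rewrite big_nil); exact: measurable_cst.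
under eq_fun do rewrite big_cons.
exact: emeasurable_funM.
Qed.

Lemma mfun_emul (f g : T -> \bar R) : measurable_fun setT f -> measurable_fun setT g ->
  measurable_fun setT (fun x => f x * g x)%E.
Proof. exact: emeasurable_funM. Qed.

Lemma mfun_fine (f : T -> \bar R) : measurable_fun setT f ->
  measurable_fun setT (fun x => fine (f x)).
Proof. exact: measurableT_comp. Qed.
End measurability.

Ltac mfun_step := first
  [ assumption
  | exact: measurable_cst
  | exact: measurable_id
  | exact: measurable_fst
  | exact: measurable_snd
  | match goal with
    | |- measurable_fun _ (fun x => EFin _) => apply: mfun_EFin
    | |- measurable_fun _ (fun x => mule _ _) => apply: mfun_emul
    | |- measurable_fun _ (fun x => GRing.exp _ _) => apply: mfun_exp
    | |- measurable_fun _ (fun x => expR _) => apply: mfun_expR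
    | |- measurable_fun _ (fun x => Num.sqrt _) => apply: mfun_sqrt
    | |- measurable_fun _ (fun x => ln _) => apply: mfun_ln
    | |- measurable_fun _ (fun x => GRing.inv _) => apply: mfun_inv
    | |- measurable_fun _ (fun x => Num.norm _) => apply: mfun_norm
    | |- measurable_fun _ (fun x => GRing.opp _) => apply: mfun_opp
    | |- measurable_fun _ (fun x => GRing.add _ _) => apply: mfun_add
    | |- measurable_fun _ (fun x => GRing.mul _ _) => apply: mfun_mul
    | |- measurable_fun _ (fun x => GRing.natmul _ _) => apply: mfun_natmul
    | |- measurable_fun _ (fun x => \sum_(i <- _) _) => apply: mfun_sumT => ?
    | |- measurable_fun _ (fun x => \prod_(i <- _) _) => apply: mfun_prodT => ?
    | |- measurable_fun _ (fun x => \sum_(i <- _ | _) _) => apply: mfun_sum => ?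
    | |- measurable_fun _ (fun x => \prod_(i <- _ | _) _) => apply: mfun_prod => ?
    end
  | solve [eauto with nocore] ].
Ltac mfun := repeat mfun_step.

(** * Integration against densities and image measures *)

Section density.
Context d (T : measurableType d) (R : realType).
Variables (mu nu : {measure set T -> \bar R}) (p : T -> R).
Hypothesis mp : measurable_fun setT p.
Hypothesis p0 : forall x, 0 <= p x.
Hypothesis nuE : forall A, measurable A -> nu A = (\int[mu]_(x in A) (p x)%:E)%E.

(** The usual climb: indicators by [nuE], simple functions by linearity, then monotone limits on
    both sides along the same approximating sequence. *)
Lemma ge0_integral_density (f : T -> \bar R) : measurable_fun setT f ->
  (forall x, 0 <= f x)%E ->
  (\int[nu]_x f x = \int[mu]_x (f x * (p x)%:E))%E.
Proof.
move=> mf f0.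
pose g := nnsfun_approx measurableT mf.
have gl x : (g n x)%:E @[n --> \oo] --> f x.
  by apply: cvg_nnsfun_approx => // ? _; exact: f0.
have ind A : measurable A ->
    (\int[nu]_x (\1_A x)%:E = \int[mu]_x ((\1_A x)%:E * (p x)%:E))%E.
  move=> mA; rewrite integral_indic// setIT nuE// integral_mkcond.
  apply: eq_integral => x _; rewrite patchE indicE.
  by case: ifP; rewrite ?mul1e ?mul0e.
have sfE n : (\int[nu]_x (g n x)%:E = \int[mu]_x ((g n x)%:E * (p x)%:E))%E.
  under eq_integral do rewrite fimfunE -fsumEFin//.
  under [RHS]eq_integral do rewrite fimfunE -fsumEFin//.
  rewrite ge0_integral_fsum//; last 2 first.
    - by move=> r; apply/measurable_EFinP/measurableT_comp.
    - by move=> r x _; rewrite nnfun_muleindic_ge0.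
  transitivity ((\int[mu]_x \sum_(r \in range (g n))
       ((r * \1_(g n @^-1` [set r]) x)%:E * (p x)%:E))%E); last first.
    apply: eq_integral => x _.
    rewrite muleC ge0_mule_fsumr; last by move=> r; exact: nnfun_muleindic_ge0.
    by apply: eq_fsbigr => r _; rewrite muleC.
  rewrite ge0_integral_fsum//; last 2 first.
    - move=> r; apply: emeasurable_funM; last exact/measurable_EFinP.
      by apply/measurable_EFinP/measurableT_comp.
    - by move=> r x _; rewrite mule_ge0 ?nnfun_muleindic_ge0// lee_fin.
  apply: eq_fsbigr => r _.
  rewrite integralZl_indic_nnsfun//.
  under [RHS]eq_integral do rewrite EFinM -muleA.
  have [r0|r0] := leP 0 r.
    rewrite ge0_integralZl_EFin// ?ind//.
      by move=> x _; rewrite mule_ge0// lee_fin.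
    by apply: emeasurable_funM; apply/measurable_EFinP => //; exact: measurable_indic.
  (* For r < 0 the level set of a nonnegative simple function is empty, so both sides are 0. *)
  rewrite preimage_nnfun0// integral_indic// set0I measure0 mule0.
  by rewrite integral0_eq// => x _; rewrite indic0 mul0e mule0.
transitivity (limn (fun n => \int[nu]_x (g n x)%:E)%E).
  rewrite -monotone_convergence//.
  - by apply: eq_integral => x _; apply/esym/cvg_lim => //; exact: gl.
  - by move=> n; exact/measurable_EFinP.
  - by move=> n x _; rewrite lee_fin.
  - by move=> x _ m n mn; rewrite lee_fin; exact/lefP/nd_nnsfun_approx.
under eq_fun do rewrite sfE.
rewrite -monotone_convergence//.
- apply: eq_integral => x _; apply/cvg_lim => //.
  by apply: cvgeZr => //; exact: gl.
- move=> n; apply: emeasurable_funM; exact/measurable_EFinP.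
- by move=> n x _; rewrite mule_ge0// lee_fin.
- move=> x _ m n mn; rewrite lee_wpmul2r ?lee_fin//; exact/lefP/nd_nnsfun_approx.
Qed.
End density.

Section image_measure.
Context d d' (T1 : measurableType d) (T2 : measurableType d') (R : realType).
Variables (m : {measure set T1 -> \bar R}) (f : T1 -> T2).
Hypothesis mf : measurable_fun setT f.

Definition push : {measure set T2 -> \bar R} :=
  Measure.clone _ _ _ (pushforward m f) (ltac:(refine (_ mf))).

Lemma pushE A : push A = m (f @^-1` A). Proof. by []. Qed.

Lemma ge0_integral_image (m2 : {measure set T2 -> \bar R}) (F : T2 -> \bar R) :
  (forall A, measurable A -> m2 A = m (f @^-1` A)) ->
  measurable_fun setT F -> (forall y, 0 <= F y)%E ->
  (\int[m2]_y F y = \int[m]_x F (f x))%E.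
Proof.
move=> m2E mF F0; rewrite (eq_measure_integral push).
  by rewrite ge0_integral_pushforward.
by move=> A mA _; rewrite m2E.
Qed.
End image_measure.

Section lebesgue.
Variable R : realType.
Local Notation mu := (@lebesgue_measure R).

(** By uniqueness of Lebesgue measure: [s] times its image under x -> a + s x agrees with it on the
    intervals ]b, c]. *)
Lemma ge0_integral_affine (a s : R) (f : R -> \bar R) : 0 < s ->
  measurable_fun setT f -> (forall x, 0 <= f x)%E ->
  (\int[mu]_x f (a + s * x)%R = (s^-1)%:E * \int[mu]_x f x)%E.
Proof.
move=> s0 mf f0.
have sV0 : 0 <= s^-1 by rewrite invr_ge0 ltW.
have mphi : measurable_fun setT (fun x : measurableTypeR R => a + s * x : measurableTypeR R).
  by apply: measurable_funD => //; apply: measurable_funM.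
rewrite -(@ge0_integral_image _ _ _ _ _ mu _ mphi (push mu mphi) f)//.
rewrite -[(s^-1)%R]/((NngNum sV0)%:num)%R -ge0_integral_mscale//.
apply: eq_measure_integral => /= A mA _.
have := @lebesgue_measure_unique R (mscale (NngNum (ltW s0)) (push mu mphi)) _ A mA.
rewrite /mscale /= => ->.
  by rewrite muleA -EFinM mulVf ?mul1e// gt_eqF.
move=> X [[b c] _ <-]; rewrite /mscale/= (@pushE _ _ _ _ _ mu _ mphi).
have -> : (fun x => a + s * x) @^-1` `]b, c] = `](b - a) / s, (c - a) / s]%classic.
  apply/seteqP; split => x /=; rewrite !in_itv/= ltr_pdivrMr// ler_pdivlMr//;
   rewrite ltrBlDl lerBrDl (mulrC x) => //.
rewrite lebesgue_measure_itv/= [in RHS]lebesgue_measure_itv/= !lte_fin ltr_pM2r ?invr_gt0// ltrD2r.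
case: ifPn => _; last by rewrite mule0.
rewrite -!EFinB -EFinM; congr EFin. by field; rewrite gt_eqF.
Qed.
End lebesgue.

(** * The law N(0, 1/2) under shifts, scalings and rotations *)

Section std_normal.
Variable R : realType.
Local Notation mu := (@lebesgue_measure R).

(* Variance 1/2, so that an independent pair is the real and imaginary part of [CN(0, 1)]. *)
Definition g1 : probability (measurableTypeR R) R := normal_prob 0 (Num.sqrt (1 / 2)).

Definition g1_pdf (x : R) : R := (Num.sqrt pi)^-1 * expR (- x ^+ 2).

Lemma g1_pdf_ge0 x : 0 <= g1_pdf x.
Proof. by rewrite mulr_ge0 ?invr_ge0 ?sqrtr_ge0 ?expR_ge0. Qed.

Lemma measurable_g1_pdf : measurable_fun setT g1_pdf.
Proof.
by rewrite /g1_pdf; mfun.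
Qed.

Lemma normal_pdf_affine (m s : R) x : 0 < s ->
  normal_pdf m (s * Num.sqrt (1 / 2)) (m + s * x) = s^-1 * g1_pdf x.
Proof.
move=> s0; have h0 : 0 < Num.sqrt (1 / 2 : R) by rewrite sqrtr_gt0; lra.
rewrite normal_pdfE ?gt_eqF ?mulr_gt0// /normal_peak /normal_fun /g1_pdf.
rewrite exprMn sqr_sqrtr; last lra.
rewrite [RHS]mulrA; congr (_ * expR _); last by field; rewrite gt_eqF.
rewrite (_ : s ^+ 2 * (1 / 2) * pi *+ 2 = s ^+ 2 * pi); last by rewrite -mulr_natr; field.
by rewrite sqrtrM ?sqr_ge0// sqrtr_sqr gtr0_norm// invfM.
Qed.

Lemma ge0_integral_normal (m s : R) (f : R -> \bar R) : 0 < s ->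
  measurable_fun setT f -> (forall x, 0 <= f x)%E ->
  (\int[normal_prob m (s * Num.sqrt (1 / 2))]_x f x =
   \int[mu]_x (f (m + s * x)%R * (g1_pdf x)%:E))%E.
Proof.
move=> s0 mf f0.
pose p := normal_pdf m (s * Num.sqrt (1 / 2)).
rewrite (@ge0_integral_density _ _ _ mu _ p)//; last 2 first.
- exact: measurable_normal_pdf.
- exact: normal_pdf_ge0.
have mF : measurable_fun setT (fun x => f x * (p x)%:E)%E.
  by apply: emeasurable_funM => //; apply/measurable_EFinP; exact: measurable_normal_pdf.
have F0 x : (0 <= f x * (p x)%:E)%E by rewrite mule_ge0// lee_fin normal_pdf_ge0.
have := ge0_integral_affine m s0 mF F0.
move=> /(congr1 (fun z => s%:E * z)%E); rewrite muleA -EFinM divff ?gt_eqF// mul1e => <-.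
have maff : measurable_fun setT (fun x : R => m + s * x) by mfun.
rewrite -ge0_integralZl_EFin//; [|exact: (measurableT_comp mF maff)|exact: ltW].
by apply: eq_integral => x _; rewrite /p normal_pdf_affine// muleCA -EFinM mulrA divff ?mul1r// gt_eqF.
Qed.

Lemma ge0_integral_g1 (f : R -> \bar R) :
  measurable_fun setT f -> (forall x, 0 <= f x)%E ->
  (\int[g1]_x f x = \int[mu]_x (f x * (g1_pdf x)%:E))%E.
Proof.
move=> mf f0; rewrite /g1.
have := @ge0_integral_normal 0 1 f ltr01 mf f0; rewrite mul1r => ->.
by apply: eq_integral => x _; rewrite add0r mul1r.
Qed.

Lemma ge0_integral_normal_std (m s : R) (f : R -> \bar R) : 0 < s ->
  measurable_fun setT f -> (forall x, 0 <= f x)%E ->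
  (\int[normal_prob m (s * Num.sqrt (1 / 2))]_x f x = \int[g1]_x f (m + s * x)%R)%E.
Proof.
move=> s0 mf f0; rewrite ge0_integral_normal// [RHS]ge0_integral_g1//.
apply: measurableT_comp => //.
by apply: measurable_funD => //; apply: measurable_funM.
Qed.

Lemma normal_std (m s : R) (A : set R) : 0 < s -> measurable A ->
  normal_prob m (s * Num.sqrt (1 / 2)) [set x | A ((x - m) / s)] = g1 A.
Proof.
move=> s0 mA.
have mB : measurable [set x : R | A ((x - m) / s)].
  have mh : measurable_fun setT (fun x : R => (x - m) / s) by mfun.
  by rewrite -[X in measurable X]setTI; exact: mh.
rewrite -[X in normal_prob _ _ X]setIT -integral_indic//.
rewrite ge0_integral_normal_std//; last first.
  by apply/measurable_EFinP; exact: measurable_indic.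
rewrite -[X in g1 X]setIT -[RHS]integral_indic//.
apply: eq_integral => x _; rewrite !indicE; congr ((nat_of_bool _)%:R%:E).
apply/idP/idP; rewrite !inE/= addrAC subrr add0r mulrAC divff ?gt_eqF// mul1r//.
Qed.

(** One-dimensional Cameron-Martin formula. With variance 1/2 the density ratio between x - a and x
    is exp (2 a x - a^2), without further constants. *)
Lemma g1_shift (a : R) (f : R -> \bar R) :
  measurable_fun setT f -> (forall x, 0 <= f x)%E ->
  (\int[g1]_x f (x + a)%R = \int[g1]_x (f x * (expR (2 * a * x - a ^+ 2))%:E))%E.
Proof.
move=> mf f0.
have mfa : measurable_fun setT (fun x : R => f (x + a)).
  by apply: (measurableT_comp mf); mfun.
have mp := measurable_g1_pdf.
have me : measurable_fun setT (fun x : R => (f x * (expR (2 * a * x - a ^+ 2))%:E)%E).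
  by mfun.
rewrite ge0_integral_g1// ge0_integral_g1//; last first.
  by move=> x; rewrite mule_ge0// lee_fin expR_ge0.
rewrite -[RHS]mul1e -[X in (X%:E * _)%E]invr1 -(ge0_integral_affine a ltr01); last 2 first.
- by mfun.
- by move=> x; rewrite !mule_ge0// lee_fin ?expR_ge0 ?g1_pdf_ge0.
apply: eq_integral => x _; rewrite mul1r addrC -muleA -EFinM; congr (_ * _%:E)%E.
by rewrite /g1_pdf mulrCA -expRD; congr (_ * expR _); ring.
Qed.

(** The weight is the density of s X' read backwards, s times the ratio of [g1_pdf] at s x and at x.
    It is the tool by which quadratic exponents are absorbed later. *)
Lemma g1_scale (s : R) (f : R -> \bar R) : 0 < s ->
  measurable_fun setT f -> (forall x, 0 <= f x)%E ->
  (\int[g1]_x f (x / s)%R = \int[g1]_x (f x * (s * expR (- ((s ^+ 2 - 1) * x ^+ 2)))%:E))%E.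
Proof.
move=> s0 mf f0.
have mfa : measurable_fun setT (fun x : R => f (x / s)).
  by apply: (measurableT_comp mf); mfun.
have mp := measurable_g1_pdf.
have se0 x : 0 <= s * expR (- ((s ^+ 2 - 1) * x ^+ 2)).
  by rewrite mulr_ge0 ?expR_ge0// ltW.
rewrite ge0_integral_g1// ge0_integral_g1//; last 2 first.
- by mfun.
- by move=> x; rewrite mule_ge0// lee_fin.
have := @ge0_integral_affine R 0 s (fun x => f (x / s)%R * (g1_pdf x)%:E)%E s0.
move=> /(_ _ _)/(congr1 (fun z => s%:E * z)%E).
rewrite muleA -EFinM divff ?gt_eqF// mul1e => <-; last 2 first.
- by mfun.
- by move=> x; rewrite mule_ge0// lee_fin g1_pdf_ge0.
rewrite -ge0_integralZl_EFin//; last 3 first.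
- by move=> x _; rewrite mule_ge0// lee_fin g1_pdf_ge0.
- have mfs : measurable_fun setT (fun x : R => f ((0 + s * x) / s)).
    by apply: (measurableT_comp mf); mfun.
  have mfg : measurable_fun setT (fun x : R => g1_pdf (0 + s * x)).
    by apply: (measurableT_comp mp); mfun.
  by mfun.
- exact: ltW.
apply: eq_integral => x _; rewrite add0r [s * x]mulrC mulfK ?gt_eqF//.
rewrite muleCA -muleA; congr (_ * _)%E; rewrite -!EFinM; congr EFin.
rewrite /g1_pdf -mulrA; congr (_ * _); rewrite mulrCA -expRD; congr (_ * expR _); ring.
Qed.

Lemma mfun_comp2 d (T : measurableType d) (F : R -> R -> \bar R) (a b : T -> R) :
  measurable_fun setT (fun z : R * R => F z.1 z.2) ->
  measurable_fun setT a -> measurable_fun setT b ->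
  measurable_fun setT (fun t => F (a t) (b t)).
Proof.
move=> mF ma mb.
have mab : measurable_fun setT (fun t => (a t, b t)) by exact: measurable_fun_pair.
exact: (measurableT_comp mF mab).
Qed.

Lemma lebesgue_shear1 (t : R) (G : R -> R -> \bar R) :
  measurable_fun setT (fun z : R * R => G z.1 z.2) -> (forall x y, 0 <= G x y)%E ->
  (\int[mu]_x \int[mu]_y G (x - t * y)%R y = \int[mu]_x \int[mu]_y G x y)%E.
Proof.
move=> mG G0.
have mG' : measurable_fun setT (fun z : R * R => G (z.1 - t * z.2)%R z.2).
  by apply: mfun_comp2 => //; mfun.
rewrite (fubini_tonelli (m1 := mu) (m2 := mu) (fun z : R * R => G (z.1 - t * z.2)%R z.2))//.
rewrite [RHS](fubini_tonelli (m1 := mu) (m2 := mu) (fun z : R * R => G z.1 z.2))//=.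
apply: eq_integral => y _.
have := @ge0_integral_affine R (- (t * y)) 1 (fun x => G x y) ltr01.
rewrite invr1 mul1e => <- //; last by apply: mfun_comp2 => //; mfun.
by apply: eq_integral => x _; rewrite mul1r addrC.
Qed.

Lemma lebesgue_shear2 (t : R) (G : R -> R -> \bar R) :
  measurable_fun setT (fun z : R * R => G z.1 z.2) -> (forall x y, 0 <= G x y)%E ->
  (\int[mu]_x \int[mu]_y G x (y + t * x)%R = \int[mu]_x \int[mu]_y G x y)%E.
Proof.
move=> mG G0; apply: eq_integral => x _.
have := @ge0_integral_affine R (t * x) 1 (fun y => G x y) ltr01.
rewrite invr1 mul1e => <- //; last by apply: mfun_comp2 => //; mfun.
by apply: eq_integral => y _; rewrite mul1r addrC.
Qed.

End std_normal.

Local Opaque integral.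

Section rotation.
Variable R : realType.
Local Notation mu := (@lebesgue_measure R).
(* A rotation of angle a is the product of the shears of slopes
   -tan(a/2), sin a and -tan(a/2); the half turn is done in two steps. *)
Lemma lebesgue_rot (c s : R) (G : R -> R -> \bar R) : c ^+ 2 + s ^+ 2 = 1 ->
  measurable_fun setT (fun z : R * R => G z.1 z.2) -> (forall x y, 0 <= G x y)%E ->
  (\int[mu]_x \int[mu]_y G (c * x - s * y)%R (s * x + c * y)%R =
   \int[mu]_x \int[mu]_y G x y)%E.
Proof.
have key (c' s' : R) (G' : R -> R -> \bar R) : c' != -1 -> c' ^+ 2 + s' ^+ 2 = 1 ->
    measurable_fun setT (fun z : R * R => G' z.1 z.2) -> (forall x y, 0 <= G' x y)%E ->
    (\int[mu]_x \int[mu]_y G' (c' * x - s' * y)%R (s' * x + c' * y)%R =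
     \int[mu]_x \int[mu]_y G' x y)%E.
  move=> c1 cs mG G0; pose t := s' / (1 + c').
  have c10 : 1 + c' != 0 by rewrite addrC -[1]opprK subr_eq0.
  have tc : t * (1 + c') = s' by rewrite /t mulfVK.
  have ts : t * s' = 1 - c'.
    apply: (mulIf c10); rewrite mulrAC tc; nra.
  have m1 : measurable_fun setT (fun z : R * R => G' (z.1 - t * z.2)%R z.2).
    by apply: mfun_comp2 => //; mfun.
  have m2 : measurable_fun setT
      (fun z : R * R => G' (z.1 - t * (z.2 + s' * z.1))%R (z.2 + s' * z.1)%R).
    by apply: mfun_comp2 => //; mfun.
  have H1 := lebesgue_shear1 t mG G0.
  have H2 := @lebesgue_shear2 _ s' (fun x y => G' (x - t * y)%R y) m1 (fun x y => G0 _ _).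
  have H3 := @lebesgue_shear1 _ t (fun x y => G' (x - t * (y + s' * x))%R (y + s' * x)%R) m2
    (fun x y => G0 _ _).
  apply: etrans (etrans _ H3) (etrans H2 H1).
  apply: eq_integral => x _; apply: eq_integral => y _.
  have -> : y + s' * (x - t * y) = s' * x + c' * y.
    by rewrite -[c'](subKr 1) -ts; ring.
  by congr (G' _ _); rewrite -{1}[c'](subKr 1) -ts -tc; ring.
have [->|] := eqVneq c (-1); last by move=> *; exact: key.
move=> cs mG G0; move: cs => /(canRL (addKr _)) /eqP.
rewrite sqrrN expr1n addNr sqrf_eq0 => /eqP ->.
have n01 : (0 : R) != -1 by rewrite eq_sym oppr_eq0 oner_eq0.
have h01 : (0 : R) ^+ 2 + 1 ^+ 2 = 1 by ring.
have mG1 : measurable_fun setT (fun z : R * R => G (0 * z.1 - 1 * z.2)%R (1 * z.1 + 0 * z.2)%R).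
  by apply: mfun_comp2 => //; mfun.
have H1 := key 0 1 G n01 h01 mG G0.
have H2 := key 0 1 (fun x y => G (0 * x - 1 * y)%R (1 * x + 0 * y)%R) n01 h01 mG1 (fun x y => G0 _ _).
apply: etrans (etrans _ H2) H1.
by apply: eq_integral => x _; apply: eq_integral => y _; congr (G _ _); ring.
Qed.

Lemma integral_g1_g1 (F : R -> R -> \bar R) :
  measurable_fun setT (fun z : R * R => F z.1 z.2) -> (forall x y, 0 <= F x y)%E ->
  (\int[g1 R]_x \int[g1 R]_y F x y =
   \int[mu]_x \int[mu]_y (F x y * ((pi)^-1 * expR (- (x ^+ 2 + y ^+ 2)))%:E))%E.
Proof.
move=> mF F0; have mp := @measurable_g1_pdf R.
have mpy : measurable_fun setT (fun z : R * R => g1_pdf z.2).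
  by apply: (measurableT_comp mp); mfun.
have mFp : measurable_fun setT (fun z : R * R => (F z.1 z.2 * (g1_pdf z.2)%:E)%E) by mfun.
have Fp0 x y : (0 <= F x y * (g1_pdf y)%:E)%E by rewrite mule_ge0// lee_fin g1_pdf_ge0.
under eq_integral => x _.
  rewrite ge0_integral_g1//; last by apply: mfun_comp2 => //; mfun.
  over.
rewrite /= ge0_integral_g1//; last 2 first.
- exact: (measurable_fun_fubini_tonelli_F (m2 := mu)
    (fun z : R * R => F z.1 z.2 * (g1_pdf z.2)%:E)%E mFp).
- by move=> x; apply: integral_ge0.
apply: eq_integral => x _.
rewrite -ge0_integralZr//; last 2 first.
- by apply: (@mfun_comp2 _ _ _ (fun x y => F x y * (g1_pdf y)%:E)%E) => //; mfun.
- by rewrite lee_fin g1_pdf_ge0.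
apply: eq_integral => y _; rewrite -muleA -EFinM; congr (_ * _%:E)%E.
rewrite /g1_pdf mulrACA -invfM -expr2 sqr_sqrtr ?pi_ge0// -expRD; congr (_ * expR _); ring.
Qed.

(** Lebesgue measure on the plane is rotation invariant and the joint density depends on x^2 + y^2
    only. *)
Lemma g1_rot (c s : R) (F : R -> R -> \bar R) : c ^+ 2 + s ^+ 2 = 1 ->
  measurable_fun setT (fun z : R * R => F z.1 z.2) -> (forall x y, 0 <= F x y)%E ->
  (\int[g1 R]_x \int[g1 R]_y F (c * x - s * y)%R (s * x + c * y)%R =
   \int[g1 R]_x \int[g1 R]_y F x y)%E.
Proof.
move=> cs mF F0.
pose G x y := (F x y * ((pi)^-1 * expR (- (x ^+ 2 + y ^+ 2)))%:E)%E.
have mG : measurable_fun setT (fun z : R * R => G z.1 z.2) by rewrite /G; mfun.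
have G0 x y : (0 <= G x y)%E.
  by rewrite mule_ge0// lee_fin mulr_ge0 ?invr_ge0 ?pi_ge0 ?expR_ge0.
have mFr : measurable_fun setT (fun z : R * R => F (c * z.1 - s * z.2)%R (s * z.1 + c * z.2)%R).
  by apply: mfun_comp2 => //; mfun.
have H1 := integral_g1_g1 mF F0.
have H2 := @integral_g1_g1 (fun x y => F (c * x - s * y)%R (s * x + c * y)%R) mFr (fun x y => F0 _ _).
have H3 := lebesgue_rot cs mG G0.
apply: etrans H2 (etrans _ (etrans H3 (esym H1))).
apply: eq_integral => x _; apply: eq_integral => y _; congr (_ * (_ * expR (- _))%:E)%E.
rewrite -[LHS]mul1r -cs; ring.
Qed.

End rotation.

(** * Finite families of independent Gaussians *)

Section vec.
Variables (R : realType) (I : finType).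

(** Boxes are closed under intersection, so a finite measure on [vec] is determined by them, and a
    box is exactly an event whose probability mutual independence gives as a product. *)
Definition vbox : set (set (I -> R)) :=
  [set B | exists2 A : I -> set R, (forall i, measurable (A i)) &
     B = [set f | forall i, A i (f i)]].

Definition vec := g_sigma_algebraType vbox.

Lemma vboxT : vbox setT.
Proof. by exists (fun=> setT) => //; apply/seteqP; split. Qed.

Lemma vboxI : setI_closed vbox.
Proof.
move=> _ _ [A mA ->] [B mB ->]; exists (fun i => A i `&` B i).
  by move=> i; exact: measurableI.
apply/seteqP; split => f /=; first by move=> [fA fB] i; split.
by move=> fAB; split => i; have [] := fAB i.
Qed.

Lemma measurable_vbox B : vbox B -> measurable (B : set vec).
Proof. exact: sub_sigma_algebra. Qed.

Lemma mfun_coord i : measurable_fun setT (fun v : vec => v i : R).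
Proof.
move=> _ A mA; rewrite setTI; apply: measurable_vbox.
exists (fun j => if j == i then A else setT); first by move=> j; case: ifP.
apply/seteqP; split => f /=.
  by move=> Af j; case: eqP => // ->.
by move=> /(_ i); rewrite eqxx.
Qed.

Lemma mfun_vec d (T : measurableType d) (X : T -> I -> R) :
  (forall i, measurable_fun setT (fun t => X t i)) ->
  measurable_fun setT (X : T -> vec).
Proof.
move=> mX; apply: (@measurability _ _ _ vec _ _ vbox) => //.
move=> _ [_ [A mA ->] <-]; rewrite setTI.
have -> : X @^-1` [set f | forall i, A i (f i)] =
    \bigcap_(i in [set: I]) ((fun t => X t i) @^-1` A i).
  by apply/seteqP; split => t /= XA i => [_|]; apply: XA.
apply: fin_bigcap_measurable => // i _.
by rewrite -[X in measurable X]setTI; exact: mX.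
Qed.

End vec.

Section gfam.
Variable R : realType.

(** Prescribing the joint law on boxes contains both the marginals [g1] and independence. [P] is a
    mere measure, so that a product [P \x P'] can be used as it stands. *)
Definition gfam d (T : measurableType d) (P : {measure set T -> \bar R})
    (I : finType) (X : I -> T -> R) : Prop :=
  (forall i, measurable_fun setT (X i)) /\
  forall A : I -> set R, (forall i, measurable (A i)) ->
    P [set t | forall i, A i (X i t)] = (\prod_(i : I) g1 R (A i))%E.

Section transfer.
Context d (T : measurableType d) (P : {measure set T -> \bar R}).
Context d' (T' : measurableType d') (P' : {measure set T' -> \bar R}).
Variable I : finType.

(** The two image measures on [vec R I] agree on boxes, a pi-system, hence everywhere. This is how a
    computation made with one realisation reaches another one: a different space, a product space,
    or the same family after a unitary map. *)
Lemma gfam_transfer (X : I -> T -> R) (X' : I -> T' -> R) (F : vec R I -> \bar R) :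
  gfam P X -> gfam P' X' -> measurable_fun setT F -> (forall v, 0 <= F v)%E ->
  (\int[P]_t F (fun i => X i t) = \int[P']_t F (fun i => X' i t))%E.
Proof.
move=> [mX PX] [mX' PX'] mF F0.
have mv : measurable_fun setT ((fun t i => X i t) : T -> vec R I) by exact: mfun_vec.
have mv' : measurable_fun setT ((fun t i => X' i t) : T' -> vec R I) by exact: mfun_vec.
rewrite -(@ge0_integral_image _ _ _ _ _ P _ mv (push P mv) F)//.
rewrite -(@ge0_integral_image _ _ _ _ _ P' _ mv' (push P mv) F)// => A mA.
rewrite -[RHS]/(push P' mv' A).
have H1 : forall B, vbox B -> push P mv B = push P' mv' B.
  by move=> _ [B mB ->]; exact: etrans (PX B mB) (esym (PX' B mB)).
have H2 : (push P mv setT < +oo)%E.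
  have := PX (fun=> setT) (fun=> measurableT).
  rewrite (_ : [set t | _] = setT); last by apply/seteqP; split.
  move=> E; have -> : push P mv setT = P setT by [].
  by rewrite E big1 ?ltry// => i _; exact: probability_setT.
have H3 : \bigcup_(k in [set: nat]) (setT : set (vec R I)) = setT.
  by apply/seteqP; split => // x _; exists 0%N.
exact: (@measure_unique _ R (vec R I) (@vbox R I) (fun=> setT) erefl (@vboxI R I)
  (fun=> @vboxT R I) H3 (push P mv) (push P' mv') H1 (fun=> H2) A mA).
Qed.
End transfer.

Section reindex.
Context d (T : measurableType d) (P : {measure set T -> \bar R}).
Variables (I J : finType) (phi : J -> I).
Hypothesis phi_inj : injective phi.

(** A box over [J] is a box over [I] whose sides off the range of [phi] are the whole line, each
    contributing a factor 1. *)
Lemma gfam_reindex (X : I -> T -> R) : gfam P X -> gfam P (fun j => X (phi j)).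
Proof.
move=> [mX PX]; split=> [j|A mA]; first exact: mX.
pose B i : set R := if [pick j | phi j == i] is Some j then A j else setT.
have Bphi j : B (phi j) = A j.
  rewrite /B; case: pickP => [k /eqP/phi_inj -> //|/(_ j)]; by rewrite eqxx.
have BN i : i \notin codom phi -> B i = setT.
  move=> iphi; rewrite /B; case: pickP => // j /eqP ji.
  by rewrite -ji codom_f in iphi.
have mB i : measurable (B i) by rewrite /B; case: pickP.
have -> : [set t | forall j, A j (X (phi j) t)] = [set t | forall i, B i (X i t)].
  apply/seteqP; split => t /= H; last by move=> j; rewrite -Bphi; exact: H.
  move=> i; rewrite /B; case: pickP => // j /eqP <-; exact: H.
rewrite PX// (bigID (mem (codom phi)))/= [X in (_ * X)%E]big1 ?mule1; last first.
  by move=> i /BN ->; exact: probability_setT.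
rewrite -big_uniq/=; last by rewrite map_inj_uniq ?enum_uniq.
by rewrite big_image/=; apply: eq_bigr => j _; rewrite Bphi.
Qed.
End reindex.

Section mix.
Context d (T : measurableType d) (P : {sigma_finite_measure set T -> \bar R}).
Context d' (T' : measurableType d') (P' : {sigma_finite_measure set T' -> \bar R}).
Variables (I : finType) (a : pred I).

Definition mix (x y : I -> R) : I -> R := fun i => if a i then x i else y i.

Lemma gfam_mix (X : I -> T -> R) (X' : I -> T' -> R) : gfam P X -> gfam P' X' ->
  gfam (P \x P')%E (fun i z => mix (X^~ z.1) (X'^~ z.2) i).
Proof.
move=> [mX PX] [mX' PX']; split=> [i|A mA].
  rewrite /mix; case: (a i).
    exact: (measurableT_comp (mX i) measurable_fst).
  exact: (measurableT_comp (mX' i) measurable_snd).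
pose A1 i := if a i then A i else setT.
pose A2 i := if a i then setT else A i.
have mA1 i : measurable (A1 i) by rewrite /A1; case: ifP.
have mA2 i : measurable (A2 i) by rewrite /A2; case: ifP.
have mS d0 (T0 : measurableType d0) (Y : I -> T0 -> R) (B : I -> set R) :
    (forall i, measurable_fun setT (Y i)) -> (forall i, measurable (B i)) ->
    measurable [set t | forall i, B i (Y i t)].
  move=> mY mB.
  have mv : measurable_fun setT ((fun t i => Y i t) : T0 -> vec R I) by exact: mfun_vec.
  rewrite -[X in measurable X]setTI.
  have mB' : measurable ([set f | forall i, B i (f i)] : set (vec R I)).
    by apply: measurable_vbox; exists B.
  exact: (mv measurableT _ mB').
have -> : [set z : T * T' | forall i, A i (mix (X^~ z.1) (X'^~ z.2) i)] =
    [set t | forall i, A1 i (X i t)] `*` [set t | forall i, A2 i (X' i t)].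
  apply/seteqP; split => z /=.
    move=> H; split => i; have := H i; rewrite /mix /A1 /A2; case: (a i) => //.
  by move=> [H1 H2] i; have := H1 i; have := H2 i; rewrite /mix /A1 /A2; case: (a i).
transitivity (P [set t | forall i, A1 i (X i t)] * P' [set t | forall i, A2 i (X' i t)])%E.
  by apply: product_measure1E; exact: mS.
rewrite PX// PX'// -big_split/=; apply: eq_bigr => i _.
by rewrite /A1 /A2; case: (a i); rewrite probability_setT ?mule1 ?mul1e.
Qed.

(** Independence as an iterated integral: the coordinates in [a] are frozen in the outer integral,
    the others are redrawn from an independent copy in the inner one. Taking the same space and
    family twice is allowed, so no further probability space is required. *)
Lemma gfam_split (X : I -> T -> R) (X' : I -> T' -> R) (F : vec R I -> \bar R) :
  gfam P X -> gfam P' X' -> measurable_fun setT F -> (forall v, 0 <= F v)%E ->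
  (\int[P]_t F (X^~ t) = \int[P]_t \int[P']_u F (mix (X^~ t) (X'^~ u)))%E.
Proof.
move=> gX gX' mF F0; have gm := gfam_mix gX gX'.
rewrite (gfam_transfer gX gm mF F0).
have mv : measurable_fun setT
    ((fun z => mix (X^~ z.1) (X'^~ z.2)) : T * T' -> vec R I).
  by apply: mfun_vec => i; exact: gm.1.
exact: (fubini_tonelli1 (fun z : T * T' => F (mix (X^~ z.1) (X'^~ z.2)))
  (measurableT_comp mF mv)).
Qed.
End mix.

End gfam.

(** * Changing single coordinates, and independence of disjoint blocks *)

Section coordinates.
Variables (R : realType) (I : finType).

Definition upd (v : I -> R) (i : I) (x : R) : I -> R := fun k => if k == i then x else v k.

Lemma mfun_upd d (T : measurableType d) (v : T -> I -> R) i (x : T -> R) :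
  (forall k, measurable_fun setT (fun t => v t k)) -> measurable_fun setT x ->
  measurable_fun setT ((fun t => upd (v t) i (x t)) : T -> vec R I).
Proof. by move=> mv mx; apply: mfun_vec => k; rewrite /upd; case: eqP. Qed.

Context d (T : measurableType d) (P : probability T R).
Variable X : I -> T -> R.
Hypothesis gX : gfam P X.

Lemma gfam_marginal i (f : R -> \bar R) : measurable_fun setT f -> (forall x, 0 <= f x)%E ->
  (\int[P]_t f (X i t) = \int[g1 R]_x f x)%E.
Proof.
move=> mf f0.
have mXi : measurable_fun setT (X i : T -> measurableTypeR R) := gX.1 i.
apply/esym; apply: (ge0_integral_image (m := P) mXi) => // A mA.
have := gX.2 (fun j => if j == i then A else setT).
rewrite (bigD1 i)//= eqxx big1 ?mule1; last first.
  by move=> j /negbTE ->; exact: probability_setT.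
move=> <-; last by move=> j; case: ifP.
congr (P _); apply/seteqP; split => t /=; first by move=> /(_ i); rewrite eqxx.
by move=> At j; case: eqP => // ->.
Qed.

Lemma gfam_coord i (F : vec R I -> \bar R) :
  measurable_fun setT F -> (forall v, 0 <= F v)%E ->
  (\int[P]_t F (X^~ t) = \int[P]_t \int[g1 R]_x F (upd (X^~ t) i x))%E.
Proof.
move=> mF F0; rewrite (gfam_split (predC1 i) gX gX mF F0).
apply: eq_integral => t _.
rewrite -(@gfam_marginal i (fun x => F (upd (X^~ t) i x)))//.
- apply: eq_integral => u _; congr (F _); apply/funext => k.
  by rewrite /mix /upd /=; case: eqP => //= ->.
- have mu : measurable_fun setT ((fun x => upd (X^~ t) i x) : R -> vec R I).
    by apply: mfun_upd => // k.
  exact: measurableT_comp mF mu.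
Qed.

Lemma gfam_change1 i (theta omega : R -> R) (F : vec R I -> \bar R) :
  measurable_fun setT theta -> measurable_fun setT omega -> (forall x, 0 <= omega x) ->
  (forall f : R -> \bar R, measurable_fun setT f -> (forall x, 0 <= f x)%E ->
     \int[g1 R]_x f (theta x) = \int[g1 R]_x (f x * (omega x)%:E))%E ->
  measurable_fun setT F -> (forall v, 0 <= F v)%E ->
  (\int[P]_t F (upd (X^~ t) i (theta (X i t))) = \int[P]_t (F (X^~ t) * (omega (X i t))%:E))%E.
Proof.
move=> mt mo o0 h mF F0.
have mc := @mfun_coord R I.
have mth : measurable_fun setT (fun v : vec R I => theta (v i)) by exact: (measurableT_comp mt (mc i)).
have moh : measurable_fun setT (fun v : vec R I => omega (v i)) by exact: (measurableT_comp mo (mc i)).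
have mu : measurable_fun setT ((fun v => upd v i (theta (v i))) : vec R I -> vec R I).
  by apply: mfun_upd.
have mF1 : measurable_fun setT (fun v : vec R I => F (upd v i (theta (v i)))).
  exact: (measurableT_comp mF mu).
have H1 := gfam_coord i mF1 (fun v => F0 _).
have mF2 : measurable_fun setT (fun v : vec R I => F v * (omega (v i))%:E)%E by mfun.
have F20 v : (0 <= F v * (omega (v i))%:E)%E by rewrite mule_ge0 ?lee_fin.
have H2 := gfam_coord i mF2 F20.
apply: etrans H1 (etrans _ (esym H2)).
apply: eq_integral => t _.
have updE x y : upd (upd (X^~ t) i x) i y = upd (X^~ t) i y.
  by apply/funext => k; rewrite /upd; case: eqP.
have updi x : upd (X^~ t) i x i = x by rewrite /upd eqxx.
have mut : measurable_fun setT ((fun x => upd (X^~ t) i x) : R -> vec R I).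
  by apply: mfun_upd => // k.
have H3 := h (fun x => F (upd (X^~ t) i x)) (measurableT_comp mF mut) (fun x => F0 _).
apply: etrans (etrans _ H3) _; apply: eq_integral => x _; rewrite ?updi ?updE//.
Qed.

(** Coordinates are changed one after another; since [s] is duplicate-free, the weights already
    collected do not involve the coordinate being changed. *)
Lemma gfam_change_seq (s : seq I) (theta omega : I -> R -> R) (F : vec R I -> \bar R) :
  uniq s ->
  (forall i, measurable_fun setT (theta i)) -> (forall i, measurable_fun setT (omega i)) ->
  (forall i x, 0 <= omega i x) ->
  (forall i (f : R -> \bar R), measurable_fun setT f -> (forall x, 0 <= f x)%E ->
     \int[g1 R]_x f (theta i x) = \int[g1 R]_x (f x * (omega i x)%:E))%E ->
  measurable_fun setT F -> (forall v, 0 <= F v)%E ->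
  (\int[P]_t F (fun i => if i \in s then theta i (X i t) else X i t) =
   \int[P]_t (F (X^~ t) * (\prod_(i <- s) omega i (X i t))%:E))%E.
Proof.
move=> us mt mo o0 h mF F0; have mc := @mfun_coord R I.
have mth i j : measurable_fun setT (fun v : vec R I => theta i (v j)) by exact: (measurableT_comp (mt i) (mc j)).
have moh i j : measurable_fun setT (fun v : vec R I => omega i (v j)) by exact: (measurableT_comp (mo i) (mc j)).
elim: s us F mF F0 => [_ F mF F0|i s IH /= /andP[si us] F mF F0].
  by apply: eq_integral => t _; rewrite big_nil mule1.
pose F1 (v : vec R I) := F (upd v i (theta i (v i))).
have mu : measurable_fun setT ((fun v => upd v i (theta i (v i))) : vec R I -> vec R I).
  by apply: mfun_upd.
have mF1 : measurable_fun setT F1 := measurableT_comp mF mu.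
have H1 := IH us F1 mF1 (fun v => F0 _).
pose F2 (v : vec R I) := (F v * (\prod_(j <- s) omega j (v j))%:E)%E.
have mF2 : measurable_fun setT F2 by rewrite /F2; mfun.
have F20 v : (0 <= F2 v)%E by rewrite mule_ge0// lee_fin prodr_ge0.
have H2 := gfam_change1 i (mt i) (mo i) (o0 i) (h i) mF2 F20.
apply: etrans (etrans _ H1) _.
  apply: eq_integral => t _; rewrite /F1; congr F; apply/funext => k.
  by rewrite /upd inE (negbTE si); case: eqP => // ->.
apply: etrans (etrans _ H2) _; apply: eq_integral => t _; rewrite /F2 /F1.
  congr (_ * _%:E)%E; apply: eq_big_seq => j js.
  by rewrite /upd; case: eqP => // ji; rewrite ji (negbTE si) in js.
by rewrite -muleA -EFinM big_cons mulrC.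
Qed.

Lemma gfam_change (a : pred I) (theta omega : I -> R -> R) (F : vec R I -> \bar R) :
  (forall i, measurable_fun setT (theta i)) -> (forall i, measurable_fun setT (omega i)) ->
  (forall i x, 0 <= omega i x) ->
  (forall i (f : R -> \bar R), measurable_fun setT f -> (forall x, 0 <= f x)%E ->
     \int[g1 R]_x f (theta i x) = \int[g1 R]_x (f x * (omega i x)%:E))%E ->
  measurable_fun setT F -> (forall v, 0 <= F v)%E ->
  (\int[P]_t F (fun i => if a i then theta i (X i t) else X i t) =
   \int[P]_t (F (X^~ t) * (\prod_(i | a i) omega i (X i t))%:E))%E.
Proof.
move=> mt mo o0 h mF F0.
have := gfam_change_seq (enum_uniq a) mt mo o0 h mF F0.
move=> H; apply: etrans (etrans _ H) _; apply: eq_integral => t _.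
  by congr F; apply/funext => i; rewrite mem_enum.
by rewrite big_enum.
Qed.

(** Block [k] is peeled off: after [gfam_split] its factor sees the outer copy only and the
    remaining factors the inner copy only, so the iterated integral factors. *)
Lemma gfam_indep (K : eqType) (s : seq K) (a : K -> pred I) (psi : K -> vec R I -> \bar R) :
  uniq s -> (forall j k i, a j i -> a k i -> j = k) ->
  (forall k, measurable_fun setT (psi k)) -> (forall k v, 0 <= psi k v)%E ->
  (forall k (v w : I -> R), (forall i, a k i -> v i = w i) -> psi k v = psi k w) ->
  (\int[P]_t \prod_(k <- s) psi k (X^~ t) = \prod_(k <- s) \int[P]_t psi k (X^~ t))%E.
Proof.
move=> us aK mp p0 dep; elim: s us => [_|k s IH /= /andP[ks us]].
  rewrite big_nil; under eq_integral do rewrite big_nil.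
  by rewrite integral_cst//= probability_setT mule1.
rewrite big_cons -IH//.
have prod0 v : (0 <= \prod_(j <- s) psi j v)%E by apply: prode_ge0.
have mprod : measurable_fun setT (fun v => \prod_(j <- s) psi j v)%E.
  exact: mfun_eprod.
have mX : measurable_fun setT ((fun t i => X i t) : T -> vec R I).
  by apply: mfun_vec; exact: gX.1.
pose F (v : vec R I) := (psi k v * \prod_(j <- s) psi j v)%E.
have mF : measurable_fun setT F by exact: emeasurable_funM.
have F0 v : (0 <= F v)%E by rewrite mule_ge0.
transitivity (\int[P]_t F (X^~ t))%E.
  by apply: eq_integral => t _; rewrite big_cons.
rewrite (gfam_split (a k) gX gX mF F0).
transitivity (\int[P]_t \int[P]_u (psi k (X^~ t) * \prod_(j <- s) psi j (X^~ u)))%E.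
  apply: eq_integral => t _; apply: eq_integral => u _; congr (_ * _)%E.
    by apply: dep => i aki; rewrite /mix aki.
  apply: eq_big_seq => j js; apply: dep => i aji; rewrite /mix; case: ifP => // aki.
  by rewrite (aK _ _ _ aki aji) js in ks.
under eq_integral => t _.
  rewrite ge0_integralZl//; [|exact: (measurableT_comp mprod mX)].
  over.
by rewrite /= ge0_integralZr//; [exact: (measurableT_comp (mp k) mX)|exact: integral_ge0].
Qed.

End coordinates.

(** * Unitary maps of Gaussian families *)

Section preserving.
Variables (R : realType) (I : finType).

Lemma gfam_of_integral d (T : measurableType d) (P : probability T R) (X : I -> T -> R)
    (Y : I -> T -> R) : gfam P X ->
  (forall i, measurable_fun setT (Y i)) ->
  (forall F : vec R I -> \bar R, measurable_fun setT F -> (forall v, 0 <= F v)%E ->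
    \int[P]_t F (Y^~ t) = \int[P]_t F (X^~ t))%E -> gfam P Y.
Proof.
move=> gX mY YX; split=> // A mA; rewrite -(gX.2 A mA).
have mB : measurable ([set f | forall i, A i (f i)] : set (vec R I)).
  by apply: measurable_vbox; exists A.
have key Z : (forall i, measurable_fun setT (Z i)) ->
    (P [set t | forall i, A i (Z i t)] =
     \int[P]_t (\1_([set f | forall i, A i (f i)] : set (vec R I)) (Z^~ t))%:E)%E.
  move=> mZ.
  have mv : measurable_fun setT ((fun t i => Z i t) : T -> vec R I) by exact: mfun_vec.
  have mZB : measurable [set t | forall i, A i (Z i t)].
    by rewrite -[X in measurable X]setTI; exact: (mv measurableT _ mB).
  rewrite -[X in P X]setIT -integral_indic//; apply: eq_integral => t _.
apply: etrans (key Y mY) (etrans _ (esym (key X gX.1))).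
apply: (YX (fun v : vec R I => (\1_([set f | forall i, A i (f i)] : set (vec R I)) v)%:E))
  => [|v]; last by rewrite lee_fin.
by apply/measurable_EFinP; exact: measurable_indic.
Qed.

(** Quantifying over all probability spaces and families makes such maps composable and lets a map
    built once be applied to any realisation. *)
Definition gpres (O : (I -> R) -> I -> R) : Prop :=
  measurable_fun setT (O : vec R I -> vec R I) /\
  forall d (T : measurableType d) (P : probability T R) (X : I -> T -> R),
    gfam P X -> gfam P (fun i t => O (X^~ t) i).

Lemma gpres_id : gpres id.
Proof. by split => //; exact: measurable_id. Qed.

Lemma gpres_comp O1 O2 : gpres O1 -> gpres O2 -> gpres (O1 \o O2).
Proof.
move=> [mO1 H1] [mO2 H2]; split; first exact: (measurableT_comp mO1 mO2).
by move=> d T P X gX; exact: (H1 _ _ _ _ (H2 _ _ _ _ gX)).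
Qed.

Definition plane_rot (i j : I) (c s : R) (v : I -> R) : I -> R :=
  upd (upd v i (c * v i - s * v j)) j (s * v i + c * v j).

Lemma gpres_rot i j c s : i != j -> c ^+ 2 + s ^+ 2 = 1 -> gpres (plane_rot i j c s).
Proof.
move=> ij cs; have mc := @mfun_coord R I.
have mr : measurable_fun setT (plane_rot i j c s : vec R I -> vec R I).
  apply: mfun_upd; last by mfun.
  by move=> k; rewrite /upd; case: eqP => _; mfun.
split=> // d T P X gX.
have mX : measurable_fun setT ((fun t i => X i t) : T -> vec R I).
  by apply: mfun_vec; exact: gX.1.
apply: (gfam_of_integral gX) => [k|F mF F0].
  exact: (measurableT_comp (mc k) (measurableT_comp mr mX)).
have two (G : vec R I -> \bar R) : measurable_fun setT G -> (forall v, 0 <= G v)%E ->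
    (\int[P]_t G (X^~ t) =
     \int[P]_t \int[g1 R]_y \int[g1 R]_x G (upd (upd (X^~ t) j y) i x))%E.
  move=> mG G0; rewrite (gfam_coord gX i mG G0).
  have mH : measurable_fun setT (fun v : vec R I => \int[g1 R]_x G (upd v i x))%E.
    have mGu : measurable_fun setT (fun z : vec R I * R => G (upd z.1 i z.2)).
      apply: (measurableT_comp mG); apply: mfun_upd => [k|]; last exact: measurable_snd.
      exact: (measurableT_comp (mc k) measurable_fst).
    have H := measurable_fun_fubini_tonelli_F (m2 := g1 R)
      (fun z : vec R I * R => G (upd z.1 i z.2)) mGu (fun z => G0 _).
    exact H.
  have H0 v : (0 <= \int[g1 R]_x G (upd v i x))%E by apply: integral_ge0.
  exact: (gfam_coord gX j mH H0).
have H1 := two _ (measurableT_comp mF mr) (fun v => F0 _).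
have H2 := two _ mF F0.
apply: etrans H1 (etrans _ (esym H2)); apply: eq_integral => t _.
pose G (y x : R) := F (upd (upd (X^~ t) j y) i x).
have mG : measurable_fun setT (fun z : R * R => G z.1 z.2).
  apply: (measurableT_comp mF); apply: mfun_upd => [k|]; last exact: measurable_snd.
  by rewrite /upd; case: eqP => _; mfun.
(* In [G] the coordinate [j] comes first, so the rotation is seen with the opposite angle. *)
have cs' : c ^+ 2 + (- s) ^+ 2 = 1 by rewrite sqrrN.
have H3 := g1_rot cs' mG (fun _ _ => F0 _).
apply: etrans _ H3; apply: eq_integral => y _; apply: eq_integral => x _.
rewrite /G /plane_rot /=; congr F; apply/funext => k; rewrite /upd eqxx.
rewrite (eq_sym j i) (negbTE ij) eqxx.
have [->|ki] := eqVneq k i; first by rewrite (negbTE ij); ring.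
by case: eqP => // _; ring.
Qed.

End preserving.

Section complex_rotations.
Variables (R : realType) (K : finType).
Local Notation I := (K * bool)%type.

Definition cx (v : I -> R) (k : K) : R[i] := mkC (v (k, false)) (v (k, true)).

(** Rotating the plane of real and imaginary parts multiplies by the phase conj u / |u|. Stating the
    relation after multiplication by |u| covers u = 0, where the identity map does. *)
Lemma gpres_phase (k : K) (u : R[i]) : exists O : (I -> R) -> I -> R,
  [/\ gpres O,
      forall v, rC (Num.sqrt (cnorm2 u)) * cx (O v) k = u^*%C * cx v k,
      forall v j b, j != k -> O v (j, b) = v (j, b) &
      forall v, cnorm2 (cx (O v) k) = cnorm2 (cx v k)].
Proof.
case: u => a b; rewrite /cnorm2 /=.
have [ab0|ab0] := eqVneq (a ^+ 2 + b ^+ 2) 0.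
  have [a0 b0] : a = 0 /\ b = 0.
    by move/eqP: ab0; rewrite paddr_eq0 ?sqr_ge0// !sqrf_eq0 => /andP[/eqP-> /eqP->].
  exists id; split => //.
  by move=> v; rewrite ab0 a0 b0 sqrtr0 oppr0 !mul0r.
pose r := Num.sqrt (a ^+ 2 + b ^+ 2).
have r2 : r ^+ 2 = a ^+ 2 + b ^+ 2 by rewrite sqr_sqrtr// addr_ge0 ?sqr_ge0.
have r0 : r != 0 by rewrite -sqrf_eq0 r2.
have cs : (a / r) ^+ 2 + (- b / r) ^+ 2 = 1.
  rewrite !expr_div_n sqrrN -mulrDl -r2 divff// expf_neq0//.
have kk : (k, false) != (k, true) by rewrite xpair_eqE andbF.
exists (plane_rot (k, false) (k, true) (a / r) (- b / r)); split.
- exact: gpres_rot.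
- move=> v; rewrite -/r /cx /plane_rot /upd /= !eqxx (negbTE kk) /=; apply/eqP; rewrite eq_complex /=.
  by apply/andP; split; apply/eqP; field.
- by move=> v j c jk; rewrite /plane_rot /upd !xpair_eqE (negbTE jk).
- move=> v; rewrite /plane_rot /upd /= !eqxx (negbTE kk) /=.
  rewrite -[RHS]mul1r -cs; ring.
Qed.

Lemma givens_coef (p q : R) : exists c s : R,
  [/\ c ^+ 2 + s ^+ 2 = 1, c * Num.sqrt (p ^+ 2 + q ^+ 2) = p &
      s * Num.sqrt (p ^+ 2 + q ^+ 2) = q].
Proof.
have [pq0|pq0] := eqVneq (p ^+ 2 + q ^+ 2) 0.
  exists 1, 0; rewrite pq0 sqrtr0 !mulr0 expr1n expr0n addr0.
  by move/eqP: pq0; rewrite paddr_eq0 ?sqr_ge0// !sqrf_eq0 => /andP[/eqP-> /eqP->].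
pose r := Num.sqrt (p ^+ 2 + q ^+ 2).
have r2 : r ^+ 2 = p ^+ 2 + q ^+ 2 by rewrite sqr_sqrtr// addr_ge0 ?sqr_ge0.
have r0 : r != 0 by rewrite -sqrf_eq0 r2.
exists (p / r), (q / r); split; rewrite -/r ?mulfVK//.
by rewrite !expr_div_n -mulrDl -r2 divff// expf_neq0.
Qed.

Lemma gpres_givens (k0 k1 : K) (c s : R) : k0 != k1 -> c ^+ 2 + s ^+ 2 = 1 ->
  exists O : (I -> R) -> I -> R,
  [/\ gpres O,
      forall v, cx (O v) k0 = rC c * cx v k0 + rC s * cx v k1,
      forall v, cx (O v) k1 = - rC s * cx v k0 + rC c * cx v k1 &
      forall v j b, j != k0 -> j != k1 -> O v (j, b) = v (j, b)].
Proof.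
move=> k01 cs; have cs' : c ^+ 2 + (- s) ^+ 2 = 1 by rewrite sqrrN.
have k10 : k1 != k0 by rewrite eq_sym.
have kb b : (k0, b) != (k1, b) by rewrite xpair_eqE (negbTE k01).
exists (plane_rot (k0, false) (k1, false) c (- s) \o plane_rot (k0, true) (k1, true) c (- s)); split.
- by apply: gpres_comp; apply: gpres_rot => //; rewrite kb.
- move=> v; rewrite /cx /plane_rot /upd /= !xpair_eqE !eqxx (negbTE k01) (negbTE k10) /=.
  by apply/eqP; rewrite eq_complex /=; apply/andP; split; apply/eqP; ring.
- move=> v; rewrite /cx /plane_rot /upd /= !xpair_eqE !eqxx (negbTE k01) (negbTE k10) /=.
  by apply/eqP; rewrite eq_complex /=; apply/andP; split; apply/eqP; ring.
- by move=> v j b j0 j1; rewrite /plane_rot /upd /= !xpair_eqE (negbTE j0) (negbTE j1).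
Qed.

Lemma cx_eq (v w : I -> R) k : (forall b, v (k, b) = w (k, b)) -> cx v k = cx w k.
Proof. by move=> vw; rewrite /cx !vw. Qed.

Lemma rCD (x y : R) : rC (x + y) = rC x + rC y.
Proof. by apply/eqP; rewrite eq_complex /= addr0 !eqxx. Qed.

Lemma rCM (x y : R) : rC (x * y) = rC x * rC y.
Proof. by apply/eqP; rewrite eq_complex /= !mul0r mulr0 subr0 addr0 !eqxx. Qed.

Lemma cnorm2_ge0 (z : R[i]) : 0 <= cnorm2 z.
Proof. by rewrite addr_ge0 ?sqr_ge0. Qed.

(** A unitary map that turns [u] onto the axis [k0]: coordinate [k0] of the image is the inner
    product with u / |u|. Each new coordinate is first turned by the phase of its entry, then merged
    into [k0] by a Givens rotation with the real coefficients p and q. That coordinates outside the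
    list stay put is recorded so that several blocks can be treated in turn. *)
Lemma gpres_reduce (u : K -> R[i]) (k0 : K) (s : seq K) : uniq (k0 :: s) ->
  exists O : (I -> R) -> I -> R,
  [/\ gpres O,
      forall v, rC (Num.sqrt (\sum_(k <- k0 :: s) cnorm2 (u k))) * cx (O v) k0 =
                \sum_(k <- k0 :: s) (u k)^*%C * cx v k,
      forall v j b, j \notin k0 :: s -> O v (j, b) = v (j, b) &
      forall v, \sum_(k <- k0 :: s) cnorm2 (cx (O v) k) = \sum_(k <- k0 :: s) cnorm2 (cx v k)].
Proof.
elim: s => [_|k1 s IH].
  have [ O [gO H1 H2 H3]] := gpres_phase k0 (u k0); exists O; split => //.
  - by move=> v; rewrite !big_seq1.
  - by move=> v j b; rewrite inE; exact: H2.
  - by move=> v; rewrite !big_seq1.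
rewrite /= inE negb_or => /andP[/andP[k01 k0s] /andP[k1s us]].
have /IH[ O1 [g1O A1 A2 A3]] : uniq (k0 :: s) by rewrite /= k0s.
have [ O2 [g2O B1 B2 B3]] := gpres_phase k1 (u k1).
pose p := Num.sqrt (\sum_(k <- k0 :: s) cnorm2 (u k)).
pose q := Num.sqrt (cnorm2 (u k1)).
have [c [s' [cs cp sq]]] := givens_coef p q.
have [ O3 [g3O C1 C2 C3]] := gpres_givens k01 cs.
have k10 : k1 != k0 by rewrite eq_sym.
have k1n : k1 \notin k0 :: s by rewrite inE negb_or k10.
have pq : \sum_(k <- [:: k0, k1 & s]) cnorm2 (u k) = p ^+ 2 + q ^+ 2.
  rewrite !sqr_sqrtr ?cnorm2_ge0//; last by apply: sumr_ge0 => k _; exact: cnorm2_ge0.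
  by rewrite !big_cons addrA addrAC.
have Bk0 v : cx (O2 v) k0 = cx v k0 by apply: cx_eq => b; apply: B2.
have Ak1 v : cx (O1 v) k1 = cx v k1 by apply: cx_eq => b; apply: A2.
have ks j : j \in s -> (j != k0) && (j != k1).
  by move=> js; apply/andP; split; apply/eqP => E; [move: k0s|move: k1s]; rewrite -E js.
exists (O3 \o (O2 \o O1)); split.
- by do 2 apply: gpres_comp => //.
- move=> v; rewrite pq /= C1 mulrDr !mulrA -!rCM ![_ * c]mulrC ![_ * s']mulrC cp sq.
  rewrite Bk0 A1 B1 Ak1 !big_cons; ring.
- move=> v j b; rewrite !inE !negb_or => /and3P[j0 j1 js].
  by rewrite /= C3// B2// A2// inE negb_or j0.
- move=> v; rewrite !big_cons /= C1 C2.
  have -> : \sum_(j <- s) cnorm2 (cx (O3 (O2 (O1 v))) j) = \sum_(j <- s) cnorm2 (cx (O1 v) j).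
    apply: eq_big_seq => j /ks/andP[j0 j1]; congr cnorm2; apply: cx_eq => b.
    by rewrite C3// B2.
  have := A3 v; rewrite !big_cons => E.
  rewrite [RHS]addrCA -E -(Ak1 v) -(B3 (O1 v)) Bk0 addrA [RHS]addrA; congr (_ + _).
  rewrite -[RHS]mul1r -cs /cnorm2.
  case: (cx (O1 v) k0) => a b; case: (cx (O2 (O1 v)) k1) => a' b' /=; ring.
Qed.

Lemma gpres_reduce_blocks (B : finType) (u : B -> K -> R[i]) (k0 : B -> K) (s : B -> seq K) :
  (forall b, uniq (k0 b :: s b)) ->
  (forall a b k, k \in k0 a :: s a -> k \in k0 b :: s b -> a = b) ->
  exists O : (I -> R) -> I -> R,
  [/\ gpres O,
      forall b v, rC (Num.sqrt (\sum_(k <- k0 b :: s b) cnorm2 (u b k))) * cx (O v) (k0 b) =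
                \sum_(k <- k0 b :: s b) (u b k)^*%C * cx v k,
      forall v j c, (forall b, j \notin k0 b :: s b) -> O v (j, c) = v (j, c) &
      forall b v, \sum_(k <- k0 b :: s b) cnorm2 (cx (O v) k) =
                  \sum_(k <- k0 b :: s b) cnorm2 (cx v k)].
Proof.
move=> us disj.
(* Relativised to [b \in enum B] so that induction on the list of blocks is possible; disjointness
   keeps the maps of different blocks from interfering. *)
suff [ O [gO H1 H2 H3 _]] : exists O : (I -> R) -> I -> R,
  [/\ gpres O,
      forall b v, b \in enum B ->
        rC (Num.sqrt (\sum_(k <- k0 b :: s b) cnorm2 (u b k))) * cx (O v) (k0 b) =
                \sum_(k <- k0 b :: s b) (u b k)^*%C * cx v k,
      forall v j c, (forall b, b \in enum B -> j \notin k0 b :: s b) -> O v (j, c) = v (j, c),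
      forall b v, b \in enum B -> \sum_(k <- k0 b :: s b) cnorm2 (cx (O v) k) =
                  \sum_(k <- k0 b :: s b) cnorm2 (cx v k) & true].
  exists O; split => //.
  - by move=> b v; apply: H1; rewrite mem_enum.
  - by move=> v j c jb; apply: H2 => b _; exact: jb.
  - by move=> b v; apply: H3; rewrite mem_enum.
elim: (enum B) (enum_uniq B) => [_|b bs IH /= /andP[bbs /IH[ O [gO H1 H2 H3 _]]]].
  by exists id; split.
have [ O' [gO' G1 G2 G3]] := gpres_reduce (u b) (us b).
have same a v k : a != b -> k \in k0 a :: s a -> cx (O' v) k = cx v k.
  move=> ab ka; apply: cx_eq => c; apply: G2; apply: contra ab => kb.
  by apply/eqP; exact: disj ka kb.
have same2 v k : k \in k0 b :: s b -> cx (O v) k = cx v k.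
  move=> kb; apply: cx_eq => c; apply: H2 => a abs; apply: contra bbs => ka.
  by rewrite (disj b a k kb ka).
have neq a : a \in bs -> a != b by apply: contraTneq => ->.
exists (O' \o O); split => //.
- exact: gpres_comp.
- move=> a v; rewrite inE => /predU1P[->|abs] /=.
    by rewrite G1; apply: eq_big_seq => k kb; rewrite same2.
  by rewrite (same a) ?neq ?mem_head// H1.
- move=> v j c jb /=; rewrite G2; last by apply: jb; rewrite mem_head.
  by apply: H2 => a abs; apply: jb; rewrite inE abs orbT.
- move=> a v; rewrite inE => /predU1P[->|abs] /=.
    by rewrite G3; apply: eq_big_seq => k kb; rewrite same2.
  by rewrite -[RHS]H3//; apply: eq_big_seq => k ka /=; rewrite (same a)// neq.
Qed.

End complex_rotations.

(** * Moments of uniform points on spheres and Bessel series *)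

Section calculus.
Variable R : realType.
Local Notation mu := (@lebesgue_measure R).

Lemma is_derive_continuous (f : R -> R) (x df : R) : is_derive x 1 f df -> {for x, continuous f}.
Proof.
by move=> [dfx _]; apply: differentiable_continuous; apply/derivable1_diffP.
Qed.

Lemma FTC2y_derive (f F : R -> R) (a l : R) :
  (forall x, a <= x -> 0 <= f x) -> (forall x, a <= x -> is_derive x 1 F (f x)) ->
  (forall x, a <= x -> {for x, continuous f}) ->
  F x @[x --> +oo] --> l ->
  (\int[mu]_(x in `[a, +oo[) (f x)%:E = (l - F a)%:E)%E.
Proof.
move=> f0 dF cf Fl; rewrite (@ge0_continuous_FTC2y _ f F a l)//.
- apply/continuous_within_itvcyP; split.
    by move=> x; rewrite in_itv/= andbT => /ltW; exact: cf.
  apply: cvg_at_right_filter; exact: cf.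
- by move=> x /ltW ax; have [] := dF _ ax.
- apply: cvg_at_right_filter; exact: (is_derive_continuous (dF _ (lexx a))).
- move=> x; rewrite in_itv/= andbT => /ltW ax; rewrite derive1E.
  by have [_ ->] := dF _ ax.
Qed.

Lemma sqr_shift_cvgy (r : R) : 0 < r -> (s ^+ 2 - 1) * r @[s --> +oo] --> +oo.
Proof.
move=> r0; under eq_fun do rewrite mulrC.
apply: gt0_cvgMry => //; apply/cvgryPge => A.
near=> s; rewrite lerBrDr.
by near: s; apply: (cvgryPge _).1; exact: cvgr_expr2.
Unshelve. all: by end_near. Qed.

Lemma is_derive_exp_shift (r s : R) :
  is_derive s 1 (fun s => - expR (- ((s ^+ 2 - 1) * r))) (2 * s * (r * expR (- ((s ^+ 2 - 1) * r)))).
Proof.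
have D1 : is_derive s 1 (fun s : R => - ((s ^+ 2 - 1) * r)) (- (2 * s * r)).
  rewrite (_ : (fun s => _) = (- r) *: ((@id R) ^+ 2 - cst 1)); last first.
    by apply/funext => x /=; rewrite !fctE /=; rewrite /GRing.scale /=; ring.
  by apply: is_derive_eq; rewrite /GRing.scale /=; ring.
have D2 := @is_derive1_comp _ expR (fun s : R => - ((s ^+ 2 - 1) * r)) s _ _
  (is_derive_expR _) D1.
rewrite (_ : (fun s => _) = - (expR \o (fun s : R => - ((s ^+ 2 - 1) * r)))) //.
by apply: is_derive_eq; ring.
Qed.

Lemma integral_exp_shift (r : R) : 0 < r ->
  (\int[mu]_(s in `[1%R, +oo[) (2 * s * (r * expR (- ((s ^+ 2 - 1) * r))))%:E = 1)%E.
Proof.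
move=> r0.
rewrite (@FTC2y_derive _ (fun s : R => - expR (- ((s ^+ 2 - 1) * r))) 1 0 _
  (fun s _ => is_derive_exp_shift r s)).
- by rewrite expr1n subrr mul0r oppr0 expR0 opprK add0r.
- by move=> s s1; rewrite !mulr_ge0 ?expR_ge0// ?ltW// (lt_le_trans ltr01).
- move=> s _; have := is_derive_continuous (is_derive_exp_shift r s) => c1.
  have -> : (fun s => 2 * s * (r * expR (- ((s ^+ 2 - 1) * r)))) =
      ((fun s : R => (- (2 * r)) * s) * (fun s => - expR (- ((s ^+ 2 - 1) * r)))).
    by apply/funext => x; rewrite !fctE; ring.
  by apply: continuousM => //; exact: mulrl_continuous.
- rewrite -oppr0; apply: cvgN.
  apply: (@cvg_comp _ _ _ (fun s : R => (s ^+ 2 - 1) * r) (fun x : R => expR (- x))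
    _ (pinfty_nbhs R)); last exact: cvgr_expR.
  exact: sqr_shift_cvgy.
Qed.

Lemma is_derive_invX (n : nat) (s : R) : s != 0 ->
  is_derive s 1 (fun s => s ^- n) (- (n%:R * s ^- n.+1)).
Proof.
move=> s0.
have D : is_derive s 1 (fun s : R => s ^+ n) (n%:R * s ^+ n.-1).
  rewrite (_ : (fun s => _) = (@id R) ^+ n); last by apply/funext => x; rewrite fctE.
  by apply: is_derive_eq; rewrite /GRing.scale /= mulr1.
have := is_deriveV (f := fun s : R => s ^+ n) _ D; rewrite expf_neq0// => /(_ isT) D2.
apply: is_derive_eq; rewrite /GRing.scale /=.
case: n {D D2} => [|n] /=; first by rewrite !mul0r mulr0 oppr0.
have q0 : s ^+ n != 0 by rewrite expf_neq0.
rewrite !exprS; move: (s ^+ n) q0 => q q0.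
by field; rewrite s0 q0.
Qed.

Lemma integral_inv_exp (n : nat) :
  (\int[mu]_(s in `[1%R, +oo[) (2 * s ^- n.+2)%:E = (2 / n.+1%:R)%:E)%E.
Proof.
have pos (s : R) : 1 <= s -> 0 < s by exact: lt_le_trans ltr01.
have D (s : R) k : 1 <= s -> is_derive s 1 (fun s => s ^- k) (- (k%:R * s ^- k.+1)).
  by move=> /pos s0; apply: is_derive_invX; rewrite gt_eqF.
have DF (s : R) : 1 <= s ->
    is_derive s 1 ((- (2 / n.+1%:R)) *: (fun s : R => s ^- n.+1)) (2 * s ^- n.+2).
  move=> s1; have := D s n.+1 s1 => D1.
  by apply: is_derive_eq; rewrite /GRing.scale /=; field; apply/andP; split; [rewrite expf_neq0// gt_eqF ?pos | rewrite nat1r pnatr_eq0].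
rewrite (@FTC2y_derive _ ((- (2 / n.+1%:R)) *: (fun s : R => s ^- n.+1)) 1 0 _ DF).
- by rewrite fctE expr1n invr1 /GRing.scale /= mulr1 opprK add0r.
- by move=> s /pos s0; rewrite mulr_ge0 ?invr_ge0 ?exprn_ge0// ltW.
- move=> s s1; have c1 := is_derive_continuous (D s n.+2 s1).
  rewrite (_ : (fun s : R => 2 * s ^- n.+2) = (cst 2) * (fun s : R => s ^- n.+2)); last first.
    by apply/funext.
  by apply: continuousM => //; exact: cst_continuous.
- rewrite -(scaler0 _ (- (2 / n.+1%:R))).
  apply: cvgZr.
  apply/gtr0_cvgV0; first by near=> s; rewrite exprn_gt0.
  apply/cvgryPge => A; near=> s.
  have s1 : 1 <= s by [].
  by rewrite (@le_trans _ _ s)// exprS ler_peMr ?exprn_ege1// ltW// pos.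
Unshelve. all: by end_near. Qed.

(* [2 * s] on [1, +oo): integrating the scaling identity of the Gaussian weight
   against it trades one factor [r] for a rational constant. *)
Definition ray_weight (s : R) : R := 2 * s * \1_(`[1%R, +oo[%classic : set R) s.

Lemma measurable_ray_weight : measurable_fun setT ray_weight.
Proof.
rewrite /ray_weight; apply: measurable_funM; first by mfun.
by apply: measurable_indic.
Qed.

Lemma ray_weight_ge0 s : 0 <= ray_weight s.
Proof.
rewrite /ray_weight indicE; case: (boolP (s \in _)) => [|_]; last by rewrite mulr0.
by rewrite inE/= in_itv/= andbT mulr1 => s1; rewrite mulr_ge0// (le_trans ler01).
Qed.

Lemma ray_weight0 s : s < 1 -> ray_weight s = 0.
Proof.
move=> s1; rewrite /ray_weight indicE memNset ?mulr0//=.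
by rewrite in_itv/= andbT; apply/negP; rewrite -ltNge.
Qed.

Lemma integral_ray_weight (f : R -> R) :
  (\int[mu]_s (ray_weight s * f s)%:E = \int[mu]_(s in `[1%R, +oo[) (2 * s * f s)%:E)%E.
Proof.
rewrite [RHS]integral_mkcond; apply: eq_integral => s _.
rewrite patchE /ray_weight indicE; case: (s \in _); first by rewrite mulr1.
by rewrite mulr0 mul0r.
Qed.

Lemma integral_ray_exp (r : R) : 0 < r ->
  (\int[mu]_s (ray_weight s * (r * expR (- ((s ^+ 2 - 1) * r))))%:E = 1)%E.
Proof.
by move=> r0; rewrite (integral_ray_weight (fun s => r * expR (- ((s ^+ 2 - 1) * r)))) integral_exp_shift.
Qed.

Lemma integral_ray_inv (n : nat) :
  (\int[mu]_s (ray_weight s * s ^- n.+3)%:E = (2 / n.+1%:R)%:E)%E.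
Proof.
rewrite (integral_ray_weight (fun s => s ^- n.+3)) -integral_inv_exp.
apply: eq_integral => s; rewrite inE/= in_itv/= andbT => s1; congr EFin.
have s0 : s != 0 by rewrite gt_eqF// (lt_le_trans ltr01).
by rewrite [s ^+ n.+3]exprS invfM mulrA mulfK.
Qed.

End calculus.

(** * Radial recursion for homogeneous functions of a Gaussian vector *)

Section homogeneous.
Variables (R : realType) (J : finType).
Local Notation mu := (@lebesgue_measure R).
Context d (T : measurableType d) (P : probability T R).
Variable X : J -> T -> R.
Hypothesis gX : gfam P X.

Definition sqn (v : J -> R) : R := \sum_j v j ^+ 2.

Lemma mfun_sqn : measurable_fun setT (sqn : vec R J -> R).
Proof. by rewrite /sqn; have mc := @mfun_coord R J; mfun. Qed.

Lemma sqn_ge0 v : 0 <= sqn v.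
Proof. by apply: sumr_ge0 => j _; exact: sqr_ge0. Qed.

Lemma mX_vec : measurable_fun setT ((fun t j => X j t) : T -> vec R J).
Proof. by apply: mfun_vec; exact: gX.1. Qed.

Lemma gfam_scale (s : R) (G : vec R J -> \bar R) : 0 < s ->
  measurable_fun setT G -> (forall v, 0 <= G v)%E ->
  (\int[P]_t G (fun j => (X j t / s)%R) =
   \int[P]_t (G (X^~ t) * (s ^+ #|J| * expR (- ((s ^+ 2 - 1) * sqn (X^~ t))))%:E))%E.
Proof.
move=> s0 mG G0.
have H := @gfam_change R J d T P X gX predT (fun _ x => x / s)
  (fun _ x => s * expR (- ((s ^+ 2 - 1) * x ^+ 2))) G.
apply: etrans (H _ _ _ _ mG G0) _ => {H}.
- by move=> _; mfun.
- by move=> _; mfun.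
- by move=> _ x; rewrite mulr_ge0 ?expR_ge0// ltW.
- by move=> _ f mf f0; exact: g1_scale.
- apply: eq_integral => t _; congr (_ * _%:E)%E.
  rewrite big_split/= prodr_const -expR_sum; congr (_ * expR _).
  by rewrite sumrN mulr_sumr.
Qed.

Lemma gfam_sqn_eq0 (j0 : J) : P.-negligible [set t | sqn (X^~ t) = 0].
Proof.
have mX0 : measurable [set t | X j0 t = 0].
  rewrite (_ : [set t | _] = X j0 @^-1` [set 0])//.
  by rewrite -[X in measurable X]setTI; exact: (gX.1 j0).
exists [set t | X j0 t = 0]; split => //; last first.
  move=> t /eqP; rewrite /sqn psumr_eq0; last by move=> *; exact: sqr_ge0.
  by move=> /allP/(_ j0)/=; rewrite mem_index_enum sqrf_eq0 => /(_ isT)/eqP.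
have -> : P [set t | X j0 t = 0] = (\int[P]_t (\1_([set 0] : set R) (X j0 t))%:E)%E.
  rewrite -[X in P X]setIT -integral_indic//.
rewrite (gfam_marginal gX j0 (f := fun x => (\1_([set 0] : set R) x)%:E)).
- rewrite integral_indic// setIT.
  have /null_content_dominatesP := @normal_prob_dominates R 0 (Num.sqrt (1 / 2)).
  by apply => //; exact: lebesgue_measure_set1.
- by apply/measurable_EFinP; exact: measurable_indic.
- by move=> x; rewrite lee_fin.
Qed.

(** This is the recursion Gamma (a + 1) = a Gamma (a) with a = (e + #|J|) / 2, obtained without
    polar coordinates. For G = F |X|^2, scaling by s gives E (G exp (- (s^2 - 1) |X|^2)) = s^(- n -
    3) E G. Both sides are integrated against 2 s ds over [1, +oo): on the left 2 s |X|^2 exp (-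
    (s^2 - 1) |X|^2) integrates to 1 and leaves E F, on the right 2 s^(- n - 2) integrates to 2 / (n
    + 1). *)
Lemma gfam_homogeneous (j0 : J) (F : vec R J -> R) (e n : nat) :
  measurable_fun setT F -> (forall v, 0 <= F v) ->
  (forall s v, 0 < s -> F (fun j => v j / s) = s ^- e * F v) ->
  (e + #|J| = n.+1)%N ->
  (\int[P]_t (F (X^~ t))%:E =
   (2 / n.+1%:R)%:E * \int[P]_t (F (X^~ t) * sqn (X^~ t))%:E)%E.
Proof.
move=> mF F0 hF en.
pose G (v : vec R J) := F v * sqn v.
have msq := mfun_sqn.
have mG : measurable_fun setT G by rewrite /G; mfun.
have mGX : measurable_fun setT (fun t => G (X^~ t)) := measurableT_comp mG mX_vec.
have mFX : measurable_fun setT (fun t => F (X^~ t)) := measurableT_comp mF mX_vec.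
have msX : measurable_fun setT (fun t => sqn (X^~ t)) := measurableT_comp msq mX_vec.
have G0 v : 0 <= G v by rewrite mulr_ge0 ?sqn_ge0.
have mw := @measurable_ray_weight R.
have hG s v : 0 < s -> G (fun j => v j / s) = s ^- e.+2 * G v.
  move=> s0; rewrite /G hF//.
  have -> : sqn (fun j => v j / s) = s ^- 2 * sqn v.
    by rewrite /sqn mulr_sumr; apply: eq_bigr => j _; rewrite expr_div_n mulrC.
  by rewrite -(addn2 e) (exprD s e 2) (invfM (s ^+ e) (s ^+ 2)) mulrACA.
have scale s : 0 < s -> (\int[P]_t (G (X^~ t) * expR (- ((s ^+ 2 - 1) * sqn (X^~ t))))%:E
    = (s ^- n.+3)%:E * \int[P]_t (G (X^~ t))%:E)%E.
  move=> s0; have sn0 k : s ^+ k != 0 by rewrite expf_neq0// gt_eqF.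
  have mE : measurable_fun setT (EFin \o G) by exact/measurable_EFinP.
  have E := gfam_scale s0 mE (fun v => G0 v).
  have E1 : (\int[P]_t (G (fun j => (X j t / s)%R))%:E =
      (s ^- e.+2)%:E * \int[P]_t (G (X^~ t))%:E)%E.
    rewrite -ge0_integralZl_EFin//; last 3 first.
    - by move=> t _; rewrite lee_fin.
    - by apply/measurable_EFinP.
    - by rewrite invr_ge0 exprn_ge0// ltW.
    by apply: eq_integral => t _; rewrite hG// EFinM.
  have E2 : (\int[P]_t ((G (X^~ t))%:E * (s ^+ #|J| * expR (- ((s ^+ 2 - 1) * sqn (X^~ t))))%:E) =
      (s ^+ #|J|)%:E * \int[P]_t (G (X^~ t) * expR (- ((s ^+ 2 - 1) * sqn (X^~ t))))%:E)%E.
    rewrite -ge0_integralZl_EFin//; last 3 first.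
    - by move=> t _; rewrite lee_fin mulr_ge0 ?expR_ge0.
    - by mfun.
    - by rewrite exprn_ge0// ltW.
    by apply: eq_integral => t _; rewrite -!EFinM; congr EFin; ring.
  have := etrans (esym E1) (etrans E E2).
  move=> /(congr1 (fun z => (s ^- #|J|)%:E * z)%E).
  rewrite !muleA -!EFinM mulVf// mul1e => <-; congr (_%:E * _)%E.
  by rewrite -invfM -exprD addnC addSn addSn en.
have key : (\int[P]_t \int[mu]_s (F (X^~ t) * (ray_weight s *
      (sqn (X^~ t) * expR (- ((s ^+ 2 - 1) * sqn (X^~ t))))))%:E =
    (2 / n.+1%:R)%:E * \int[P]_t (G (X^~ t))%:E)%E.
  rewrite (fubini_tonelli (m1 := P) (m2 := mu) (fun z => (F (X^~ z.1) * (ray_weight z.2 *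
      (sqn (X^~ z.1) * expR (- ((z.2 ^+ 2 - 1) * sqn (X^~ z.1))))))%:E))/=; last 2 first.
  - have m1 : measurable_fun setT (fun z : T * R => F (X^~ z.1)) := measurableT_comp mFX measurable_fst.
    have m2 : measurable_fun setT (fun z : T * R => sqn (X^~ z.1)) := measurableT_comp msX measurable_fst.
    have m3 : measurable_fun setT (fun z : T * R => ray_weight z.2) := measurableT_comp mw measurable_snd.
    by mfun.
  - by move=> z; rewrite lee_fin mulr_ge0 ?F0// mulr_ge0 ?ray_weight_ge0// mulr_ge0 ?expR_ge0 ?sqn_ge0.
  transitivity (\int[mu]_s ((ray_weight s * s ^- n.+3)%:E * \int[P]_t (G (X^~ t))%:E))%E.
    apply: eq_integral => s _; have [s1|s1] := ltP s 1.
      rewrite ray_weight0// mul0r mul0e integral0_eq// => t _.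
      by rewrite mul0r mulr0.
    have s0 : 0 < s by rewrite (lt_le_trans ltr01).
    rewrite EFinM -muleA -scale// -ge0_integralZl_EFin//; last 3 first.
    - by move=> t _; rewrite lee_fin mulr_ge0 ?expR_ge0.
    - by mfun.
    - exact: ray_weight_ge0.
    by apply: eq_integral => t _; rewrite -EFinM /G; congr EFin; ring.
  have mwi : measurable_fun setT (fun s : R => (ray_weight s * s ^- n.+3)%:E) by mfun.
  rewrite ge0_integralZr//; last 2 first.
  - move=> s _; rewrite lee_fin; have [s1|s1] := ltP s 1.
      by rewrite ray_weight0// mul0r.
    by rewrite mulr_ge0 ?ray_weight_ge0// invr_ge0 exprn_ge0// (le_trans ler01).
  - by apply: integral_ge0 => t _; rewrite lee_fin.
  by rewrite integral_ray_inv.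
rewrite -[RHS]key.
pose H (z : T * R) := (F (X^~ z.1) * (ray_weight z.2 *
      (sqn (X^~ z.1) * expR (- ((z.2 ^+ 2 - 1) * sqn (X^~ z.1))))))%:E.
have mH : measurable_fun setT H.
  have m1 : measurable_fun setT (fun z : T * R => F (X^~ z.1)) := measurableT_comp mFX measurable_fst.
  have m2 : measurable_fun setT (fun z : T * R => sqn (X^~ z.1)) := measurableT_comp msX measurable_fst.
  have m3 : measurable_fun setT (fun z : T * R => ray_weight z.2) := measurableT_comp mw measurable_snd.
  by rewrite /H; mfun.
have H0 z : (0 <= H z)%E.
  by rewrite lee_fin mulr_ge0 ?F0// mulr_ge0 ?ray_weight_ge0// mulr_ge0 ?expR_ge0 ?sqn_ge0.
have mHF := measurable_fun_fubini_tonelli_F (m2 := mu) H mH H0.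
(* The inner integral over s equals 1 only where |X|^2 > 0, so equality holds off the null set of
   [gfam_sqn_eq0]. *)
apply: ge0_ae_eq_integral => //.
- by apply/measurable_EFinP.
- by move=> t _; rewrite lee_fin.
- by move=> t _; apply: integral_ge0 => s _; exact: (H0 (t, s)).
have [N [mN N0 subN]] := gfam_sqn_eq0 j0; exists N; split => // t /= nt.
apply: subN => /=; apply: contrapT => st; apply: nt => _.
have s0 : 0 < sqn (X^~ t) by rewrite lt_neqAle sqn_ge0 andbT eq_sym; apply/eqP.
under eq_integral do rewrite EFinM.
rewrite ge0_integralZl_EFin//; last 2 first.
- move=> s _; rewrite lee_fin mulr_ge0 ?ray_weight_ge0// mulr_ge0 ?expR_ge0 ?sqn_ge0//.
- by mfun.
by rewrite integral_ray_exp// mule1.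
Qed.

End homogeneous.

(** * Power series and Gamma integrals *)

Section series_facts.
Variable R : realType.
Local Notation mu := (@lebesgue_measure R).

Lemma nneseries_of_cvg (u : nat -> R) (l : R) : series u @ \oo --> l ->
  (\sum_(k <oo) (u k)%:E = l%:E)%E.
Proof.
move=> ul; apply/cvg_lim => //.
rewrite (_ : (fun n => _) = EFin \o series u).
  by apply: cvg_EFin => //; apply: nearW.
by apply/funext => n /=; rewrite /series /= sumEFin.
Qed.

Lemma cvg_expR (x : R) : series (exp_coeff x) @ \oo --> expR x.
Proof. exact: is_cvg_series_exp_coeff. Qed.

Lemma cosh_series (x : R) :
  (\sum_(k <oo) (x ^+ k.*2 / (k.*2)`!%:R)%:E = ((expR x + expR (- x)) / 2)%:E)%E.
Proof.
apply: nneseries_of_cvg.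
have c2 : (fun n => (series (exp_coeff x) n + series (exp_coeff (- x)) n) / 2) @ \oo -->
    (expR x + expR (- x)) / 2.
  by apply: cvgMl; apply: cvgD; exact: cvg_expR.
(* Odd terms of the two exponential series cancel, so n terms of the even series correspond to 2 n
   terms of the exponentials. *)
have -> : series (fun k => x ^+ k.*2 / (k.*2)`!%:R) =
    (fun n => (series (exp_coeff x) n + series (exp_coeff (- x)) n) / 2) \o double.
  apply/funext => n /=; elim: n => [|n IH].
    by rewrite /series /= !big_geq// addr0 mul0r.
  rewrite doubleS !seriesSr IH /exp_coeff /= !(exprNn x) (exprS x).
  have -> : (-1) ^+ n.*2 = 1 :> R by rewrite -signr_odd odd_double.
  have -> : (-1) ^+ n.*2.+1 = -1 :> R by rewrite -signr_odd /= odd_double.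
  by rewrite mul1r; field; rewrite !pnatr_eq0 -!lt0n !fact_gt0.
have d2 : double n @[n --> \oo] --> \oo.
  apply/cvgnyPge => A; near=> n; rewrite -addnn; apply: leq_trans (leq_addr _ _).
  by near: n; exact: nbhs_infty_ge.
apply: cvg_comp; [exact: d2|exact: c2].
Unshelve. all: by end_near. Qed.

(* The entire series for which [besselI nu (2 sqrt w) = sqrt w ^ nu * bessel_series nu w]. *)
Definition bessel_series (nu : nat) (w : R) : R :=
  limn (series (fun k => w ^+ k / (k`!%:R * (k + nu)`!%:R))).

Lemma cvg_bessel_series (nu : nat) (w : R) : 0 <= w ->
  series (fun k => w ^+ k / (k`!%:R * (k + nu)`!%:R)) @ \oo --> bessel_series nu w.
Proof.
move=> w0; apply: (@series_le_cvg _ _ (exp_coeff w)).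
- by move=> n; rewrite divr_ge0 ?exprn_ge0// mulr_ge0.
- by move=> n; rewrite /exp_coeff /= divr_ge0 ?exprn_ge0.
- move=> n; have p k : 0 < k`!%:R :> R by rewrite ltr0n fact_gt0.
  rewrite /exp_coeff /= ler_wpM2l ?exprn_ge0// lef_pV2 ?posrE ?mulr_gt0//.
  by rewrite -natrM ler_nat leq_pmulr// fact_gt0.
- exact: is_cvg_series_exp_coeff.
Qed.

Lemma nneseries_bessel (nu : nat) (w : R) : 0 <= w ->
  (\sum_(k <oo) (w ^+ k / (k`!%:R * (k + nu)`!%:R))%:E = (bessel_series nu w)%:E)%E.
Proof. by move=> w0; apply: nneseries_of_cvg; exact: cvg_bessel_series. Qed.

Lemma besselI_sqrt (nu : nat) (w : R) : 0 <= w ->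
  besselI nu (2 * Num.sqrt w) = Num.sqrt w ^+ nu * bessel_series nu w.
Proof.
move=> w0; apply/cvg_lim => //.
have -> : series (fun k => (2 * Num.sqrt w / 2) ^+ (2 * k + nu)%N / (k`!%:R * (k + nu)`!%:R)) =
    (fun n => Num.sqrt w ^+ nu * series (fun k => w ^+ k / (k`!%:R * (k + nu)`!%:R)) n).
  apply/funext => n; rewrite /series /= mulr_sumr; apply: eq_bigr => k _.
  rewrite [2 * _]mulrC mulfK ?pnatr_eq0// exprD exprM sqr_sqrtr//.
  by rewrite mulrAC mulrA mulrC mulrA.
by apply: cvgMr; exact: cvg_bessel_series.
Qed.

Lemma cvg_expnMexpN (n : nat) : x ^+ n * expR (- x) @[x --> +oo] --> (0 : R).
Proof.
have b (x : R) : 0 < x -> x ^+ n * expR (- x) <= n.+1`!%:R * x^-1.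
  move=> x0; rewrite expRN ler_pdivrMr ?expR_gt0// mulrAC ler_pdivlMr// -exprSr.
  rewrite -ler_pdivrMl ?ltr0n ?fact_gt0// mulrC; apply: le_trans (expR_ge1Dxn n (ltW x0)).
  by rewrite lerDr.
apply: (@squeeze_cvgr _ _ _ _ (fun=> 0) (fun x : R => n.+1`!%:R * x^-1)).
- by near=> x; rewrite mulr_ge0 ?exprn_ge0 ?expR_ge0//= b.
- exact: cvg_cst.
- rewrite -[X in _ --> X](mulr0 (n.+1`!%:R : R)); apply: cvgMr.
  by apply/gtr0_cvgV0; [near=> x|exact: cvg_id].
Unshelve. all: by end_near. Qed.

(** An antiderivative of z ^ n exp (- z), the recursion being integration by parts; it tends to 0 at
    infinity, so its value - n! at 0 gives the Gamma integral. *)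
Fixpoint gamma_prim (n : nat) (z : R) : R :=
  if n is n'.+1 then - (z ^+ n * expR (- z)) + n%:R * gamma_prim n' z else - expR (- z).

Lemma is_derive_expRN (z : R) : is_derive z 1 (fun z => expR (- z)) (- expR (- z)).
Proof.
have D0 : is_derive z 1 (-%R : R -> R) (-1).
  by rewrite (_ : -%R = - (@id R)); [apply: is_derive_eq|apply/funext].
have D := @is_derive1_comp _ expR -%R z _ _ (is_derive_expR (- z)) D0.
by apply: is_derive_eq; rewrite mulrN1.
Qed.

Lemma is_derive_gamma_prim n (z : R) : is_derive z 1 (gamma_prim n) (z ^+ n * expR (- z)).
Proof.
have DN := is_derive_expRN z.
elim: n => [|n IH].
  rewrite expr0 mul1r (_ : gamma_prim 0 = - (fun z => expR (- z)))//.
  by apply: is_derive_eq; rewrite opprK.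
have DX : is_derive z 1 (fun z : R => z ^+ n.+1) (n.+1%:R * z ^+ n).
  rewrite (_ : (fun s => _) = (@id R) ^+ n.+1); last by apply/funext => x; rewrite fctE.
  by apply: is_derive_eq; rewrite /GRing.scale /= mulr1.
rewrite (_ : gamma_prim n.+1 = - ((fun z => z ^+ n.+1) * (fun z => expR (- z))) +
    n.+1%:R *: gamma_prim n); last by apply/funext.
have DD := is_deriveD (is_deriveN (is_deriveM DX DN)) (is_deriveZ n.+1%:R IH).
suff -> : z ^+ n.+1 * expR (- z) = - (z ^+ n.+1 *: - expR (- z) +
    expR (- z) *: (n.+1%:R * z ^+ n)) + n.+1%:R *: (z ^+ n * expR (- z)) by [].
rewrite /GRing.scale /= exprS.
by move: (z ^+ n) (expR (- z)) (n.+1%:R) => q e c; ring.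
Qed.

Lemma gamma_prim0 n : gamma_prim n 0 = - n`!%:R.
Proof.
elim: n => [|n IH] /=; first by rewrite oppr0 expR0.
by rewrite IH expr0n /= mul0r oppr0 add0r factS natrM mulrN.
Qed.

Lemma cvg_gamma_prim n : gamma_prim n x @[x --> +oo] --> (0 : R).
Proof.
elim: n => [|n IH] /=; first by rewrite -oppr0; apply: cvgN; exact: cvgr_expR.
rewrite -[X in _ --> X](addr0 0) -{1}oppr0 -[X in _ --> _ + X](mulr0 (n.+1%:R : R)).
by apply: cvgD; [apply: cvgN; exact: cvg_expnMexpN|exact: cvgMr].
Qed.

Lemma integral_gamma1 n :
  (\int[mu]_(z in `[0%R, +oo[) (z ^+ n * expR (- z))%:E = n`!%:R%:E)%E.
Proof.
have c k : continuous (fun z : R => z ^+ k) by exact: exprn_continuous.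
rewrite (@FTC2y_derive _ _ (gamma_prim n) 0 0 _ (fun z _ => is_derive_gamma_prim n z)).
- by rewrite gamma_prim0 opprK add0r.
- by move=> z z0; rewrite mulr_ge0 ?exprn_ge0 ?expR_ge0.
- move=> z _; have := is_derive_continuous (is_derive_expRN z) => cN.
  rewrite (_ : (fun z => _) = (fun z => z ^+ n) * (fun z => expR (- z))); last exact/funext.
  by apply: continuousM => //; exact: c.
- exact: cvg_gamma_prim.
Qed.

Lemma integral_gamma n (a : R) : 0 < a ->
  (\int[mu]_(z in `[0%R, +oo[) (z ^+ n * expR (- (a * z)))%:E = (n`!%:R * a ^- n.+1)%:E)%E.
Proof.
move=> a0.
pose f (z : R) := (\1_(`[0%R, +oo[%classic : set R) z * (z ^+ n * expR (- z)))%:E.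
have mf : measurable_fun setT f.
  have mi : measurable_fun setT (\1_(`[0%R, +oo[%classic : set R) : R -> R).
    by apply: measurable_indic.
  by rewrite /f; mfun.
have f0 z : (0 <= f z)%E.
  rewrite /f lee_fin indicE; case: (boolP (z \in _)); last by rewrite mul0r.
  by rewrite inE/= in_itv/= andbT mul1r => z0; rewrite mulr_ge0 ?exprn_ge0 ?expR_ge0.
have restrictE (g : R -> R) : (\int[mu]_(z in `[0%R, +oo[) (g z)%:E =
    \int[mu]_z (\1_(`[0%R, +oo[%classic : set R) z * g z)%:E)%E.
  rewrite [LHS]integral_mkcond; apply: eq_integral => z _.
  by rewrite patchE indicE; case: ifP; rewrite ?mul1r ?mul0r.
have := ge0_integral_affine 0 a0 mf f0.
rewrite -[X in (_ * X)%E]restrictE integral_gamma1.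
move=> /(congr1 (fun z => (a ^- n)%:E * z)%E).
rewrite -!EFinM mulrA -invfM -exprSr mulrC => <-.
have ma : measurable_fun setT (fun x : R => 0 + a * x) by mfun.
have mfa := measurableT_comp mf ma.
rewrite restrictE -ge0_integralZl_EFin//; last by rewrite invr_ge0 exprn_ge0// ltW.
apply: eq_integral => z _; rewrite /f add0r -EFinM; congr EFin.
have -> : (\1_(`[0%R, +oo[%classic : set R) (a * z) : R) = \1_(`[0%R, +oo[%classic : set R) z.
  rewrite !indicE; congr ((nat_of_bool _)%:R).
  by apply/idP/idP; rewrite !inE/= !in_itv/= !andbT pmulr_rge0.
by rewrite exprMn; field; rewrite expf_neq0// gt_eqF.
Qed.

End series_facts.

Lemma evenX_ge0 (R : realType) (x : R) k : 0 <= x ^+ k.*2.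
Proof. by rewrite -mul2n exprM exprn_ge0// sqr_ge0. Qed.

Lemma sphere_scale (R : realType) (s x b : R) (j n : nat) : s != 0 ->
  x ^+ (j + n).*2 / s ^+ (j + n).*2 * (s ^- 2 * b) ^- n = s ^- j.*2 * (x ^+ (j + n).*2 * b ^- n).
Proof.
move=> s0; have sk k : s ^+ k != 0 by rewrite expf_neq0.
have -> : (s ^- 2 * b) ^- n = s ^+ n.*2 * b ^- n.
  by rewrite exprMn exprVn -exprM mul2n invfM invrK.
rewrite doubleD (exprD s); move: (x ^+ _) (b ^- n) (sk n.*2) (sk j.*2) => y c.
by move: (s ^+ n.*2) (s ^+ j.*2) => p q p0 q0; field; rewrite p0 q0.
Qed.

(** * Moments of a spherical coordinate and their generating function *)

Section moments.
Variables (R : realType) (J : finType).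
Local Notation mu := (@lebesgue_measure R).
Context d (T : measurableType d) (P : probability T R).
Variable X : J -> T -> R.
Hypothesis gX : gfam P X.

(** The half turn of the plane (i, j) preserves the law and flips the sign of [psi], so exp may be
    replaced by cosh. The series of cosh has nonnegative terms and is integrated term by term with
    no bound on [psi]. *)
Lemma gfam_sym_series (i j : J) (Phi psi : vec R J -> R) : i != j ->
  measurable_fun setT Phi -> measurable_fun setT psi -> (forall v, 0 <= Phi v) ->
  (forall v, Phi (plane_rot i j (-1) 0 v) = Phi v) ->
  (forall v, psi (plane_rot i j (-1) 0 v) = - psi v) ->
  (\int[P]_t (Phi (X^~ t) * expR (psi (X^~ t)))%:E =
   \sum_(k <oo) \int[P]_t (Phi (X^~ t) * (psi (X^~ t) ^+ k.*2 / (k.*2)`!%:R))%:E)%E.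
Proof.
move=> ij mPhi mpsi Phi0 Phis psis.
have mX := mX_vec gX.
have mPX : measurable_fun setT (fun t => Phi (X^~ t)) := measurableT_comp mPhi mX.
have mpX : measurable_fun setT (fun t => psi (X^~ t)) := measurableT_comp mpsi mX.
rewrite -integral_nneseries//; last 2 first.
- by move=> k; mfun.
- by move=> k t _; rewrite lee_fin mulr_ge0// divr_ge0// evenX_ge0.
have hc : (-1 : R) ^+ 2 + 0 ^+ 2 = 1 by rewrite sqrrN expr1n expr0n addr0.
have [_ gO] := gpres_rot ij hc.
have mF : measurable_fun setT (fun v : vec R J => (Phi v * expR (psi v))%:E) by mfun.
have F0 v : (0 <= (Phi v * expR (psi v))%:E)%E by rewrite lee_fin mulr_ge0 ?expR_ge0.
have H := gfam_transfer gX (gO _ _ _ _ gX) mF F0.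
have E : (\int[P]_t (Phi (X^~ t) * expR (psi (X^~ t)))%:E =
          \int[P]_t (Phi (X^~ t) * expR (- psi (X^~ t)))%:E)%E.
  apply: etrans H _; apply: eq_integral => t _.
  by have := Phis (X^~ t); have := psis (X^~ t); rewrite /= => -> ->.
transitivity (\int[P]_t (Phi (X^~ t) * ((expR (psi (X^~ t)) + expR (- psi (X^~ t))) / 2))%:E)%E;
  last first.
  apply: eq_integral => t _.
  under eq_eseriesr do rewrite EFinM.
  rewrite nneseriesZl; last first.
    by move=> k _; rewrite lee_fin divr_ge0// evenX_ge0.
  by rewrite cosh_series EFinM.
(* Valid at infinite values too, because the integral is not known to be finite here. *)
have half x : (x = (1 / 2)%:E * (x + x) :> \bar R)%E.
  case: x => [x| |]; last 2 first.
  - by rewrite /= gt0_muley// lte_fin; lra.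
  - by rewrite /= gt0_muleNy// lte_fin; lra.
  by rewrite -EFinD -EFinM; congr EFin; field.
transitivity ((1 / 2)%:E * (\int[P]_t (Phi (X^~ t) * expR (psi (X^~ t)))%:E +
    \int[P]_t (Phi (X^~ t) * expR (- psi (X^~ t)))%:E))%E; first by rewrite -E; exact: half.
have A0 t : [set: T] t -> (0 <= (Phi (X^~ t) * expR (psi (X^~ t)))%:E)%E.
  by move=> _; rewrite lee_fin mulr_ge0 ?expR_ge0.
have B0 t : [set: T] t -> (0 <= (Phi (X^~ t) * expR (- psi (X^~ t)))%:E)%E.
  by move=> _; rewrite lee_fin mulr_ge0 ?expR_ge0.
have mA : measurable_fun setT (fun t => (Phi (X^~ t) * expR (psi (X^~ t)))%:E) by mfun.
have mB : measurable_fun setT (fun t => (Phi (X^~ t) * expR (- psi (X^~ t)))%:E) by mfun.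
rewrite -(ge0_integralD P measurableT A0 mA B0 mB).
have mS : measurable_fun setT (fun t => (Phi (X^~ t) * expR (psi (X^~ t)))%:E +
    (Phi (X^~ t) * expR (- psi (X^~ t)))%:E)%E by apply: emeasurable_funD; mfun.
have S0 t : [set: T] t -> (0 <= (Phi (X^~ t) * expR (psi (X^~ t)))%:E +
    (Phi (X^~ t) * expR (- psi (X^~ t)))%:E)%E.
  by move=> _; rewrite -EFinD lee_fin addr_ge0// mulr_ge0 ?expR_ge0.
have h2 : 0 <= 1 / 2 :> R by lra.
rewrite -(ge0_integralZl_EFin _ _ S0 mS h2)//.
by apply: eq_integral => t _; rewrite -EFinD -EFinM; congr EFin; field.
Qed.

(** The moment of order 2 k of N(0, 1/2). *)
Definition mom (k : nat) : R := (k.*2)`!%:R / (4 ^+ k * k`!%:R).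

Lemma fact_neq0 n : n`!%:R != 0 :> R.
Proof. by rewrite pnatr_eq0 -lt0n fact_gt0. Qed.

Lemma momS k : mom k.+1 = (k.*2.+1)%:R / 2 * mom k.
Proof.
rewrite /mom doubleS !factS !natrM exprS.
have -> : (k.*2.+2)%:R = 2 * k.+1%:R :> R by rewrite -natrM mul2n.
by field; rewrite !fact_neq0 expf_neq0 ?pnatr_eq0//=.
Qed.

Lemma mom_cancel (a : R) k : (2 * a) ^+ k.*2 / (k.*2)`!%:R * mom k = a ^+ k.*2 / k`!%:R.
Proof.
rewrite /mom exprMn -[in 2 ^+ _]mul2n exprM (_ : 2 ^+ 2 = 4); last by ring.
by field; rewrite !fact_neq0 expf_neq0 ?pnatr_eq0.
Qed.

Lemma gfam_moment (i : J) k : (\int[P]_t (X i t ^+ k.*2)%:E = (mom k)%:E)%E.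
Proof.
(* The coordinate is isolated as a one-element family, so that [gfam_homogeneous] applies with #|J|
   = 1. *)
have gY := @gfam_reindex R _ _ P J unit (fun=> i) (fun x y _ => match x, y with tt, tt => erefl end) X gX.
have mc := @mfun_coord R unit.
elim: k => [|k IH].
  under eq_integral do rewrite expr0.
  by rewrite integral_cst//= probability_setT mule1 /mom double0 expr0 !fact0 mul1r divff.
pose F (v : vec R unit) := v tt ^+ k.*2.
have mF : measurable_fun setT F by rewrite /F; mfun.
have F0 v : 0 <= F v by exact: evenX_ge0.
have hF s v : 0 < s -> F (fun j => v j / s) = s ^- k.*2 * F v.
  by move=> s0; rewrite /F expr_div_n mulrC.
have n1 : (k.*2 + #|{: unit}| = k.*2.+1)%N by rewrite card_unit addn1.
have := gfam_homogeneous gY tt mF F0 hF n1; rewrite /F IH.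
move=> /(congr1 (fun z => ((k.*2.+1)%:R / 2)%:E * z)%E).
rewrite muleA -!EFinM -momS [_ / 2 * _]mulrC mulrA mulfVK ?pnatr_eq0// divff ?pnatr_eq0// mul1e => ->.
apply: eq_integral => t _; congr EFin; rewrite /sqn (big_pred1 tt); last by case.
by rewrite -exprD addn2 doubleS.
Qed.

(** Induction on the power p of |X|^2 in the denominator: the integrand is homogeneous of degree 2
    j, so [gfam_homogeneous] cancels one factor |X|^2 at the price of 1 / (j + m + 1) and raises j
    by one. The case j = 0 gives the even moments of a coordinate of a uniform point on the unit
    sphere of C^(m + 1). *)
Lemma gfam_sphere_moment (i : J) (m p j : nat) : (#|J| = m.+1.*2)%N ->
  (\int[P]_t (X i t ^+ (j + p).*2 * sqn (X^~ t) ^- p)%:E =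
   (mom (j + p) * ((j + m)`!%:R / (j + p + m)`!%:R))%:E)%E.
Proof.
move=> cJ; have mc := @mfun_coord R J; have ms := @mfun_sqn R J.
elim: p j => [|p IH] j.
  rewrite addn0 divff ?fact_neq0// mulr1 -(gfam_moment i).
  by apply: eq_integral => t _; rewrite expr0 invr1 mulr1.
pose F (v : vec R J) := v i ^+ (j + p.+1).*2 * sqn v ^- p.+1.
have mF : measurable_fun setT F by rewrite /F; mfun.
have F0 v : 0 <= F v.
  by apply: mulr_ge0; [exact: evenX_ge0|rewrite invr_ge0 exprn_ge0 ?sqn_ge0].
have hF s v : 0 < s -> F (fun j => v j / s) = s ^- j.*2 * F v.
  move=> s0; rewrite /F expr_div_n.
  have -> : sqn (fun j => v j / s) = s ^- 2 * sqn v.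
    by rewrite /sqn mulr_sumr; apply: eq_bigr => k _; rewrite expr_div_n mulrC.
  exact: sphere_scale (lt0r_neq0 s0).
have n1 : (j.*2 + #|J| = ((j + m).*2.+1).+1)%N by rewrite cJ doubleS !addnS doubleD.
have := gfam_homogeneous gX i mF F0 hF n1; rewrite /F => ->.
have -> : (\int[P]_t (X i t ^+ (j + p.+1).*2 * sqn (X^~ t) ^- p.+1 * sqn (X^~ t))%:E =
   \int[P]_t (X i t ^+ (j.+1 + p).*2 * sqn (X^~ t) ^- p)%:E)%E.
  apply: eq_integral => t _; congr EFin; rewrite addnS addSn.
  (* At the origin a positive power of [X i t] vanishes, so both sides are 0 whatever the inverse of
     0 is. *)
  have [s0|s0] := eqVneq (sqn (X^~ t)) 0; last first.
    by rewrite exprS invfM; field; rewrite expf_neq0.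
  have x0 : X i t = 0.
    apply/eqP; move/eqP: s0; rewrite /sqn psumr_eq0; last by move=> *; exact: sqr_ge0.
    by move=> /allP/(_ i)/=; rewrite mem_index_enum sqrf_eq0 => /(_ isT).
  by rewrite x0 doubleS expr0n /= !mul0r.
rewrite IH -EFinM addSn addnS; congr EFin.
rewrite !addSn !factS natrM.
have -> : (((j + m).*2.+1).+1)%:R = 2 * (j + m).+1%:R :> R by rewrite -natrM mul2n doubleS.
have c0 : (j + m).+1%:R != 0 :> R by rewrite pnatr_eq0.
move: ((_ * _)%:R^-1) (mom _) ((j + m)`!%:R) ((j + m).+1%:R) c0 => a b c e e0.
by field; rewrite e0.
Qed.

(** Odd moments disappear by the half turn in the plane (i, j), and [mom_cancel] turns the even ones
    into a Bessel series. Here originates the factor of order block length minus one in [f_Y]: 2 (m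
    + 1) real coordinates give order m. *)
Lemma gfam_sphere_mgf (i j : J) (m : nat) (a : R) : i != j -> (#|J| = m.+1.*2)%N ->
  (\int[P]_t (expR (2 * a * X i t / Num.sqrt (sqn (X^~ t))))%:E =
   (m`!%:R * bessel_series m (a ^+ 2))%:E)%E.
Proof.
move=> ij cJ; have mc := @mfun_coord R J; have ms := @mfun_sqn R J.
pose psi (v : vec R J) := 2 * a * v i / Num.sqrt (sqn v).
have mpsi : measurable_fun setT psi by rewrite /psi; mfun.
have ji : (j == i) = false by rewrite eq_sym; apply/negbTE.
have rotsq v : sqn (plane_rot i j (-1) 0 v) = sqn v.
  rewrite /sqn (bigD1 i)//= (bigD1 j)//=; last by rewrite ji.
  rewrite [RHS](bigD1 i)//= [in RHS](bigD1 j)//=; last by rewrite ji.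
  rewrite /plane_rot /upd eqxx (negbTE ij) ji eqxx; congr (_ + (_ + _)); try by ring.
  by apply: eq_bigr => k /andP[ki kj]; rewrite (negbTE ki) (negbTE kj).
have psis v : psi (plane_rot i j (-1) 0 v) = - psi v.
  rewrite /psi rotsq /plane_rot /upd (negbTE ij) eqxx mul0r subr0; ring.
have H := @gfam_sym_series i j (fun=> 1) psi ij (measurable_cst _) mpsi (fun=> ler01)
  (fun=> erefl) psis.
transitivity (\int[P]_t (1 * expR (psi (X^~ t)))%:E)%E.
  by apply: eq_integral => t _; rewrite mul1r.
rewrite H EFinM -nneseries_bessel ?sqr_ge0// -nneseriesZl; last first.
  by move=> k _; rewrite lee_fin divr_ge0 ?mulr_ge0// exprn_ge0// sqr_ge0.
apply: eq_eseriesr => k _.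
transitivity (((2 * a) ^+ k.*2 / (k.*2)`!%:R)%:E *
    \int[P]_t (X i t ^+ (0 + k).*2 * sqn (X^~ t) ^- k)%:E)%E.
  have mXi := gX.1 i.
  have mS : measurable_fun setT (fun t => sqn (X^~ t)) := measurableT_comp ms (mX_vec gX).
  have ev (x : R) : 0 <= x ^+ k.*2 by exact: evenX_ge0.
  rewrite -ge0_integralZl_EFin//; last 3 first.
  - by move=> t _; rewrite lee_fin mulr_ge0 ?ev// invr_ge0 exprn_ge0// sqn_ge0.
  - by mfun.
  - by rewrite divr_ge0 ?ev.
  apply: eq_integral => t _; rewrite -EFinM; congr EFin.
  rewrite mul1r /psi add0n [2 * a * _ / _]mulrAC !exprMn exprVn.
  rewrite -[in Num.sqrt _ ^+ _]mul2n (exprM _ 2) sqr_sqrtr ?sqn_ge0//; ring.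
rewrite (gfam_sphere_moment i k 0 cJ) -!EFinM !add0n; congr EFin.
rewrite mulrA mom_cancel -[in a ^+ _]mul2n exprM; field; rewrite !fact_neq0//.
Qed.

End moments.

(** * Gaussian averages in the plane of the fading coefficient *)

Section noncentral.
Variable R : realType.
Local Notation mu := (@lebesgue_measure R).
Context d (T : measurableType d) (P : probability T R).
Variable X : bool -> T -> R.
Hypothesis gX : gfam P X.

Lemma gfam_plane_moment k j :
  (\int[P]_t (sqn (X^~ t) ^+ k * X false t ^+ j.*2)%:E =
   (mom R j * ((j + k)`!%:R / j`!%:R))%:E)%E.
Proof.
have mc := @mfun_coord R bool; have ms := @mfun_sqn R bool.
elim: k => [|k IH].
  rewrite addn0 divff ?fact_neq0// mulr1 -(gfam_moment gX false).
  by apply: eq_integral => t _; rewrite expr0 mul1r.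
pose F (v : vec R bool) := sqn v ^+ k * v false ^+ j.*2.
have mF : measurable_fun setT F by rewrite /F; mfun.
have F0 v : 0 <= F v by apply: mulr_ge0; [rewrite exprn_ge0 ?sqn_ge0|exact: evenX_ge0].
have hF s v : 0 < s -> F (fun j => v j / s) = s ^- (j + k).*2 * F v.
  move=> s0; rewrite /F.
  have -> : sqn (fun j => v j / s) = s ^- 2 * sqn v.
    by rewrite /sqn mulr_sumr; apply: eq_bigr => i _; rewrite expr_div_n mulrC.
  have sk l : s ^+ l != 0 by rewrite expf_neq0 ?lt0r_neq0.
  rewrite exprMn exprVn -exprM mul2n expr_div_n doubleD exprD.
  move: (sqn v ^+ k) (_ ^+ j.*2) (s ^+ j.*2) (sk j.*2) (s ^+ k.*2) (sk k.*2) => a b p p0 q q0.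
  by field; rewrite p0 q0.
have n1 : ((j + k).*2 + #|{: bool}| = ((j + k).*2.+1).+1)%N by rewrite card_bool addn2.
have := gfam_homogeneous gX false mF F0 hF n1; rewrite /F IH.
have -> : (((j + k).*2.+1).+1)%:R = 2 * (j + k).+1%:R :> R by rewrite -natrM mul2n doubleS.
have c0 : (j + k).+1%:R != 0 :> R by rewrite pnatr_eq0.
move=> /(congr1 (fun z => ((j + k).+1%:R)%:E * z)%E).
rewrite muleA -!EFinM [in X in X = _ -> _]mulrCA => E.
transitivity (((j + k).+1%:R * (2 / (2 * (j + k).+1%:R)))%:E *
  \int[P]_t (sqn (X^~ t) ^+ k * X false t ^+ j.*2 * sqn (X^~ t))%:E)%E.
  have -> : (j + k).+1%:R * (2 / (2 * (j + k).+1%:R)) = 1 :> R.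
    by move: ((j + k).+1%:R) c0 => a a0; field; rewrite a0.
  rewrite mul1e.
  by apply: eq_integral => t _; congr EFin; rewrite exprS; ring.
rewrite -E addnS factS natrM; congr EFin; ring.
Qed.

Lemma gfam_plane_exp k (b : R) :
  (\int[P]_t (sqn (X^~ t) ^+ k * expR (2 * b * X false t))%:E =
   \sum_(j <oo) (b ^+ j.*2 * (j + k)`!%:R / (j`!%:R * j`!%:R))%:E)%E.
Proof.
have mc := @mfun_coord R bool; have ms := @mfun_sqn R bool.
have mX := mX_vec gX.
have mphi : measurable_fun setT (fun v : vec R bool => sqn v ^+ k) by mfun.
have mpsi : measurable_fun setT (fun v : vec R bool => 2 * b * v false) by mfun.
have ft : false != true by [].
rewrite (gfam_sym_series gX ft mphi mpsi); last 3 first.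
- by move=> v; rewrite exprn_ge0 ?sqn_ge0.
- move=> v; congr (_ ^+ _); rewrite /sqn !big_bool /plane_rot /upd /=; ring.
- by move=> v; rewrite /plane_rot /upd /=; ring.
apply: eq_eseriesr => j _.
transitivity (((2 * b) ^+ j.*2 / (j.*2)`!%:R)%:E *
    \int[P]_t (sqn (X^~ t) ^+ k * X false t ^+ j.*2)%:E)%E.
  have mXf := gX.1 false.
  have mS : measurable_fun setT (fun t => sqn (X^~ t)) := measurableT_comp ms mX.
  rewrite -ge0_integralZl_EFin//; last 3 first.
  - move=> t _; rewrite lee_fin; apply: mulr_ge0; last exact: evenX_ge0.
    by rewrite exprn_ge0 ?sqn_ge0.
  - by mfun.
  - by rewrite divr_ge0 ?evenX_ge0.
  by apply: eq_integral => t _; rewrite -EFinM exprMn; congr EFin; ring.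
rewrite gfam_plane_moment -EFinM mulrA mom_cancel; congr EFin.
by rewrite mulf_div mulrC.
Qed.

(** Rotating the vector [b] onto the axis [false] reduces to a single linear coordinate. *)
Lemma gfam_plane_exp2 k (b : bool -> R) :
  (\int[P]_t (sqn (X^~ t) ^+ k * expR (2 * \sum_i b i * X i t))%:E =
   \sum_(j <oo) (sqn b ^+ j * (j + k)`!%:R / (j`!%:R * j`!%:R))%:E)%E.
Proof.
have mc := @mfun_coord R bool; have ms := @mfun_sqn R bool.
have [c [s [cs cb sb]]] := givens_coef (b false) (b true).
set r := Num.sqrt _ in cb sb.
have r2 : r ^+ 2 = sqn b by rewrite sqr_sqrtr ?addr_ge0 ?sqr_ge0// /sqn big_bool addrC.
have ft : false != true by [].
have cs' : c ^+ 2 + (- s) ^+ 2 = 1 by rewrite sqrrN.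
have [_ gO] := gpres_rot ft cs'.
pose F (v : vec R bool) := (sqn v ^+ k * expR (2 * r * v false))%:E.
have mF : measurable_fun setT F by rewrite /F; mfun.
have F0 v : (0 <= F v)%E by rewrite lee_fin mulr_ge0 ?expR_ge0// exprn_ge0 ?sqn_ge0.
have H := gfam_transfer (gO _ _ _ _ gX) gX mF F0.
transitivity (\int[P]_t F (X^~ t))%E; last first.
  by rewrite gfam_plane_exp; apply: eq_eseriesr => j _; rewrite -mul2n exprM r2.
rewrite -H; apply: eq_integral => t _; rewrite /F; congr (_ ^+ _ * expR _)%:E.
  rewrite /sqn !big_bool /plane_rot /upd /= -[LHS]mul1r -cs; ring.
rewrite !big_bool /plane_rot /upd /= -cb -sb; ring.
Qed.

Lemma laplace_bessel0 (a beta : R) k : 0 < a -> 0 <= beta ->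
  (\int[mu]_(z in `[0%R, +oo[) (z ^+ k * expR (- (a * z)) * bessel_series 0 (z * beta))%:E =
   \sum_(j <oo) (beta ^+ j / (j`!%:R * j`!%:R) * ((k + j)`!%:R * a ^- (k + j).+1))%:E)%E.
Proof.
move=> a0 b0.
have mg (j : nat) : measurable_fun setT (fun z : R => (z ^+ (k + j) * expR (- (a * z)))%:E) by mfun.
have c0 j : 0 <= beta ^+ j / (j`!%:R * j`!%:R) by rewrite divr_ge0 ?exprn_ge0 ?mulr_ge0.
have g0 j (z : R) : 0 <= z -> 0 <= z ^+ (k + j) * expR (- (a * z)).
  by move=> z0; rewrite mulr_ge0 ?expR_ge0// exprn_ge0.
transitivity (\int[mu]_(z in `[0%R, +oo[) \sum_(j <oo)
    ((beta ^+ j / (j`!%:R * j`!%:R))%:E * (z ^+ (k + j) * expR (- (a * z)))%:E))%E.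
  apply: eq_integral => z; rewrite inE/= in_itv/= andbT => z0.
  rewrite EFinM -nneseries_bessel; last by rewrite mulr_ge0.
  rewrite -nneseriesZl; last first.
    by move=> j _; rewrite lee_fin divr_ge0 ?mulr_ge0// exprn_ge0// mulr_ge0.
  apply: eq_eseriesr => j _; rewrite -!EFinM addn0 exprD exprMn.
  by congr EFin; move: (_^-1) (z ^+ j) => y w; ring.
rewrite integral_nneseries//; last 2 first.
- by move=> j; apply: measurable_funTS; apply: measurable_funeM; exact: mg.
- by move=> j z; rewrite /= in_itv/= andbT => z0; rewrite -EFinM lee_fin mulr_ge0// g0.
apply: eq_eseriesr => j _; rewrite [RHS]EFinM -(integral_gamma (k + j) a0).
rewrite ge0_integralZl_EFin//.
- by move=> z; rewrite /= in_itv/= andbT => z0; rewrite lee_fin g0.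
- by apply: measurable_funTS; exact: mg.
Qed.

(** [q ^+ 2] is the total coefficient of |X|^2 in the exponent, 1 from the Gaussian density and c
    s^2 from the integrand; q^(-2) is the Jacobian of the dilation by [q] in real dimension two. *)
Lemma gfam_noncentral_series (c s : R) (m : bool -> R) k : 0 <= c -> 0 < s ->
  let q := Num.sqrt (1 + c * s ^+ 2) in
  (\int[P]_t (expR (- (c * \sum_i (m i + s * X i t) ^+ 2)) *
      (\sum_i (m i + s * X i t) ^+ 2) ^+ k)%:E =
   (q ^- 2 * (s ^+ 2 / q ^+ 2) ^+ k * expR (- (sqn m / s ^+ 2)))%:E *
   \sum_(j <oo) ((sqn m / s ^+ 2 / q ^+ 2) ^+ j * (j + k)`!%:R / (j`!%:R * j`!%:R))%:E)%E.
Proof.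
move=> c0 s0 q; have mc := @mfun_coord R bool; have ms := @mfun_sqn R bool.
have sn0 : s != 0 by rewrite gt_eqF.
pose b i := m i / s.
have q2 : q ^+ 2 = 1 + c * s ^+ 2.
  by rewrite sqr_sqrtr// addr_ge0// mulr_ge0// sqr_ge0.
have q0 : 0 < q.
  by rewrite sqrtr_gt0 ltr_pwDl// mulr_ge0// sqr_ge0.
have qn0 : q != 0 by rewrite gt_eqF.
(* Cameron-Martin shift, then rescaling to absorb the Gaussian weight. *)
pose G (v : vec R bool) := (s ^+ 2 * sqn v) ^+ k * expR (2 * \sum_i b i * v i - sqn b).
have mG : measurable_fun setT (fun v => (G v)%:E) by rewrite /G; mfun.
have G0 v : (0 <= (G v)%:E)%E.
  by rewrite lee_fin mulr_ge0 ?expR_ge0// exprn_ge0// mulr_ge0 ?sqr_ge0 ?sqn_ge0.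
pose f (v : vec R bool) := expR (- (c * (s ^+ 2 * sqn v))) * (s ^+ 2 * sqn v) ^+ k.
have mf : measurable_fun setT (fun v => (f v)%:E) by rewrite /f; mfun.
have f0 v : (0 <= (f v)%:E)%E.
  by rewrite lee_fin mulr_ge0 ?expR_ge0// exprn_ge0// mulr_ge0 ?sqr_ge0 ?sqn_ge0.
have H1 := @gfam_change R bool d T P X gX predT (fun i x => x + b i)
  (fun i x => expR (2 * b i * x - b i ^+ 2)) (fun v => (f v)%:E).
have H2 := gfam_scale gX q0 mG G0.
have H3 := gfam_plane_exp2 k (fun i => b i / q).
transitivity (\int[P]_t ((f (fun i => X i t + b i))%:E))%E.
  apply: eq_integral => t _; rewrite /f.
  have -> : s ^+ 2 * sqn (fun i => X i t + b i) = \sum_i (m i + s * X i t) ^+ 2.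
    by rewrite /sqn mulr_sumr; apply: eq_bigr => i _; rewrite /b; field.
  by [].
apply: etrans (H1 _ _ _ _ mf f0) _ => {H1}.
- by move=> i; mfun.
- by move=> i; mfun.
- by move=> i x; exact: expR_ge0.
- by move=> i g mg g0; exact: g1_shift.
have mX := mX_vec gX.
have mGX : measurable_fun setT (fun t => G (X^~ t)).
  by have mG' : measurable_fun setT G by [rewrite /G; mfun]; exact: (measurableT_comp mG' mX).
have mS : measurable_fun setT (fun t => sqn (X^~ t)) := measurableT_comp ms mX.
transitivity ((q ^- 2)%:E * \int[P]_t (G (fun j => (X j t / q)%R))%:E)%E.
  rewrite H2 -ge0_integralZl_EFin//; last 3 first.
  - move=> t _; apply: mule_ge0; first exact: G0.
    by rewrite lee_fin mulr_ge0 ?expR_ge0// exprn_ge0// ltW.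
  - by mfun.
  - by rewrite invr_ge0 exprn_ge0// ltW.
  apply: eq_integral => t _; rewrite -!EFinM -expR_sum; congr EFin.
  have -> : \sum_i (2 * b i * X i t - b i ^+ 2) = 2 * (\sum_i b i * X i t) - sqn b.
    rewrite sumrB mulr_sumr; congr (_ - _).
    by apply: eq_bigr => i _; rewrite mulrA.
  rewrite /f /G q2 card_bool.
  have -> : (1 + c * s ^+ 2 - 1) * sqn (X^~ t) = c * (s ^+ 2 * sqn (X^~ t)) by ring.
  by rewrite -q2; field.
have sb : sqn b = sqn m / s ^+ 2.
  by rewrite /sqn mulr_suml; apply: eq_bigr => i _; rewrite /b expr_div_n.
have sbq : sqn (fun i => b i / q) = sqn m / s ^+ 2 / q ^+ 2.
  by rewrite -sb /sqn mulr_suml; apply: eq_bigr => i _; rewrite expr_div_n.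
rewrite -sbq -H3 -mulrA EFinM -muleA; congr (_ * _)%E.
rewrite -ge0_integralZl_EFin//; last 3 first.
- by move=> t _; rewrite lee_fin mulr_ge0 ?expR_ge0// exprn_ge0// sqn_ge0.
- by have mXi i := gX.1 i; mfun.
- by rewrite mulr_ge0 ?expR_ge0// exprn_ge0// divr_ge0// sqr_ge0.
apply: eq_integral => t _; rewrite -EFinM /G expRD -sb; congr EFin.
have -> : sqn (fun j => X j t / q) = sqn (X^~ t) / q ^+ 2.
  by rewrite /sqn mulr_suml; apply: eq_bigr => i _; rewrite expr_div_n.
have -> : 2 * (\sum_i b i * (X i t / q)) = 2 * \sum_i b i / q * X i t.
  by congr (_ * _); apply: eq_bigr => i _; rewrite mulrA mulrAC.
have -> : s ^+ 2 * (sqn (X^~ t) / q ^+ 2) = sqn (X^~ t) * (s ^+ 2 / q ^+ 2).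
  by move: (sqn _) (s ^+ 2) ((q ^+ 2)^-1) => x y z; ring.
rewrite exprMn; move: (sqn _ ^+ k) ((s ^+ 2 / q ^+ 2) ^+ k) (expR (- _)) (expR (2 * _)) => x y z w.
by ring.
Qed.

(* Both sides are expanded in power series; this identifies the average over the fading with
   the [z]-integral in [f_Y]. *)
Lemma gfam_noncentral_moment (c s : R) (m : bool -> R) k : 0 <= c -> 0 < s ->
  (\int[P]_t (expR (- (c * \sum_i (m i + s * X i t) ^+ 2)) *
      (\sum_i (m i + s * X i t) ^+ 2) ^+ k)%:E =
   (s ^- 2 * expR (- (sqn m / s ^+ 2)))%:E * \int[mu]_(z in `[0%R, +oo[)
      (z ^+ k * expR (- ((c + s ^- 2) * z)) * bessel_series 0 (z * (sqn m / s ^+ 4)))%:E)%E.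
Proof.
move=> c0 s0.
have sn0 l : s ^+ l != 0 by rewrite expf_neq0 ?gt_eqF.
have a0 : 0 < c + s ^- 2 by rewrite ltr_wpDl// invr_gt0 exprn_gt0.
have sm0 : 0 <= sqn m / s ^+ 4 by rewrite divr_ge0 ?sqn_ge0// exprn_ge0// ltW.
rewrite gfam_noncentral_series// laplace_bessel0//.
set q := Num.sqrt _.
have q2 : q ^+ 2 = s ^+ 2 * (c + s ^- 2).
  rewrite sqr_sqrtr; last by rewrite addr_ge0// mulr_ge0// sqr_ge0.
  by rewrite mulrDr (divff (sn0 2)) addrC mulrC.
rewrite -nneseriesZl; last first.
  by move=> j _; rewrite lee_fin divr_ge0 ?mulr_ge0// exprn_ge0// !divr_ge0 ?sqn_ge0 ?sqr_ge0.
rewrite -nneseriesZl; last first.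
  move=> j _; rewrite lee_fin mulr_ge0 ?divr_ge0 ?mulr_ge0 ?exprn_ge0//.
  exact: ltW.
apply: eq_eseriesr => j _; rewrite -!EFinM; congr EFin; rewrite q2.
have an0 l : (c + s ^- 2) ^+ l != 0 by rewrite expf_neq0 ?gt_eqF.
have -> : s ^+ 2 / (s ^+ 2 * (c + s ^- 2)) = (c + s ^- 2)^-1.
  by rewrite invfM mulrA divff// mul1r.
have -> : sqn m / s ^+ 2 / (s ^+ 2 * (c + s ^- 2)) = sqn m / s ^+ 4 * (c + s ^- 2)^-1.
  have -> : s ^+ 4 = s ^+ 2 * s ^+ 2 by rewrite -exprD.
  by rewrite !(invfM (s ^+ 2)); move: ((s ^+ 2)^-1) (_^-1) => x y; ring.
have -> : (c + s ^- 2) ^- (k + j).+1 =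
    (c + s ^- 2)^-1 * (c + s ^- 2)^-1 ^+ k * (c + s ^- 2)^-1 ^+ j.
  by rewrite -exprVn exprS exprD mulrA.
rewrite (invfM (s ^+ 2)) exprMn addnC.
move: (s ^- 2) (expR _) ((sqn m / s ^+ 4) ^+ j) ((k + j)`!%:R) ((c + s ^- 2)^-1) => y x w u A.
by move: (A ^+ k) (A ^+ j) ((_ * _)^-1) => a b z; ring.
Qed.

End noncentral.

(** * Output densities *)

Section density_ratio.
Variable R : realType.
Local Notation mu := (@lebesgue_measure R).

Definition reim (z : R[i]) (b : bool) : R := if b then complex.Im z else complex.Re z.

(* Ratio of the density of [CN(sqrt c * m, c * s2 + 1)] to that of [CN(0, 1)]. *)
Definition gratio (c s2 : R) (m p : R[i]) : R :=
  (s2 * c + 1)^-1 * expR (- (cnorm2 (p - rC (Num.sqrt c) * m) / (s2 * c + 1)) + cnorm2 p).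

Lemma g1_expM (a : R) : (\int[g1 R]_x (expR (2 * a * x))%:E = (expR (a ^+ 2))%:E)%E.
Proof.
have f0 : forall x : R, (0 <= cst (expR (a ^+ 2))%:E x)%E by move=> x; rewrite /= lee_fin expR_ge0.
have h := g1_shift a (measurable_cst _) f0.
transitivity (\int[g1 R]_x (cst (expR (a ^+ 2))%:E x * (expR (2 * a * x - a ^+ 2))%:E))%E.
  by apply: eq_integral => x _; rewrite /= -EFinM -expRD addrC subrK.
rewrite -h; transitivity (\int[g1 R]_x cst (expR (a ^+ 2))%:E x)%E; first by apply: eq_integral.
by rewrite integral_cst//= [X in (_ * X)%E](probability_setT (g1 R)) mule1.
Qed.

(** Completion of the square by changes of measure: [g1_scale] absorbs the quadratic part of the
    exponent and [g1_expM] integrates the linear part. *)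
Lemma g1_quadratic (c s m p : R) : 0 <= c ->
  (\int[g1 R]_x (expR (2 * Num.sqrt c * p * (m + s * x) - c * (m + s * x) ^+ 2))%:E =
   ((Num.sqrt (s ^+ 2 * c + 1))^-1 *
    expR (- ((p - Num.sqrt c * m) ^+ 2 / (s ^+ 2 * c + 1)) + p ^+ 2))%:E)%E.
Proof.
move=> c0; set r := Num.sqrt c; have r2 : r ^+ 2 = c by rewrite sqr_sqrtr.
set v := s ^+ 2 * c + 1; have v0 : 0 < v by rewrite ltr_wpDl// mulr_ge0// sqr_ge0.
set q := Num.sqrt v; have q2 : q ^+ 2 = v by rewrite sqr_sqrtr// ltW.
have q0 : 0 < q by rewrite sqrtr_gt0.
pose beta := s * (r * p - c * m).
pose f (x : R) := (q^-1 * expR (2 * r * p * m - c * m ^+ 2 + 2 * beta * x))%:E.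
have mf : measurable_fun setT f by rewrite /f; mfun.
have f0 x : (0 <= f x)%E by rewrite lee_fin mulr_ge0 ?expR_ge0// invr_ge0 ltW.
have H := g1_scale q0 mf f0.
transitivity (\int[g1 R]_x f (x / q)%R)%E.
  rewrite H; apply: eq_integral => x _; rewrite -EFinM; congr EFin.
  rewrite mulrACA mulVf ?gt_eqF// mul1r -expRD q2; congr expR.
  by rewrite /beta /v -r2; ring.
transitivity ((q^-1 * expR (2 * r * p * m - c * m ^+ 2))%:E *
    \int[g1 R]_x (expR (2 * (beta / q) * x))%:E)%E.
  have me : measurable_fun setT (fun x : R => (expR (2 * (beta / q) * x))%:E) by mfun.
  have e0 (x : R) : [set: R] x -> (0 <= (expR (2 * (beta / q) * x))%:E)%E.
    by rewrite lee_fin expR_ge0.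
  have k0 : 0 <= q^-1 * expR (2 * r * p * m - c * m ^+ 2).
    by rewrite mulr_ge0 ?expR_ge0// invr_ge0 ltW.
  apply: etrans (ge0_integralZl_EFin (g1 R) measurableT e0 me k0).
  apply: eq_integral => x _; rewrite -EFinM -(mulrA (q^-1)) -expRD /f; congr (_ * expR _)%:E.
  by move: (beta) (q^-1) => b' r'; ring.
rewrite g1_expM -EFinM -(mulrA (q^-1)) -expRD; congr (_ * expR _)%:E.
rewrite expr_div_n q2; have vn0 : v != 0 by rewrite gt_eqF.
have -> : beta ^+ 2 = (v - 1) * (p - r * m) ^+ 2 by rewrite /beta /v -r2; ring.
by rewrite -r2; move: (v) vn0 => v' vn0'; field; rewrite vn0'.
Qed.

(** Given the fading h, exp (2 sqrt c Re (conj h p) - c |h|^2) is the density ratio of CN(sqrt c h,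
    1) to CN(0, 1) at p. Averaging over h with law CN(m, s^2) must give the ratio of the mixture
    CN(sqrt c m, c s^2 + 1); real and imaginary parts separate by independence. *)
Lemma gratioE d (T : measurableType d) (P : probability T R) (X : bool -> T -> R)
    (c s : R) (m p : R[i]) : gfam P X -> 0 <= c ->
  (\int[P]_t (expR (2 * Num.sqrt c * (\sum_b reim p b * (reim m b + s * X b t)) -
      c * \sum_b (reim m b + s * X b t) ^+ 2))%:E = (gratio c (s ^+ 2) m p)%:E)%E.
Proof.
move=> gX c0; have mc := @mfun_coord R bool.
pose psi b (x : R) := (expR (2 * Num.sqrt c * reim p b * (reim m b + s * x) -
  c * (reim m b + s * x) ^+ 2))%:E.
have mpsi b : measurable_fun setT (psi b) by rewrite /psi; mfun.
have psi0 b x : (0 <= psi b x)%E by rewrite lee_fin expR_ge0.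
have mpsiv b : measurable_fun setT (fun v : vec R bool => psi b (v b)) := measurableT_comp (mpsi b) (mc b).
have H := @gfam_indep R bool d T P X gX bool (index_enum bool) (fun b => pred1 b) (fun b v => psi b (v b))
  (index_enum_uniq _) _ mpsiv (fun b v => psi0 b _).
transitivity (\int[P]_t \prod_b psi b (X b t))%E.
  apply: eq_integral => t _; rewrite /psi prodEFin -expR_sum; congr (expR _)%:E.
  rewrite sumrB !mulr_sumr; congr (_ - _).
  by apply: eq_bigr => b _; rewrite mulrA.
apply: etrans (H _ _) _.
- by move=> j k i /eqP -> /eqP ->.
- by move=> k v w vw; rewrite (vw k (eqxx k)).
transitivity (\prod_b ((Num.sqrt (s ^+ 2 * c + 1))^-1 *
    expR (- ((reim p b - Num.sqrt c * reim m b) ^+ 2 / (s ^+ 2 * c + 1)) + reim p b ^+ 2))%:E)%E.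
  apply: eq_bigr => b _; rewrite -g1_quadratic//.
  exact: (gfam_marginal gX b (mpsi b) (psi0 b)).
rewrite prodEFin big_split/= prodr_const card_bool -expR_sum; congr (_ * expR _)%:E.
  by rewrite exprVn sqr_sqrtr// addr_ge0// mulr_ge0// sqr_ge0.
by rewrite !big_bool /cnorm2 /=; case: p {psi mpsi psi0 mpsiv H} => a b; case: m => a' b' /=; ring.
Qed.

End density_ratio.

(** * Output density for a spherical input *)

Section sphere_density.
Variable R : realType.
Local Notation mu := (@lebesgue_measure R).

Lemma measurable_bessel_series nu (beta : R) : 0 <= beta ->
  measurable_fun (`[0%R, +oo[%classic : set R) (fun z => bessel_series nu (z * beta)).
Proof.
move=> beta0; pose h n (z : R) : R := series (fun k => (z * beta) ^+ k / (k`!%:R * (k + nu)`!%:R)) n.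
apply: (measurable_fun_cvg (h := h)).
  by move=> n; apply: measurable_funTS; rewrite /h /series /=; mfun.
by move=> z; rewrite /= in_itv/= andbT => z0; apply: cvg_bessel_series; rewrite mulr_ge0.
Qed.

Lemma sqn_plane_rot (J : finType) (i j : J) (c s : R) (v : J -> R) : i != j ->
  c ^+ 2 + s ^+ 2 = 1 -> sqn (plane_rot i j c s v) = sqn v.
Proof.
move=> ij cs; have ji : (j == i) = false by rewrite eq_sym; apply/negbTE.
rewrite /sqn (bigD1 i)//= (bigD1 j)//=; last by rewrite ji.
rewrite [RHS](bigD1 i)//= [in RHS](bigD1 j)//=; last by rewrite ji.
rewrite /plane_rot /upd eqxx (negbTE ij) ji eqxx !addrA; congr (_ + _).
  by rewrite -[RHS]mul1r -cs; ring.
by apply: eq_bigr => k /andP[ki kj]; rewrite (negbTE ki) (negbTE kj).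
Qed.

Section sphere.
Context d (T : measurableType d) (P : probability T R).
Variables (J : finType) (jr ji : J) (m : nat).
Hypothesis (jri : jr != ji) (cJ : (#|J| = m.+1.*2)%N).

(** Rotating the plane (jr, ji) absorbs the phase of hr + i hi, and only its modulus is left. *)
Lemma gfam_sphere_phase (X : J -> T -> R) (a hr hi : R) : gfam P X ->
  (\int[P]_t (expR (2 * a * ((X jr t * hr - X ji t * hi) / Num.sqrt (sqn (X^~ t)))))%:E =
   (m`!%:R * bessel_series m (a ^+ 2 * (hr ^+ 2 + hi ^+ 2)))%:E)%E.
Proof.
move=> gX; have mc := @mfun_coord R J; have ms := @mfun_sqn R J.
have [c [s [cs cb sb]]] := givens_coef hr hi.
set r := Num.sqrt _ in cb sb.
have r2 : r ^+ 2 = hr ^+ 2 + hi ^+ 2 by rewrite sqr_sqrtr ?addr_ge0 ?sqr_ge0.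
have [_ gO] := gpres_rot jri cs.
pose F (v : vec R J) := (expR (2 * (a * r) * v jr / Num.sqrt (sqn v)))%:E.
have mF : measurable_fun setT F by rewrite /F; mfun.
have F0 v : (0 <= F v)%E by rewrite lee_fin expR_ge0.
have H := gfam_transfer (gO _ _ _ _ gX) gX mF F0.
transitivity (\int[P]_t F (X^~ t))%E; last first.
  by rewrite (gfam_sphere_mgf gX _ jri cJ) exprMn r2.
rewrite -H; apply: eq_integral => t _; rewrite /F (sqn_plane_rot _ jri cs) /plane_rot /upd.
rewrite (negbTE jri) eqxx -cb -sb; congr (expR _)%:E.
by rewrite !mulrA; congr (_ / _); ring.
Qed.

(* Output density of a uniform input on the sphere, relative to the noise density [CN(0, I)]
   and as a function of the squared norm [n2] of the output. *)
Definition sphere_ratio (X : J -> T -> R) (c s2 : R) (h : R[i]) (n2 : R) : \bar R :=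
  (\int[P]_t (gratio c s2 h (mkC (Num.sqrt n2 * (X jr t / Num.sqrt (sqn (X^~ t))))
     (- (Num.sqrt n2 * (X ji t / Num.sqrt (sqn (X^~ t)))))))%:E)%E.

(** The ratio is a double average, over the sphere and over the fading h, and the order is swapped.
    For fixed h the sphere average is a Bessel series in c n2 |h|^2; its terms are fading moments,
    each of them a z-integral by [gfam_noncentral_moment], and the series is resummed under that
    integral. All terms are nonnegative, which justifies every exchange. *)
Lemma sphere_ratioE (X : J -> T -> R) (c s : R) (h : R[i]) (n2 : R) : gfam P X ->
  0 <= c -> 0 < s -> 0 <= n2 ->
  sphere_ratio X c (s ^+ 2) h n2 = ((m`!%:R * (s ^- 2 * expR (- (cnorm2 h / s ^+ 2))))%:E *
    \int[mu]_(z in `[0%R, +oo[) (expR (- ((c + s ^- 2) * z)) *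
       bessel_series 0 (z * (cnorm2 h / s ^+ 4)) * bessel_series m (n2 * c * z))%:E)%E.
Proof.
move=> gX c0 s0 n20; have mc := @mfun_coord R J; have ms := @mfun_sqn R J.
have mX := mX_vec gX; have mXj j := gX.1 j.
have mS : measurable_fun setT (fun t => sqn (X^~ t)) := measurableT_comp ms mX.
pose e b := if b then ji else jr.
have einj : injective e.
  by move=> [] [] //= ee; move: jri; rewrite ee eqxx.
pose Z b := X (e b); have gZ : gfam P Z := gfam_reindex einj gX.
have mZ b := gZ.1 b.
pose hz t b := reim h b + s * Z b t.
pose p t b := if b then - (Num.sqrt n2 * (X ji t / Num.sqrt (sqn (X^~ t))))
              else Num.sqrt n2 * (X jr t / Num.sqrt (sqn (X^~ t))).
pose K (z : T * T) := (expR (2 * Num.sqrt c * (\sum_b p z.1 b * hz z.2 b) -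
      c * \sum_b hz z.2 b ^+ 2))%:E.
have mp b : measurable_fun setT (p^~ b) by rewrite /p; case: b; mfun.
have mh b : measurable_fun setT (hz^~ b) by rewrite /hz; mfun.
have mp1 b : measurable_fun setT (fun z : T * T => p z.1 b) := measurableT_comp (mp b) measurable_fst.
have mh2 b : measurable_fun setT (fun z : T * T => hz z.2 b) := measurableT_comp (mh b) measurable_snd.
have mK : measurable_fun setT K by rewrite /K; mfun.
have K0 z : (0 <= K z)%E by rewrite lee_fin expR_ge0.
have -> : sphere_ratio X c (s ^+ 2) h n2 = (\int[P]_t \int[P]_u K (t, u))%E.
  by apply: eq_integral => t _; rewrite -(gratioE _ _ _ gZ c0).
rewrite (fubini_tonelli (m1 := P) (m2 := P) K mK K0).
pose a := Num.sqrt c * Num.sqrt n2; have a2 : a ^+ 2 = c * n2 by rewrite exprMn !sqr_sqrtr.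
pose N u := \sum_b hz u b ^+ 2.
have N0 u : 0 <= N u by apply: sumr_ge0 => b _; exact: sqr_ge0.
have mN : measurable_fun setT N by rewrite /N; mfun.
transitivity (\int[P]_u \sum_(k <oo) ((m`!%:R * ((c * n2) ^+ k / (k`!%:R * (k + m)`!%:R)))%:E *
    (expR (- (c * N u)) * N u ^+ k)%:E))%E.
  apply: eq_integral => u _.
  transitivity ((expR (- (c * N u)))%:E * \int[P]_t (expR (2 * a *
     ((X jr t * hz u false - X ji t * hz u true) / Num.sqrt (sqn (X^~ t)))))%:E)%E.
    rewrite -ge0_integralZl_EFin; [|exact: measurableT|by move=> t _; rewrite lee_fin expR_ge0
      |by mfun|exact: expR_ge0].
    apply: eq_integral => t _; rewrite -EFinM -expRD; congr (expR _)%:E.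
    rewrite /K /= -/(N u) !big_bool /p /a /=.
    move: (hz u true) (hz u false) (N u) (X jr t) (X ji t) (Num.sqrt c) (Num.sqrt n2) (Num.sqrt (sqn _))^-1.
    by move=> h1 h2 nu xr xi sc sn iv; ring.
  rewrite gfam_sphere_phase// a2.
  have -> : hz u false ^+ 2 + hz u true ^+ 2 = N u by rewrite /N big_bool addrC.
  rewrite EFinM -nneseries_bessel ?mulr_ge0// muleA -EFinM -nneseriesZl; last first.
    by move=> k _; rewrite lee_fin divr_ge0 ?mulr_ge0// exprn_ge0 ?mulr_ge0.
  by apply: eq_eseriesr => k _; rewrite -!EFinM exprMn; congr EFin; move: (_^-1) => y; ring.
have ck0 k : 0 <= m`!%:R * ((c * n2) ^+ k / (k`!%:R * (k + m)`!%:R)).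
  by rewrite mulr_ge0// divr_ge0 ?mulr_ge0// exprn_ge0 ?mulr_ge0.
rewrite integral_nneseries; [|exact: measurableT|by move=> k; mfun|]; last first.
  by move=> k u _; rewrite -EFinM lee_fin mulr_ge0// mulr_ge0 ?expR_ge0// exprn_ge0.
have sm : sqn (reim h) = cnorm2 h by rewrite /sqn big_bool /= addrC.
transitivity (\sum_(k <oo) ((m`!%:R * ((c * n2) ^+ k / (k`!%:R * (k + m)`!%:R)))%:E *
    ((s ^- 2 * expR (- (cnorm2 h / s ^+ 2)))%:E * \int[mu]_(z in `[0%R, +oo[)
      (z ^+ k * expR (- ((c + s ^- 2) * z)) * bessel_series 0 (z * (cnorm2 h / s ^+ 4)))%:E)))%E.
  apply: eq_eseriesr => k _; rewrite ge0_integralZl_EFin; [|exact: measurableT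
    |by move=> u _; rewrite lee_fin mulr_ge0 ?expR_ge0// exprn_ge0|by mfun|exact: ck0].
  by rewrite -sm -(gfam_noncentral_moment gZ (reim h) k c0 s0).
have b0 (z : R) : 0 <= z -> 0 <= z * (cnorm2 h / s ^+ 4).
  by move=> z0; rewrite mulr_ge0// divr_ge0 ?cnorm2_ge0// exprn_ge0// ltW.
have B0 nu (w : R) : 0 <= w -> 0 <= bessel_series nu w.
  move=> w0; rewrite -lee_fin -nneseries_bessel//; apply: nneseries_ge0 => k _ _.
  by rewrite lee_fin divr_ge0 ?exprn_ge0// mulr_ge0.
have beta0 : 0 <= cnorm2 h / s ^+ 4 by rewrite divr_ge0 ?cnorm2_ge0// exprn_ge0// ltW.
set beta := cnorm2 h / s ^+ 4 in b0 beta0 *.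
set A := c + s ^- 2.
pose f k (z : R) := (c * n2) ^+ k / (k`!%:R * (k + m)`!%:R) *
  (z ^+ k * expR (- (A * z)) * bessel_series 0 (z * beta)).
have mf k : measurable_fun (`[0%R, +oo[%classic : set R) (fun z => (f k z)%:E).
  apply/measurable_EFinP; apply: measurable_funM; first exact: measurable_cst.
  by apply: measurable_funM; [apply: measurable_funTS; mfun|exact: measurable_bessel_series].
have f0 k z : z \in `[0%R, +oo[ -> 0 <= f k z.
  rewrite in_itv/= andbT => z0; apply: mulr_ge0.
    by rewrite divr_ge0 ?mulr_ge0// exprn_ge0 ?mulr_ge0.
  by rewrite mulr_ge0 ?B0 ?b0// mulr_ge0 ?expR_ge0// exprn_ge0.
transitivity (\sum_(k <oo) ((m`!%:R * (s ^- 2 * expR (- (cnorm2 h / s ^+ 2))))%:E *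
    \int[mu]_(z in `[0%R, +oo[) (f k z)%:E))%E.
  apply: eq_eseriesr => k _.
  have ak : 0 <= (c * n2) ^+ k / (k`!%:R * (k + m)`!%:R).
    by rewrite divr_ge0 ?mulr_ge0// exprn_ge0 ?mulr_ge0.
  have -> : (\int[mu]_(z in `[0%R, +oo[) (f k z)%:E = ((c * n2) ^+ k / (k`!%:R * (k + m)`!%:R))%:E *
      \int[mu]_(z in `[0%R, +oo[) (z ^+ k * expR (- (A * z)) * bessel_series 0 (z * beta))%:E)%E.
    rewrite -ge0_integralZl_EFin; [|exact: measurable_itv| | |exact: ak].
    - by apply: eq_integral => z _; rewrite -EFinM.
    - move=> z; rewrite /= in_itv/= andbT => z0; rewrite lee_fin mulr_ge0 ?B0 ?b0//.
      by rewrite mulr_ge0 ?expR_ge0// exprn_ge0.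
    - apply/measurable_EFinP.
      by apply: measurable_funM; [apply: measurable_funTS; mfun|exact: measurable_bessel_series].
  by rewrite !muleA -!EFinM; congr (_%:E * _)%E; move: (_^-1) (_^-1) => x y; ring.
rewrite nneseriesZl; last by move=> k _; apply: integral_ge0 => z zD; rewrite lee_fin f0.
congr (_ * _)%E; rewrite -integral_nneseries; [|exact: measurable_itv|exact: mf|]; last first.
  by move=> k z zD; rewrite lee_fin f0.
apply: eq_integral => z; rewrite inE/= in_itv/= andbT => z0.
rewrite [RHS]EFinM -nneseries_bessel; last by rewrite !mulr_ge0.
rewrite -nneseriesZl; last by move=> k _; rewrite lee_fin divr_ge0 ?mulr_ge0// exprn_ge0 ?mulr_ge0.
apply: eq_eseriesr => k _; rewrite -EFinM /f; congr EFin.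
rewrite [n2 * c]mulrC (exprMn _ _ z); move: (_^-1) => y; ring.
Qed.

End sphere.
End sphere_density.

(** * Identification with [f_Y] and with the information density *)

Section output_density.
Variable R : realType.
Local Notation mu := (@lebesgue_measure R).

Lemma cnorm2B_le (p q : R[i]) : cnorm2 (p - q) <= 2 * (cnorm2 p + cnorm2 q).
Proof.
case: p => a b; case: q => a' b'; rewrite /cnorm2 /= -subr_ge0.
have -> : 2 * (a ^+ 2 + b ^+ 2 + (a' ^+ 2 + b' ^+ 2)) - ((a - a') ^+ 2 + (b - b') ^+ 2) =
  (a + a') ^+ 2 + (b + b') ^+ 2 by ring.
by rewrite addr_ge0 ?sqr_ge0.
Qed.

Lemma gratio_gt0 (c s2 : R) (h p : R[i]) : 0 <= c -> 0 <= s2 -> 0 < gratio c s2 h p.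
Proof.
by move=> c0 s0; rewrite mulr_gt0 ?expR_gt0// invr_gt0 ltr_wpDl// mulr_ge0.
Qed.

Lemma gratio_le (c s2 : R) (h p : R[i]) (n2 : R) : 0 <= c -> 0 <= s2 -> cnorm2 p <= n2 ->
  gratio c s2 h p <= (s2 * c + 1)^-1 * expR n2.
Proof.
move=> c0 s0 pn; have v0 : 0 < s2 * c + 1 by rewrite ltr_wpDl// mulr_ge0.
rewrite ler_pM2l ?invr_gt0// ler_expR -[leRHS]add0r lerD// oppr_le0.
by rewrite divr_ge0 ?cnorm2_ge0// ltW.
Qed.

Lemma gratio_ge (c s2 : R) (h p : R[i]) (n2 : R) : 0 <= c -> 0 <= s2 -> cnorm2 p <= n2 ->
  (s2 * c + 1)^-1 * expR (- (2 * (n2 + cnorm2 (rC (Num.sqrt c) * h)) / (s2 * c + 1))) <=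
  gratio c s2 h p.
Proof.
move=> c0 s0 pn; have v0 : 0 < s2 * c + 1 by rewrite ltr_wpDl// mulr_ge0.
rewrite ler_pM2l ?invr_gt0// ler_expR -[leLHS]addr0 lerD ?cnorm2_ge0// lerN2.
rewrite ler_pM2r ?invr_gt0//; apply: le_trans (cnorm2B_le _ _) _.
by rewrite ler_pM2l// lerD2r.
Qed.

Lemma f_Y_e1E n (i0 : 'I_n) (rho s2 : R) (m : R[i]) (y : 'I_n -> R[i]) : i0 = 0%N :> nat ->
  f_Y_e1 rho m s2 y = pi ^- n * expR (- vnorm2 y) * gratio (n%:R * rho) s2 m (y i0).
Proof.
move=> i00; rewrite /f_Y_e1 /cn_diag_pdf /vnorm2 (bigD1 i0)//= i00 eqxx.
rewrite [in RHS](bigD1 i0)//=.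
have -> : \prod_(i < n | i != i0) ((pi * (if (i : nat) == 0%N then s2 * n%:R * rho + 1 else 1))^-1 *
    expR (- (cnorm2 (y i - (if (i : nat) == 0%N then m * rC (Num.sqrt (n%:R * rho)) else 0)) /
      (if (i : nat) == 0%N then s2 * n%:R * rho + 1 else 1)))) =
    \prod_(i < n | i != i0) (pi^-1 * expR (- cnorm2 (y i))).
  apply: eq_bigr => i ii; have /negbTE -> : (i : nat) != 0%N by rewrite -i00.
  by rewrite mulr1 subr0 divr1.
rewrite big_split/= prodr_const -expR_sum sumrN.
have -> : #|[pred i | i != i0]| = n.-1.
  by rewrite cardC1 card_ord.
rewrite opprD expRD /gratio invfM (mulrC m) mulrA -exprVn.
have nS : n = n.-1.+1 by rewrite prednK// (leq_ltn_trans _ (ltn_ord i0)).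
rewrite [in pi^-1 ^+ n]nS exprS expRD (expRN (cnorm2 (y i0))) -!mulrA.
move: (pi^-1) (pi^-1 ^+ n.-1) (expR (- (_ / _))) (expR (- \sum_(i < n | _) _)) => f a b e.
have := expR_gt0 (cnorm2 (y i0)); move: (expR (cnorm2 (y i0))) ((s2 * (n%:R * rho) + 1)^-1) => g0 w g00.
have g1 : g0 != 0 by rewrite gt_eqF.
by field; rewrite g1.
Qed.

Lemma fineMl (a : R) (x : \bar R) : 0 < a -> fine (a%:E * x)%E = a * fine x.
Proof.
move=> a0; case: x => [x| |] //=.
  by rewrite gt0_muley ?lte_fin//= mulr0.
by rewrite gt0_muleNy ?lte_fin//= mulr0.
Qed.

Section output.
Context d (T : measurableType d) (P : probability T R).
Variables (n : nat) (i0 : 'I_n) (X : 'I_n * bool -> T -> R).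
Hypotheses (i00 : i0 = 0%N :> nat) (gX : gfam P X).

Definition out_ratio (c s2 : R) (h : R[i]) (n2 : R) : R :=
  fine (sphere_ratio P (i0, false) (i0, true) X c s2 h n2).

Lemma cnorm2_slot (n2 : R) t : 0 <= n2 ->
  cnorm2 (mkC (Num.sqrt n2 * (X (i0, false) t / Num.sqrt (sqn (X^~ t))))
     (- (Num.sqrt n2 * (X (i0, true) t / Num.sqrt (sqn (X^~ t)))))) <= n2.
Proof.
move=> n20; rewrite /cnorm2 /= sqrrN !exprMn exprVn !sqr_sqrtr ?sqn_ge0// -mulrDr -mulrDl.
rewrite -[leRHS]mulr1 ler_wpM2l//.
have le : X (i0, false) t ^+ 2 + X (i0, true) t ^+ 2 <= sqn (X^~ t).
  rewrite /sqn (bigD1 (i0, false))//= (bigD1 (i0, true)) /= ?xpair_eqE ?andbF// addrA lerDl.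
  by apply: sumr_ge0 => j _; exact: sqr_ge0.
have [->|n0] := eqVneq (sqn (X^~ t)) 0; first by rewrite invr0 mulr0.
have s0 : 0 < sqn (X^~ t) by rewrite lt_neqAle eq_sym n0 sqn_ge0.
by rewrite ler_pdivrMr// mul1r.
Qed.

Lemma measurable_slot_ratio (c s2 : R) (h : R[i]) (n2 : R) : measurable_fun setT (fun t =>
  (gratio c s2 h (mkC (Num.sqrt n2 * (X (i0, false) t / Num.sqrt (sqn (X^~ t))))
     (- (Num.sqrt n2 * (X (i0, true) t / Num.sqrt (sqn (X^~ t)))))))%:E).
Proof.
have mX j := gX.1 j; have ms := measurableT_comp (@mfun_sqn R _) (mX_vec gX).
by rewrite /gratio /cnorm2; case: h => a b /=; mfun.
Qed.

(** The argument of [gratio] has modulus at most sqrt n2 by [cnorm2_slot], so [gratio] lies between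
    two positive constants; its average is then finite and positive, which makes division by the
    output density meaningful. *)
Lemma out_ratio_fin (c s2 : R) (h : R[i]) (n2 : R) : 0 <= c -> 0 <= s2 -> 0 <= n2 ->
  sphere_ratio P (i0, false) (i0, true) X c s2 h n2 = (out_ratio c s2 h n2)%:E /\
  0 < out_ratio c s2 h n2.
Proof.
move=> c0 s0 n20.
have mf := measurable_slot_ratio c s2 h n2.
pose lo := (s2 * c + 1)^-1 * expR (- (2 * (n2 + cnorm2 (rC (Num.sqrt c) * h)) / (s2 * c + 1))).
pose hi := (s2 * c + 1)^-1 * expR n2.
have v0 : 0 < s2 * c + 1 by rewrite ltr_wpDl// mulr_ge0.
have lo0 : 0 < lo by rewrite mulr_gt0 ?expR_gt0// invr_gt0.
have hi0 : 0 < hi by rewrite mulr_gt0 ?expR_gt0// invr_gt0.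
have loE : (lo%:E <= sphere_ratio P (i0, false) (i0, true) X c s2 h n2)%E.
  have -> : (lo%:E = \int[P]_t (cst lo%:E) t)%E.
    by rewrite integral_cst// [X in (_ * X)%E](probability_setT P) mule1.
  apply: ge0_le_integral => //.
  - by move=> t _; rewrite lee_fin ltW.
  - by move=> t _; rewrite lee_fin gratio_ge// cnorm2_slot.
have hiE : (sphere_ratio P (i0, false) (i0, true) X c s2 h n2 <= hi%:E)%E.
  have -> : (hi%:E = \int[P]_t (cst hi%:E) t)%E.
    by rewrite integral_cst// [X in (_ * X)%E](probability_setT P) mule1.
  apply: ge0_le_integral => //.
  - by move=> t _; rewrite lee_fin ltW// gratio_gt0.
  - by move=> t _; rewrite lee_fin gratio_le// cnorm2_slot.
have e : sphere_ratio P (i0, false) (i0, true) X c s2 h n2 = (out_ratio c s2 h n2)%:E.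
  rewrite /out_ratio fineK// ge0_fin_numE; first by rewrite (le_lt_trans hiE)// ltry.
  by apply: le_trans loE; rewrite lee_fin ltW.
by split=> //; move: loE; rewrite e lee_fin; exact: lt_le_trans.
Qed.

Lemma out_ratio0 (c s2 : R) (h : R[i]) : out_ratio c s2 h 0 = gratio c s2 h 0.
Proof.
rewrite /out_ratio /sphere_ratio.
have -> : (\int[P]_t (gratio c s2 h (mkC (Num.sqrt 0 * (X (i0, false) t / Num.sqrt (sqn (X^~ t))))
     (- (Num.sqrt 0 * (X (i0, true) t / Num.sqrt (sqn (X^~ t)))))))%:E =
   \int[P]_t (cst (gratio c s2 h 0)%:E) t)%E.
  by apply: eq_integral => t _; rewrite sqrtr0 !mul0r oppr0.
by rewrite integral_cst// [X in (_ * X)%E](probability_setT P) mule1.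
Qed.

(** The power of the square root in the denominator of the integrand cancels the prefactor of
    [besselI]. For y = 0 and block length above 1 the denominator is 0 and the integrand is read as
    0, hence the side condition. *)
Lemma f_YE (rho s : R) (m : R[i]) (y : 'I_n -> R[i]) : 0 < rho -> 0 < s ->
  vnorm2 y != 0 \/ n.-1 = 0%N ->
  f_Y rho m (s ^+ 2) y =
    pi ^- n * expR (- vnorm2 y) * out_ratio (n%:R * rho) (s ^+ 2) m (vnorm2 y).
Proof.
move=> rho0 s0 yn.
have n0 : (0 < n)%N by rewrite (leq_ltn_trans _ (ltn_ord i0)).
have v0 : 0 <= vnorm2 y by apply: sumr_ge0 => i _; exact: cnorm2_ge0.
have c0 : 0 <= n%:R * rho by rewrite mulr_ge0// ltW.
have jj : (i0, false) != (i0, true) by rewrite xpair_eqE andbF.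
have cJ : #|{: 'I_n * bool}| = n.-1.+1.*2.
  by rewrite card_prod card_ord card_bool muln2 prednK.
rewrite /out_ratio (sphere_ratioE jj cJ m gX c0 s0 v0) fineMl; last first.
  by rewrite !mulr_gt0 ?expR_gt0 ?invr_gt0 ?exprn_gt0// ltr0n fact_gt0.
rewrite /f_Y; have -> : (\int[mu]_(z in `[0%R, +oo[) (f_Y_integrand rho m (s ^+ 2) y z)%:E =
   \int[mu]_(z in `[0%R, +oo[) (expR (- ((n%:R * rho + s ^- 2) * z)) *
       bessel_series 0 (z * (cnorm2 m / s ^+ 4)) *
       bessel_series n.-1 (vnorm2 y * (n%:R * rho) * z))%:E)%E.
  have E z : 0 < z -> f_Y_integrand rho m (s ^+ 2) y z = expR (- ((n%:R * rho + s ^- 2) * z)) *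
       bessel_series 0 (z * (cnorm2 m / s ^+ 4)) *
       bessel_series n.-1 (z * (vnorm2 y * (n%:R * rho))).
    move=> z0; rewrite /f_Y_integrand.
    have -> : vnorm2 y * rho * n%:R * z = z * (vnorm2 y * (n%:R * rho)).
      by move: (vnorm2 y) (n%:R) => p q; ring.
    rewrite -exprM (mulrC rho) besselI_sqrt; last first.
      by rewrite divr_ge0 ?exprn_ge0 ?mulr_ge0 ?cnorm2_ge0// ltW.
    rewrite besselI_sqrt; last by rewrite !mulr_ge0// ltW.
    rewrite expr0 mul1r -!mulrA; congr (_ * _); move: (bessel_series 0 _) => B.
    set q := Num.sqrt _; have [q0|qn] := boolP (q ^+ n.-1 == 0); last first.
      by rewrite mulrCA (mulrA (q ^- _)) mulVf// mul1r.
    case: yn => [yn|n10]; last by move: q0; rewrite n10 expr0 oner_eq0.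
    exfalso; move: q0; rewrite expf_eq0 => /andP[_]; rewrite gt_eqF// sqrtr_gt0.
    by rewrite !mulr_gt0 ?ltr0n// lt_neqAle eq_sym yn.
  have mg : measurable_fun (`]0%R, +oo[%classic : set R) (fun z =>
      (expR (- ((n%:R * rho + s ^- 2) * z)) * bessel_series 0 (z * (cnorm2 m / s ^+ 4)) *
       bessel_series n.-1 (z * (vnorm2 y * (n%:R * rho))))%:E).
    apply: (@measurable_funS _ _ _ _ (`[0%R, +oo[%classic : set R)) => //.
      by move=> z; rewrite /= !in_itv/= !andbT; exact: ltW.
    apply/measurable_EFinP; apply: measurable_funM; last first.
      by apply: measurable_bessel_series; rewrite mulr_ge0.
    apply: measurable_funM; first by apply: measurable_funTS; mfun.
    by apply: measurable_bessel_series; rewrite divr_ge0 ?exprn_ge0 ?cnorm2_ge0// ltW.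
  (* The same degeneracy occurs at z = 0, so this endpoint is dropped from the domain. *)
  rewrite -!integral_itv_obnd_cbnd.
  - apply: eq_integral => z; rewrite inE/= in_itv/= andbT => z0.
    by rewrite E// [vnorm2 y * _ * z]mulrC.
  - by apply: eq_measurable_fun mg => z _; rewrite [vnorm2 y * _ * z]mulrC.
  - apply: eq_measurable_fun mg => z; rewrite inE/= in_itv/= andbT => z0.
    by rewrite E.
rewrite -exprVn.
move: (expR (- vnorm2 y)) (expR _) (fine _) (_`!%:R) => a b e f.
by rewrite invfM exprVn; move: (s^-2) (pi^-n) => g h; ring.
Qed.

Lemma vnorm2_eq0 (y : 'I_n -> R[i]) i : vnorm2 y = 0 -> y i = 0.
Proof.
move=> /eqP; rewrite /vnorm2 psumr_eq0; last by move=> j _; exact: cnorm2_ge0.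
move=> /allP /(_ i); rewrite mem_index_enum => /(_ isT) /=.
case: (y i) => a b; rewrite /cnorm2 /= paddr_eq0 ?sqr_ge0// !sqrf_eq0 => /andP[/eqP -> /eqP ->].
by [].
Qed.

Lemma expR_Sfun (rho s : R) (m : R[i]) (w : 'I_n -> R[i]) : 0 < rho -> 0 < s ->
  expR (Sfun rho m (s ^+ 2) w) =
  gratio (n%:R * rho) (s ^+ 2) m (Wtilde rho m (s ^+ 2) w i0) /
  out_ratio (n%:R * rho) (s ^+ 2) m (vnorm2 (Wtilde rho m (s ^+ 2) w)).
Proof.
move=> rho0 s0; rewrite /Sfun; move: (Wtilde _ _ _ _) => y.
have c0 : 0 <= n%:R * rho by rewrite mulr_ge0// ltW.
have s20 : 0 <= s ^+ 2 by rewrite sqr_ge0.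
have v0 : 0 <= vnorm2 y by apply: sumr_ge0 => i _; exact: cnorm2_ge0.
have g0 := gratio_gt0 m (y i0) c0 s20.
have [_ o0] := out_ratio_fin m c0 s20 v0.
have [yn|] := boolP ((vnorm2 y == 0) && (0 < n.-1)%N); last first.
  move=> yn; rewrite f_YE//; last first.
    by move: yn; rewrite negb_and lt0n negbK => /orP[?|/eqP ?]; [left|right].
  rewrite (f_Y_e1E _ _ _ _ i00) -mulf_div divff ?mul1r ?lnK ?posrE ?divr_gt0//.
  by rewrite mulf_neq0 ?gt_eqF ?expR_gt0// invr_gt0 exprn_gt0// pi_gt0.
(* At y = 0 with block length above 1 the conventions give f_Y = 0, quotient 0 and ln 0 = 0, so the
   left side is 1. The right side is 1 too, since by [out_ratio0] averaging over the sphere changes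
   nothing at a zero output. Thus no null set has to be removed. *)
have /andP[/eqP y0 n1] := yn.
rewrite y0 out_ratio0 (vnorm2_eq0 _ y0) divff; last by rewrite gt_eqF// gratio_gt0.
have -> : f_Y rho m (s ^+ 2) y = 0.
  rewrite /f_Y.
  have -> : (\int[mu]_(z in `[0%R, +oo[) (f_Y_integrand rho m (s ^+ 2) y z)%:E = 0)%E.
    apply: integral0_eq => z _; rewrite /f_Y_integrand y0 !mul0r sqrtr0.
    by rewrite expr0n gtn_eqF//= invr0 mulr0 !mul0r.
  by rewrite /= mulr0.
by rewrite invr0 mulr0 ln0// expR0.
Qed.

End output.
End output_density.

(** * The channel after pilot-assisted estimation *)

Section complex_measurability.
Variable R : realType.
Context d (T : measurableType d).
Implicit Types f g : T -> R[i].

Definition cmfun f := measurable_fun setT (fun t => complex.Re (f t)) /\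
  measurable_fun setT (fun t => complex.Im (f t)).

Lemma cmfun_cst z : cmfun (fun=> z).
Proof. by split; exact: measurable_cst. Qed.

Lemma cmfun_mkC (a b : T -> R) : measurable_fun setT a -> measurable_fun setT b ->
  cmfun (fun t => mkC (a t) (b t)).
Proof. by []. Qed.

Lemma cmfun_rC (a : T -> R) : measurable_fun setT a -> cmfun (fun t => rC (a t)).
Proof. by split => //; exact: measurable_cst. Qed.

Lemma cmfun_add f g : cmfun f -> cmfun g -> cmfun (fun t => f t + g t).
Proof.
move=> [f1 f2] [g1 g2]; split.
  rewrite (_ : (fun _ => _) = fun t => complex.Re (f t) + complex.Re (g t)); first by mfun.
  by apply/funext => t; case: (f t); case: (g t).
rewrite (_ : (fun _ => _) = fun t => complex.Im (f t) + complex.Im (g t)); first by mfun.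
by apply/funext => t; case: (f t); case: (g t).
Qed.

Lemma cmfun_opp f : cmfun f -> cmfun (fun t => - f t).
Proof.
move=> [f1 f2]; split.
  rewrite (_ : (fun _ => _) = fun t => - complex.Re (f t)); first by mfun.
  by apply/funext => t; case: (f t).
rewrite (_ : (fun _ => _) = fun t => - complex.Im (f t)); first by mfun.
by apply/funext => t; case: (f t).
Qed.

Lemma cmfun_conj f : cmfun f -> cmfun (fun t => ((f t)^*)%C).
Proof.
move=> [f1 f2]; split.
  rewrite (_ : (fun _ => _) = fun t => complex.Re (f t)); first by mfun.
  by apply/funext => t; case: (f t).
rewrite (_ : (fun _ => _) = fun t => - complex.Im (f t)); first by mfun.
by apply/funext => t; case: (f t).
Qed.

Lemma cmfun_mul f g : cmfun f -> cmfun g -> cmfun (fun t => f t * g t).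
Proof.
move=> [f1 f2] [g1 g2]; split.
  rewrite (_ : (fun _ => _) = fun t =>
    complex.Re (f t) * complex.Re (g t) - complex.Im (f t) * complex.Im (g t)); first by mfun.
  by apply/funext => t; case: (f t); case: (g t).
rewrite (_ : (fun _ => _) = fun t =>
  complex.Re (f t) * complex.Im (g t) + complex.Im (f t) * complex.Re (g t)); first by mfun.
by apply/funext => t; case: (f t); case: (g t).
Qed.

Lemma cmfun_sum I (s : seq I) (h : I -> T -> R[i]) : (forall i, cmfun (h i)) ->
  cmfun (fun t => \sum_(i <- s) h i t).
Proof.
move=> mh; elim: s => [|i s IH].
  rewrite (_ : (fun _ => _) = fun=> 0); first exact: cmfun_cst.
  by apply/funext => t; rewrite big_nil.
rewrite (_ : (fun _ => _) = fun t => h i t + \sum_(j <- s) h j t); first exact: cmfun_add.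
by apply/funext => t; rewrite big_cons.
Qed.

Lemma mfun_cnorm2 f : cmfun f -> measurable_fun setT (fun t => cnorm2 (f t)).
Proof. by move=> [f1 f2]; rewrite /cnorm2; mfun. Qed.

Lemma mfun_vnorm2 n (f : 'I_n -> T -> R[i]) : (forall i, cmfun (f i)) ->
  measurable_fun setT (fun t => vnorm2 (f^~ t)).
Proof. by move=> mf; apply: mfun_sumT => i; exact: mfun_cnorm2. Qed.

Lemma mfun_gratio (c s2 : R) f g : cmfun f -> cmfun g ->
  measurable_fun setT (fun t => gratio c s2 (f t) (g t)).
Proof.
move=> mf mg; rewrite /gratio.
have m1 : measurable_fun setT (fun t => cnorm2 (g t - rC (Num.sqrt c) * f t)).
  apply: mfun_cnorm2; apply: cmfun_add mg _; apply: cmfun_opp; apply: cmfun_mul mf.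
  exact: cmfun_cst.
have m2 := mfun_cnorm2 mg.
by mfun.
Qed.

End complex_measurability.

Lemma cmfun_comp (R : realType) d d' (T : measurableType d) (T' : measurableType d')
    (f : T' -> R[i]) (h : T -> T') : measurable_fun setT h -> cmfun f -> cmfun (f \o h).
Proof. by move=> mh [f1 f2]; split; [exact: measurableT_comp f1 mh|exact: measurableT_comp f2 mh]. Qed.

Lemma cmfun_cx (R : realType) (K : finType) (k : K) :
  cmfun ((fun v => cx v k) : vec R (K * bool)%type -> R[i]).
Proof. by apply: cmfun_mkC; exact: mfun_coord. Qed.

Lemma complex_eq (R : realType) (z w : R[i]) :
  complex.Re z = complex.Re w -> complex.Im z = complex.Im w -> z = w.
Proof. by case: z => a b; case: w => a' b' /= -> ->. Qed.

Lemma rCV (R : realType) (x : R) : (rC x)^-1 = rC x^-1.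
Proof. by rewrite -[RHS]/(real_complex R x^-1) fmorphV. Qed.

Section normalisation.
Variable R : realType.
Context d (T : measurableType d) (P : probability T R).

Lemma gfam_standardize (I : finType) (f : I -> T -> R) (m s : I -> R) :
  (forall i, 0 < s i) -> (forall i, has_normal_law P (f i) (m i) (s i * Num.sqrt (1 / 2))) ->
  mutually_independent P f -> gfam P (fun i t => (f i t - m i) / s i).
Proof.
move=> s0 nf indf; split=> [i|A mA].
  by have [mf _] := nf i; mfun.
pose B i := [set x | A i ((x - m i) / s i)].
have mB i : measurable (B i).
  have mg : measurable_fun setT (fun x : R => (x - m i) / s i) by mfun.
  by rewrite -[B i]setTI; exact: mg.
have -> : [set t | forall i, A i ((f i t - m i) / s i)] =
    \bigcap_(i in [set` index_enum I]) (f i @^-1` B i).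
  apply/seteqP; split => t /= h i; first by move=> _; exact: h.
  by apply: h; rewrite /= mem_index_enum.
apply: etrans (indf _ _ (index_enum_uniq I) mB) _; apply: eq_bigr => i _.
by have [_ /(_ _ (mB i)) ->] := nf i; exact: (normal_std (m i) (s0 i) (mA i)).
Qed.

(** Regroups each block under one index type: [None] is the fading, [Some i] the noise in channel
    use [i], and the boolean is outermost so that [cx] reads complex values. *)
Definition chan_slot (l n : nat) (j : ('I_l * option 'I_n) * bool) : 'I_l * bool + 'I_l * 'I_n * bool :=
  match j with (k, None, b) => inl (k, b) | (k, Some i, b) => inr (k, i, b) end.

Lemma chan_slot_inj l n : injective (@chan_slot l n).
Proof. by move=> [[k [i|]] b] [[k' [i'|]] b'] //= [] -> -> => [->|]. Qed.

(** Serves the channel and the variables of the bound alike, which have the same shape with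
    different variance and block length. *)
Lemma rician_gfam (l n : nat) (mu s : R) (Hre Him : 'I_l -> T -> R) (Wre Wim : 'I_l -> 'I_n -> T -> R) :
  0 < s -> rician_model P mu (s ^+ 2) Hre Him Wre Wim ->
  exists X : ('I_l * option 'I_n) * bool -> T -> R,
  [/\ gfam P X,
      forall k t, mkC (Hre k t) (Him k t) = rC mu + rC s * cx (X^~ t) (k, None) &
      forall k i t, mkC (Wre k i t) (Wim k i t) = cx (X^~ t) (k, Some i)].
Proof.
move=> s0 [nH [nW ind]].
pose m (j : 'I_l * bool + 'I_l * 'I_n * bool) := if j is inl (_, false) then mu else 0.
pose sd (j : 'I_l * bool + 'I_l * 'I_n * bool) := if j is inl _ then s else 1.
have sd0 j : 0 < sd j by case: j.
have sE : Num.sqrt (s ^+ 2 / 2) = s * Num.sqrt (1 / 2).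
  by rewrite mul1r sqrtrM ?sqr_ge0// sqrtr_sqr gtr0_norm.
have law j : has_normal_law P (chan_family Hre Him Wre Wim j) (m j) (sd j * Num.sqrt (1 / 2)).
  case: j => [[k b]|[[k i] b]]; last first.
    have [h1 h2] := nW k i; have sd1 : sd (inr (k, i, b)) = 1 by [].
    have m0 : m (inr (k, i, b)) = 0 by [].
    rewrite sd1 m0 (mul1r (Num.sqrt _)) /chan_family; case: b {sd1 m0}.
      by move: h2; rewrite [complex.Im 0]/(0 : R).
    by move: h1; rewrite [complex.Re 0]/(0 : R).
  have [h1 h2] := nH k; rewrite sE in h1 h2; have sds : sd (inl (k, b)) = s by [].
  have mb : m (inl (k, b)) = if b then 0 else mu by rewrite /m; case: b {sds}.
  rewrite sds mb /chan_family; case: b {sds mb}.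
    by move: h2; rewrite [complex.Im _]/(0 : R).
  by have e : complex.Re (rC mu) = mu by []; rewrite e in h1.
exists (fun j t => (chan_family Hre Him Wre Wim (chan_slot j) t - m (chan_slot j)) / sd (chan_slot j)).
split.
- have g := gfam_standardize sd0 law ind.
  exact: (gfam_reindex (@chan_slot_inj l n) g).
- move=> k t; apply: complex_eq; rewrite /= ?subr0 ?mul0r ?mulr0 ?oppr0 ?addr0 ?add0r ?subr0.
  + by rewrite mulrC divfK ?gt_eqF// addrC subrK.
  + by rewrite mulrC divfK ?gt_eqF.
- by move=> k i t; rewrite /cx /= !subr0 !divr1.
Qed.

End normalisation.

Lemma gpres_givens_blocks (R : realType) (K : finType) (B : eqType) (ka kb : B -> K) (c s : R)
    (r : seq B) : c ^+ 2 + s ^+ 2 = 1 -> injective ka -> injective kb ->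
  (forall a b, ka a != kb b) -> uniq r ->
  exists O : (K * bool -> R) -> K * bool -> R,
  [/\ gpres O,
      forall b v, b \in r -> cx (O v) (ka b) = rC c * cx v (ka b) + rC s * cx v (kb b),
      forall b v, b \in r -> cx (O v) (kb b) = - rC s * cx v (ka b) + rC c * cx v (kb b) &
      forall v j e, (forall b, b \in r -> j != ka b /\ j != kb b) -> O v (j, e) = v (j, e)].
Proof.
move=> cs ia ib ab; elim: r => [|b r IH].
  by move=> _; exists id; split => //; exact: gpres_id.
move=> /= /andP[br /IH [ O [gO Oa Ob Oc]]].
have [ O1 [gO1 O1a O1b O1c]] := gpres_givens (ab b b) cs.
have fa v b' : b' \in r -> cx (O1 (O v)) (ka b') = cx (O v) (ka b').
  move=> b'r; apply: cx_eq => e; apply: O1c; last exact: ab.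
  by apply: contraNneq br => /ia <-.
have fb v b' : b' \in r -> cx (O1 (O v)) (kb b') = cx (O v) (kb b').
  move=> b'r; apply: cx_eq => e; apply: O1c; first by rewrite eq_sym; exact: ab.
  by apply: contraNneq br => /ib <-.
have ga v : cx (O v) (ka b) = cx v (ka b).
  apply: cx_eq => e; apply: Oc => b' b'r; split; last exact: ab.
  by apply: contraNneq br => /ia ->.
have gb v : cx (O v) (kb b) = cx v (kb b).
  apply: cx_eq => e; apply: Oc => b' b'r; split; first by rewrite eq_sym; exact: ab.
  by apply: contraNneq br => /ib ->.
exists (O1 \o O); split.
- exact: gpres_comp.
- move=> b' v; rewrite inE => /orP[/eqP ->|b'r] /=; first by rewrite O1a ga gb.
  by rewrite fa// Oa.
- move=> b' v; rewrite inE => /orP[/eqP ->|b'r] /=; first by rewrite O1b ga gb.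
  by rewrite fb// Ob.
- move=> v j e h /=; have [ja jb] := h b (mem_head _ _).
  by rewrite O1c// Oc// => b' b'r; apply: h; rewrite inE b'r orbT.
Qed.

(** After the pilot reduction a block has three kinds of slot: [None] for the normalised estimate,
    [Some None] for the estimation residual, [Some (Some i)] for the noise in data use [i]. *)
Definition noise (R : realType) (l n : nat) (v : ('I_l * option (option 'I_n)) * bool -> R)
  (k : 'I_l) (i : 'I_n) : R[i] := cx v (k, Some (Some i)).

Section pilots.
Variables (R : realType) (l nc np : nat) (kappa rho : R).
Hypotheses (np0 : (0 < np)%N) (npc : (np <= nc)%N) (rho0 : 0 < rho) (kappa0 : 0 <= kappa).
Local Notation slots := ('I_l * option (option 'I_(nc - np)))%type.

Definition est (v : slots * bool -> R) (k : 'I_l) : R[i] :=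
  rC (muH kappa) + rC (Num.sqrt (sigmaH2 kappa + sigmae2 np rho)) * cx v (k, None).
(** Conditional mean of the fading given the estimate, plus an independent residual of variance
    [sigmap2]; the minus sign comes from the second row of the Givens rotation that produces the
    residual. *)
Definition fade (v : slots * bool -> R) (k : 'I_l) : R[i] :=
  Defs.mup kappa np rho (est v k) - rC (Num.sqrt (sigmap2 kappa np rho)) * cx v (k, Some None).

Definition pilot_pos (i : 'I_np) : 'I_nc := cast_ord (subnKC npc) (lshift _ i).
Definition data_pos (i : 'I_(nc - np)) : 'I_nc := cast_ord (subnKC npc) (rshift _ i).
Definition with_pilots (x : 'I_l -> 'I_(nc - np) -> R[i]) (k : 'I_l) (i : 'I_nc) : R[i] :=
  match fintype.split (cast_ord (esym (subnKC npc)) i) with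
  | inl _ => rC (Num.sqrt rho) | inr j => x k j end.
(** The maximum-likelihood estimate: with all pilots equal to sqrt rho it is the fading plus noise
    of variance 1 / (np rho). *)
Definition pilot_est (y : 'I_l -> 'I_nc -> R[i]) (k : 'I_l) : R[i] :=
  rC (np%:R * Num.sqrt rho)^-1 * \sum_(i < np) y k (pilot_pos i).
Definition data_out (y : 'I_l -> 'I_nc -> R[i]) (k : 'I_l) (i : 'I_(nc - np)) : R[i] :=
  y k (data_pos i).

Lemma with_pilots_pilot x k i : with_pilots x k (pilot_pos i) = rC (Num.sqrt rho).
Proof. by rewrite /with_pilots /pilot_pos cast_ordK (unsplitK (inl i)). Qed.

Lemma with_pilots_data x k i : with_pilots x k (data_pos i) = x k i.
Proof. by rewrite /with_pilots /data_pos cast_ordK (unsplitK (inr i)). Qed.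

Lemma cnorm2_rC (x : R) : cnorm2 (rC x) = x ^+ 2.
Proof. by rewrite /cnorm2 /= expr0n addr0. Qed.

Lemma vnorm2_with_pilots x k : vnorm2 (x k) = (nc - np)%:R * rho ->
  vnorm2 (with_pilots x k) = nc%:R * rho.
Proof.
move=> xk; rewrite /vnorm2.
rewrite (reindex (cast_ord (subnKC npc)))/=; last first.
  by exists (cast_ord (esym (subnKC npc))) => i _; rewrite ?cast_ordK ?cast_ordKV.
rewrite big_split_ord/=.
under eq_bigr do rewrite -/(pilot_pos _) with_pilots_pilot cnorm2_rC sqr_sqrtr ?(ltW rho0)//.
under [X in _ + X]eq_bigr do rewrite -/(data_pos _) with_pilots_data.
rewrite [X in _ + X](_ : _ = vnorm2 (x k))// xk sumr_const card_ord -(mulr_natl rho) -mulrDl -natrD.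
by rewrite subnKC.
Qed.

Lemma sigmaH2_gt0 : 0 < sigmaH2 kappa :> R.
Proof. by rewrite invr_gt0 ltr_pwDl. Qed.

Lemma sigmae2_gt0 : 0 < sigmae2 np rho :> R.
Proof. by rewrite invr_gt0 mulr_gt0// ltr0n. Qed.

Lemma sigmap2_gt0 : 0 < sigmap2 kappa np rho :> R.
Proof. by rewrite divr_gt0 ?mulr_gt0 ?addr_gt0 ?sigmaH2_gt0 ?sigmae2_gt0. Qed.

Lemma mupE (h : R[i]) : Defs.mup kappa np rho h =
  rC (sigmaH2 kappa / (sigmaH2 kappa + sigmae2 np rho)) * h +
  rC (sigmae2 np rho * muH kappa / (sigmaH2 kappa + sigmae2 np rho)).
Proof. by rewrite /Defs.mup rCV mulrDl -!rCM mulrAC -rCM. Qed.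

(** The residual is stored where the noise of the pilot [p0] was; the remaining pilot slots are
    forgotten. *)
Definition chan_emb (p0 : 'I_np) (j : slots * bool) : ('I_l * option 'I_nc) * bool :=
  match j with
  | (k, None, b) => (k, None, b)
  | (k, Some None, b) => (k, Some (pilot_pos p0), b)
  | (k, Some (Some i), b) => (k, Some (data_pos i), b) end.

Lemma pilot_data i j : pilot_pos i != data_pos j.
Proof. by rewrite -val_eqE /= neq_ltn (leq_trans (ltn_ord i)) ?leq_addr. Qed.

Lemma chan_emb_inj p0 : injective (chan_emb p0).
Proof.
move=> [[k [[i|]|]] b] [[k' [[i'|]|]] b'] //=.
- by move=> [-> /addnI/val_inj -> ->].
- by move=> [_ e _]; have := pilot_data p0 i; rewrite -val_eqE /= e eqxx.
- by move=> [_ e _]; have := pilot_data p0 i'; rewrite -val_eqE /= e eqxx.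
- by move=> [-> ->].
- by move=> [-> ->].
Qed.

Context d (T : measurableType d) (P : probability T R).

(** Two unitary maps are applied. [O1] brings the normalised sum of the pilot noises of each block
    to [p0]. [O2] rotates fading and pilot sum by the angle of cosine sH / tau and sine se / tau:
    one output is the centred estimate over its standard deviation tau, the other, orthogonal to it,
    is the residual. [Z] is chosen before the codeword, which enters only through the data
    equation. *)
Lemma channel_normal_form (Hre Him : 'I_l -> T -> R) (Wre Wim : 'I_l -> 'I_nc -> T -> R) :
  rician_model P (muH kappa) (sigmaH2 kappa) Hre Him Wre Wim ->
  exists Z : slots * bool -> T -> R, gfam P Z /\
    forall x t k, let y := chan_out Hre Him Wre Wim (with_pilots x) t in
    pilot_est y k = est (Z^~ t) k /\
    forall i, data_out y k i = fade (Z^~ t) k * x k i + noise (Z^~ t) k i.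
Proof.
have sH0 := sigmaH2_gt0; have se0 := sigmae2_gt0.
set sH := Num.sqrt (sigmaH2 kappa); set se := Num.sqrt (sigmae2 np rho).
have sHE : sH ^+ 2 = sigmaH2 kappa by rewrite sqr_sqrtr// ltW.
have seE : se ^+ 2 = sigmae2 np rho by rewrite sqr_sqrtr// ltW.
have sHp : 0 < sH by rewrite sqrtr_gt0.
have sep : 0 < se by rewrite sqrtr_gt0.
set tau := Num.sqrt (sigmaH2 kappa + sigmae2 np rho).
have tauE : tau ^+ 2 = sH ^+ 2 + se ^+ 2 by rewrite sHE seE sqr_sqrtr// ltW// addr_gt0.
have tau0 : 0 < tau by rewrite sqrtr_gt0 addr_gt0.
have sp : Num.sqrt (sigmap2 kappa np rho) = sH * se / tau.
  rewrite /sigmap2 -sHE -seE -tauE -exprMn -expr_div_n sqrtr_sqr ger0_norm//.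
  by rewrite divr_ge0 ?mulr_ge0// ltW.
rewrite -sHE => /(rician_gfam sHp) [X [gX XH XW]].
pose p0 : 'I_np := Ordinal np0.
pose ps := p0 :: [seq i <- index_enum 'I_np | i != p0].
have psE (V : zmodType) (F : 'I_np -> V) : \sum_(i <- ps) F i = \sum_i F i.
  by rewrite big_cons big_filter [RHS](bigD1 p0).
have psu : uniq ps by rewrite /= mem_filter eqxx/= filter_uniq// index_enum_uniq.
pose slot k (i : 'I_np) : 'I_l * option 'I_nc := (k, Some (pilot_pos i)).
have slot_inj k : injective (slot k) by move=> i j [/val_inj].
have disj a b k : k \in map (slot a) ps -> k \in map (slot b) ps -> a = b.
  by move=> /mapP[i _ ->] /mapP[j _ [->]].
have [ O1 [gO1 O1r O1c _]] := @gpres_reduce_blocks R _ 'I_l (fun _ _ => 1) (slot^~ p0)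
  (fun k => [seq slot k i | i <- [seq i <- index_enum 'I_np | i != p0]])
  (fun k => etrans (map_inj_uniq (slot_inj k) ps) psu) disj.
have O1p k v : rC (Num.sqrt np%:R) * cx (O1 v) (slot k p0) = \sum_(i < np) cx v (slot k i).
  have := O1r k v; rewrite -(map_cons (slot k) p0) !big_map.
  rewrite !psE (_ : \sum_i cnorm2 1 = np%:R); last first.
    by rewrite sumr_const card_ord /cnorm2 /= expr0n addr0 expr1n.
  by move=> ->; apply: eq_bigr => i _; rewrite rmorph1 mul1r.
have cs : (sH / tau) ^+ 2 + (se / tau) ^+ 2 = 1.
  by rewrite !expr_div_n -mulrDl -tauE divff// sqrf_eq0 gt_eqF.
have ia : injective (fun k : 'I_l => (k, None) : 'I_l * option 'I_nc) by move=> a b [].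
have ib : injective (slot^~ p0) by move=> a b [].
have ab (a b : 'I_l) : (a, None) != slot b p0 by rewrite xpair_eqE andbF.
have [ O2 [gO2 O2a O2b O2c]] := gpres_givens_blocks cs ia ib ab (index_enum_uniq 'I_l).
pose X2 i t := O2 (O1 (X^~ t)) i.
have gX2 : gfam P X2 := (gpres_comp gO2 gO1).2 _ _ _ _ gX.
pose Z j := X2 (chan_emb p0 j); exists Z; split; first exact: (gfam_reindex (@chan_emb_inj p0) gX2).
move=> x t k y; set v := X^~ t.
have o1n : cx (O1 v) (k, None) = cx v (k, None).
  apply: cx_eq => b; apply: O1c => b'; rewrite -(map_cons (slot b') p0).
  by apply/negP => /mapP[].
have Zn : cx (Z^~ t) (k, None) = rC (sH / tau) * cx v (k, None) + rC (se / tau) * cx (O1 v) (slot k p0).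
  by rewrite -o1n -(O2a k (O1 v))// mem_index_enum.
have Zp : cx (Z^~ t) (k, Some None) = - rC (se / tau) * cx v (k, None) + rC (sH / tau) * cx (O1 v) (slot k p0).
  by rewrite -o1n -(O2b k (O1 v))// mem_index_enum.
have Zdb i b : O2 (O1 v) (k, Some (data_pos i), b) = v (k, Some (data_pos i), b).
  rewrite O2c; last first.
    move=> b' _; split; first by rewrite xpair_eqE andbF.
    by apply/negP => /eqP[_ e]; have := pilot_data p0 i; rewrite -val_eqE /= e eqxx.
  rewrite O1c// => b'; rewrite -(map_cons (slot b') p0); apply/negP => /mapP[j _ [_ e]].
  by have := pilot_data j i; rewrite -val_eqE /= e eqxx.
have Zd i : noise (Z^~ t) k i = cx v (k, Some (data_pos i)).
  by rewrite /noise /cx /Z /X2 /= !Zdb.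
have eE : est (Z^~ t) k = rC (muH kappa) + rC sH * cx v (k, None) + rC se * cx (O1 v) (slot k p0).
  rewrite /est -/tau Zn mulrDr !mulrA -!rCM addrA.
  by rewrite [tau * (sH / _)]mulrC divfK ?gt_eqF// [tau * (se / _)]mulrC divfK// gt_eqF.
split.
  rewrite eE /pilot_est.
  have -> : \sum_(i < np) y k (pilot_pos i) =
      rC (np%:R * Num.sqrt rho) * (rC (muH kappa) + rC sH * cx v (k, None)) +
      rC (Num.sqrt np%:R) * cx (O1 v) (slot k p0).
    rewrite O1p /y /chan_out.
    under eq_bigr do rewrite with_pilots_pilot XH XW -/v.
    rewrite big_split/= sumr_const card_ord; congr (_ + _).
    have natC : rC np%:R = np%:R :> R[i] by rewrite -[LHS]/(real_complex R np%:R) rmorph_nat.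
    move: (rC (muH kappa) + _) => A; rewrite -[LHS]mulr_natl rCM natC.
    by rewrite [A * _]mulrC mulrA.
  have rn0 : np%:R * Num.sqrt rho != 0 :> R by rewrite mulf_neq0 ?pnatr_eq0 -?lt0n// gt_eqF// sqrtr_gt0.
  rewrite mulrDr !mulrA -!rCM mulVf// mul1r; congr (_ + rC _ * _).
  have -> : se = (Num.sqrt np%:R * Num.sqrt rho)^-1.
    rewrite /se /sigmae2 (_ : np%:R * rho = (Num.sqrt np%:R * Num.sqrt rho) ^+ 2); last first.
      by rewrite exprMn !sqr_sqrtr// ltW.
    by rewrite -exprVn sqrtr_sqr ger0_norm// invr_ge0 mulr_ge0// sqrtr_ge0.
  have np2 : np%:R = Num.sqrt np%:R ^+ 2 :> R by rewrite sqr_sqrtr.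
  have a0 : Num.sqrt np%:R != 0 :> R by rewrite gt_eqF// sqrtr_gt0 ltr0n.
  have r0 : Num.sqrt rho != 0 by rewrite gt_eqF// sqrtr_gt0.
  rewrite {1}np2; move: (Num.sqrt np%:R) (Num.sqrt rho) a0 r0 => a r a0 r0.
  by field; rewrite ?a0 ?r0.
move=> i; rewrite /data_out /y /chan_out with_pilots_data XH XW -/v -Zd; congr (_ * _ + _).
rewrite /fade eE mupE Zp sp -sHE -seE -tauE.
move: (cx v _) (cx (O1 v) _) => h e.
have tn : tau != 0 by rewrite gt_eqF.
(* [e1], [e2] and [e3] are the coefficients of the fading slot, of the pilot noise and of the mean
   in [fade]; they recombine to sH, 0 and muH, so that [fade] is the original fading. *)
have e1 : sH ^+ 2 / tau ^+ 2 * sH + sH * se / tau * (se / tau) = sH.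
  transitivity (sH * ((sH ^+ 2 + se ^+ 2) / tau ^+ 2)); first by field.
  by rewrite -tauE divff ?mulr1// sqrf_eq0.
have e2 : sH ^+ 2 / tau ^+ 2 * se - sH * se / tau * (sH / tau) = 0 by field.
have e3 : sH ^+ 2 / tau ^+ 2 * muH kappa + se ^+ 2 * muH kappa / tau ^+ 2 = muH kappa.
  transitivity (muH kappa * ((sH ^+ 2 + se ^+ 2) / tau ^+ 2)); first by field.
  by rewrite -tauE divff ?mulr1// sqrf_eq0.
transitivity (rC (sH ^+ 2 / tau ^+ 2 * muH kappa + se ^+ 2 * muH kappa / tau ^+ 2) +
  rC (sH ^+ 2 / tau ^+ 2 * sH + sH * se / tau * (se / tau)) * h +
  rC (sH ^+ 2 / tau ^+ 2 * se - sH * se / tau * (sH / tau)) * e).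
  by rewrite e1 e2 e3 (_ : rC 0 = 0 :> R[i])// mul0r addr0.
have rCN (z : R) : rC (- z) = - rC z by apply: complex_eq; rewrite /= ?oppr0.
by rewrite !rCD rCN !rCM; ring.
Qed.

End pilots.

(** * Spherical codewords and the threshold score *)

Section big_rest.
Variables (I : finType) (i0 : I).

Definition rest : seq I := [seq i <- index_enum I | i != i0].

Lemma big_rest (V : nmodType) (F : I -> V) : \sum_(i <- i0 :: rest) F i = \sum_i F i.
Proof. by rewrite big_cons big_filter [RHS](bigD1 i0). Qed.

Lemma uniq_rest : uniq (i0 :: rest).
Proof. by rewrite /= mem_filter eqxx/= filter_uniq// index_enum_uniq. Qed.

End big_rest.

Lemma big_option (V : nmodType) (I : finType) (F : option I -> V) :
  \sum_o F o = F None + \sum_i F (Some i).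
Proof.
rewrite (bigD1 None)//=; congr (_ + _).
rewrite (reindex_omap Some id) /=; last by case.
by apply: eq_bigl => i; rewrite eqxx.
Qed.

Section codewords.
Variables (R : realType) (n : nat) (i0 : 'I_n) (c : R).
Hypothesis c0 : 0 < c.
Implicit Types x y w : 'I_n -> R[i].

Lemma indic_set1 (z : R) : \1_[set 0] z = (z == 0)%:R :> R.
Proof.
by rewrite indicE; case: eqVneq => [->|/eqP h]; [rewrite mem_set|rewrite memNset].
Qed.

Lemma Re_sum (I : Type) (r : seq I) (F : I -> R[i]) :
  complex.Re (\sum_(i <- r) F i) = \sum_(i <- r) complex.Re (F i).
Proof.
elim: r => [|i r IH]; first by rewrite !big_nil.
by rewrite !big_cons -IH; case: (F i); case: (\sum_(_ <- _) _).
Qed.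

Lemma cnorm2M (z w : R[i]) : cnorm2 (z * w) = cnorm2 z * cnorm2 w.
Proof. by case: z => a b; case: w => a' b'; rewrite /cnorm2 /=; ring. Qed.

Lemma cnorm2D (h x w : R[i]) : cnorm2 (h * x + w) =
  cnorm2 h * cnorm2 x + 2 * complex.Re ((h^*)%C * ((x^*)%C * w)) + cnorm2 w.
Proof.
by case: h => a b; case: x => a' b'; case: w => a'' b''; rewrite /cnorm2 /=; ring.
Qed.

Lemma vnorm2D (h : R[i]) x w : vnorm2 (fun i => h * x i + w i) =
  cnorm2 h * vnorm2 x + 2 * complex.Re ((h^*)%C * \sum_i ((x i)^*)%C * w i) + vnorm2 w.
Proof.
rewrite /vnorm2 mulr_sumr [in RHS]mulr_sumr Re_sum mulr_sumr -!big_split/=.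
by apply: eq_bigr => i _; rewrite cnorm2D.
Qed.

(** Matched filter. Division by sqrt c makes it a unit vector when |x|^2 = c, so that filtered noise
    is again CN(0, 1). *)
Definition ip x y : R[i] := rC (Num.sqrt c)^-1 * \sum_i ((x i)^*)%C * y i.

Lemma ipE x y : rC (Num.sqrt c) * ip x y = \sum_i ((x i)^*)%C * y i.
Proof. by rewrite /ip mulrA -rCM divff ?mul1r// gt_eqF// sqrtr_gt0. Qed.

Lemma sum_conj_mul (x : 'I_n -> R[i]) : \sum_i ((x i)^*)%C * x i = rC (vnorm2 x).
Proof.
rewrite /vnorm2; elim: (index_enum _) => [|i r IH]; first by rewrite !big_nil.
rewrite !big_cons IH rCD; congr (_ + _).
by case: (x i) => a b; apply: complex_eq; rewrite /cnorm2 /=; ring.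
Qed.

Lemma ip_out (h : R[i]) x w : vnorm2 x = c ->
  ip x (fun i => h * x i + w i) = rC (Num.sqrt c) * h + ip x w.
Proof.
move=> xc; rewrite /ip; under eq_bigr do rewrite mulrDr mulrCA.
rewrite big_split/= mulrDr -mulr_sumr sum_conj_mul xc; congr (_ + _).
rewrite mulrCA mulrC -rCM; congr (rC _ * _).
by rewrite -{2}[c]sqr_sqrtr ?(ltW c0)// expr2 mulrA mulVf ?mul1r// gt_eqF// sqrtr_gt0.
Qed.

(** [w'] stands for the noise after a unitary map sending x / sqrt c to the axis [i0], under which
    the whole signal sits on one coordinate. *)
Lemma vnorm2_out (h : R[i]) x w w' : vnorm2 x = c -> ip x w = w' i0 -> vnorm2 w' = vnorm2 w ->
  vnorm2 (fun i => h * x i + w i) =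
  vnorm2 (fun i => if i == i0 then rC (Num.sqrt c) * h + w' i else w' i).
Proof.
move=> xc xw ww; rewrite vnorm2D xc -ipE xw -ww /vnorm2 (bigD1 i0)//= [in RHS](bigD1 i0)//= eqxx.
rewrite [X in _ = _ + X](eq_bigr (fun i => cnorm2 (w' i))); last by move=> i /negbTE ->.
rewrite !addrA; congr (_ + _); have := sqr_sqrtr (ltW c0); move: (Num.sqrt c) => r <-.
by case: (w' i0) => a b; case: h => p q; rewrite /cnorm2 /=; ring.
Qed.

Lemma sqn_cx (v : 'I_n * bool -> R) : sqn v = \sum_i cnorm2 (cx v i).
Proof.
rewrite /sqn (eq_bigr (fun p => v (p.1, p.2) ^+ 2)); last by case.
rewrite -(pair_bigA _ (fun i b => v (i, b) ^+ 2)); apply: eq_bigr => i _.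
by rewrite big_bool /= addrC.
Qed.

(* The second summand replaces the junk value [0 / 0] at the origin by a legal codeword. *)
Definition sph (v : 'I_n * bool -> R) (i : 'I_n) : R[i] :=
  rC (Num.sqrt c) * (rC (Num.sqrt (sqn v))^-1 * cx v i + rC (\1_[set 0] (sqn v) * (i == i0)%:R)).

Lemma vnorm2_sph v : vnorm2 (sph v) = c.
Proof.
rewrite /vnorm2 /sph; under eq_bigr do rewrite cnorm2M cnorm2_rC sqr_sqrtr ?(ltW c0)//.
rewrite -mulr_sumr -[RHS]mulr1; congr (_ * _); rewrite indic_set1.
have [v0|vn] := eqVneq (sqn v) 0.
  rewrite (bigD1 i0)//= v0 sqrtr0 invr0 big1 ?addr0.
    by rewrite mul0r add0r eqxx mul1r cnorm2_rC expr1n.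
  by move=> i /negbTE ->; rewrite mul0r add0r mulr0 cnorm2_rC expr0n.
under eq_bigr do rewrite mul0r addr0 cnorm2M cnorm2_rC.
rewrite -mulr_sumr -sqn_cx exprVn sqr_sqrtr ?sqn_ge0// mulVf//.
Qed.

Lemma cmfun_sph i : cmfun (fun v : vec R ('I_n * bool)%type => sph v i).
Proof.
have ms := @mfun_sqn R ('I_n * bool)%type.
have mi : measurable_fun setT (fun v : vec R ('I_n * bool)%type => \1_[set 0] (sqn v) : R).
  by apply: measurableT_comp ms; exact: measurable_indic.
apply: cmfun_mul; first exact: cmfun_cst.
apply: cmfun_add; last by apply: cmfun_rC; mfun.
by apply: cmfun_mul; [apply: cmfun_rC; mfun|exact: cmfun_cx].
Qed.

Lemma conj_sum (I : Type) (r : seq I) (F : I -> R[i]) :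
  ((\sum_(i <- r) F i)^*)%C = \sum_(i <- r) ((F i)^*)%C.
Proof. exact: rmorph_sum. Qed.

Lemma ip_sph v y : sqn v != 0 ->
  ip (sph v) y = rC (Num.sqrt (sqn v))^-1 * ((\sum_i ((y i)^*)%C * cx v i)^*)%C.
Proof.
move=> vn; rewrite /ip /sph conj_sum !mulr_sumr; apply: eq_bigr => i _.
rewrite indic_set1 (negbTE vn) mul0r addr0.
have cn : Num.sqrt c != 0 by rewrite gt_eqF// sqrtr_gt0.
move: (Num.sqrt c) cn (Num.sqrt (sqn v))^-1 (cx v i) (y i) => a a0 b [p q] [p' q'].
by apply: complex_eq; rewrite /=; field.
Qed.

Context dX (TX : measurableType dX) (PX : probability TX R).
Variable X : 'I_n * bool -> TX -> R.
Hypothesis gX : gfam PX X.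

(** A unitary map of the Gaussian vector behind the codeword aligns [y] with the axis [i0], so only
    the norm of [y] matters. The conjugation in [ip] accounts for the minus sign in the imaginary
    part inside [sphere_ratio]. *)
Lemma sph_ratio d (T : measurableType d) (P : probability T R) (G : 'I_n * bool -> T -> R)
    (s2 : R) (m : R[i]) y : gfam P G -> 0 <= s2 ->
  (\int[P]_t (gratio c s2 m (ip (sph (G^~ t)) y))%:E =
   (out_ratio PX i0 X c s2 m (vnorm2 y))%:E)%E.
Proof.
move=> gG s20.
have y0 : 0 <= vnorm2 y by apply: sumr_ge0 => i _; exact: cnorm2_ge0.
have [<- _] := out_ratio_fin i0 gX m (ltW c0) s20 y0; rewrite /sphere_ratio.
have [ O [gO Or _ Os]] := gpres_reduce y (uniq_rest i0).
pose F (v : vec R ('I_n * bool)%type) := (gratio c s2 m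
  (mkC (Num.sqrt (vnorm2 y) * (v (i0, false) / Num.sqrt (sqn v)))
       (- (Num.sqrt (vnorm2 y) * (v (i0, true) / Num.sqrt (sqn v))))))%:E.
have mc := @mfun_coord R ('I_n * bool)%type; have ms := @mfun_sqn R ('I_n * bool)%type.
have mF : measurable_fun setT F.
  by apply: mfun_EFin; apply: mfun_gratio; [exact: cmfun_cst|apply: cmfun_mkC; mfun].
have F0 v : (0 <= F v)%E by rewrite lee_fin ltW// gratio_gt0// ltW.
rewrite -[RHS](gfam_transfer (gO.2 _ _ _ _ gG) gX mF F0).
have mG := mX_vec gG.
apply: ae_eq_integral => //.
- apply: mfun_EFin; apply: mfun_gratio; first exact: cmfun_cst.
  apply: cmfun_mul; first exact: cmfun_cst.
  apply: cmfun_sum => i; apply: cmfun_mul; last exact: cmfun_cst.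
  by apply: cmfun_conj; exact: (cmfun_comp mG (cmfun_sph i)).
- exact: (measurableT_comp mF (measurableT_comp gO.1 mG)).
(* [sph] differs from the plainly normalised vector only at the origin, a null set. *)
have := gfam_sqn_eq0 gG (i0, false); apply: negligibleS => t /= h.
have [//|vn] := eqVneq (sqn (G^~ t)) 0; exfalso; apply: h => _.
rewrite /F (ip_sph _ vn); congr (gratio _ _ _ _)%:E.
have sO : sqn (O (G^~ t)) = sqn (G^~ t) by rewrite !sqn_cx -!(big_rest i0) Os.
have := Or (G^~ t); rewrite !big_rest => <-; rewrite sO.
rewrite -/(vnorm2 y); move: (Num.sqrt (sqn _))^-1 (Num.sqrt (vnorm2 y)) => a b.
by apply: complex_eq; rewrite /= ?mulr0 ?mul0r ?oppr0 ?addr0 ?subr0; ring.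
Qed.

End codewords.

(** Otherwise f - K would be positive everywhere with zero integral, and the whole space would be
    null. *)
Lemma exists_le_mean d (T : measurableType d) (R : realType) (P : probability T R)
    (f : T -> \bar R) (K : R) : measurable_fun setT f -> (forall t, 0 <= f t)%E ->
  (\int[P]_t f t = K%:E)%E -> exists t, (f t <= K%:E)%E.
Proof.
move=> mf f0 fK; apply: contrapT => /forallNP h.
have lt t : (K%:E < f t)%E by rewrite ltNge; exact/negP/h.
have K0 : 0 <= K by rewrite -lee_fin -fK; exact: integral_ge0.
have mg : measurable_fun setT (fun t => f t - K%:E)%E by apply: emeasurable_funB.
have g0 t : (0 <= f t - K%:E)%E by rewrite sube_ge0// ltW.
have k0 : (0 <= K%:E)%E by rewrite lee_fin.
have : (\int[P]_t (f t - K%:E) + K%:E = K%:E)%E.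
  transitivity (\int[P]_t (f t - K%:E) + \int[P]_t (fun=> K%:E) t)%E.
    by rewrite integral_cst// [X in (_ + _ * X)%E](probability_setT P) mule1.
  rewrite -(ge0_integralD P measurableT (fun t _ => g0 t) mg (fun _ _ => k0) (measurable_cst _)).
  by rewrite -[RHS]fK; apply: eq_integral => t _; rewrite subeK.
have e : (\int[P]_t (f t - K%:E) + K%:E = K%:E -> \int[P]_t (f t - K%:E) = 0)%E.
  case: (integral P setT _) => [r| |] //= [] e.
  by congr EFin; apply: (addIr K); rewrite e add0r.
move=> /e I0.
have I1 : (\int[P]_t `|f t - K%:E| = 0)%E.
  by rewrite -[RHS]I0; apply: eq_integral => t _; rewrite gee0_abs.
have /(ae_eq_integral_abs P measurableT mg) ae := I1.
have : P.-negligible [set: T].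
  apply: negligibleS ae => t _ /= /(_ Logic.I) e0.
  by have := lt t; rewrite -sube_gt0 e0 ltxx.
move=> /(negligibleP P measurableT); rewrite [X in X = _](probability_setT P) => /eqP.
by rewrite onee_eq0.
Qed.

(** * The score in the reduced channel and its law *)

Section channel.
Variables (R : realType) (l n : nat) (i0 : 'I_n) (c s : R) (pm : R[i] -> R[i]).
Hypothesis c0 : 0 < c.
Hypothesis mpm : forall d (T : measurableType d) (f : T -> R[i]), cmfun f -> cmfun (pm \o f).
Context dX (TX : measurableType dX) (PX : probability TX R).
Variable X : 'I_n * bool -> TX -> R.
Hypothesis gX : gfam PX X.

Local Notation slots := ('I_l * option (option 'I_n))%type.
Local Notation I := (slots * bool)%type.
Local Notation orat := (out_ratio PX i0 X c (s ^+ 2)).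
Implicit Types (v : I -> R) (k : 'I_l) (i : 'I_n).

Definition pmean v k := pm (cx v (k, None)).
Definition fading v k := pmean v k - rC s * cx v (k, Some None).
Definition received v (x : 'I_l -> 'I_n -> R[i]) k i := fading v k * x k i + noise v k i.

(** Likelihood ratio of the output given [x] against [f_Y]: both densities contain the noise
    density, which cancels, and [x] enters through the matched filter only. *)
Definition score (m : 'I_l -> R[i]) (x y : 'I_l -> 'I_n -> R[i]) : R :=
  \prod_k (gratio c (s ^+ 2) (m k) (ip c (x k) (y k)) / orat (m k) (vnorm2 (y k))).

Let s20 : 0 <= s ^+ 2. Proof. exact: sqr_ge0. Qed.

Lemma vnorm2_ge0 (y : 'I_n -> R[i]) : 0 <= vnorm2 y.
Proof. by apply: sumr_ge0 => i _; exact: cnorm2_ge0. Qed.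

Lemma orat_gt0 m (y : 'I_n -> R[i]) : 0 < orat m (vnorm2 y).
Proof. by have [] := out_ratio_fin i0 gX m (ltW c0) s20 (vnorm2_ge0 y). Qed.

Lemma score_gt0 m x y : 0 < score m x y.
Proof. by apply: prodr_gt0 => k _; rewrite divr_gt0 ?orat_gt0// gratio_gt0// ltW. Qed.

Lemma mfun_orat d (T : measurableType d) (m : T -> R[i]) (n2 : T -> R) :
  cmfun m -> measurable_fun setT n2 -> measurable_fun setT (fun t => orat (m t) (n2 t)).
Proof.
move=> mm mn.
pose f (z : T * TX) := (gratio c (s ^+ 2) (m z.1)
  (mkC (Num.sqrt (n2 z.1) * (X (i0, false) z.2 / Num.sqrt (sqn (X^~ z.2))))
       (- (Num.sqrt (n2 z.1) * (X (i0, true) z.2 / Num.sqrt (sqn (X^~ z.2)))))))%:E.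
have mX j : measurable_fun setT (fun z : T * TX => X j z.2) := measurableT_comp (gX.1 j) measurable_snd.
have mn1 : measurable_fun setT (fun z : T * TX => n2 z.1) := measurableT_comp mn measurable_fst.
have ms : measurable_fun setT (fun z : T * TX => sqn (X^~ z.2)).
  by apply: (measurableT_comp (@mfun_sqn R _)); exact: (measurableT_comp (mX_vec gX) measurable_snd).
have mf : measurable_fun setT f.
  apply: mfun_EFin; apply: mfun_gratio; first exact: (cmfun_comp measurable_fst mm).
  by apply: cmfun_mkC; mfun.
have f0 z : (0 <= f z)%E by rewrite lee_fin ltW// gratio_gt0// ltW.
apply: (@mfun_fine _ _ _ (fun t => \int[PX]_u f (t, u))%E).
exact: (measurable_fun_fubini_tonelli_F (m2 := PX) f mf f0).
Qed.

Lemma cmfun_ip d (T : measurableType d) (x y : 'I_n -> T -> R[i]) :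
  (forall i, cmfun (x i)) -> (forall i, cmfun (y i)) -> cmfun (fun t => ip c (x^~ t) (y^~ t)).
Proof.
move=> mx my; apply: cmfun_mul; first exact: cmfun_cst.
by apply: cmfun_sum => i; apply: cmfun_mul => //; exact: cmfun_conj.
Qed.

Lemma mfun_score d (T : measurableType d) (m : 'I_l -> T -> R[i]) (x y : 'I_l -> 'I_n -> T -> R[i]) :
  (forall k, cmfun (m k)) -> (forall k i, cmfun (x k i)) -> (forall k i, cmfun (y k i)) ->
  measurable_fun setT (fun t => score (m^~ t) (fun k i => x k i t) (fun k i => y k i t)).
Proof.
move=> mm mx my; apply: mfun_prodT => k; apply: mfun_mul.
  by apply: mfun_gratio => //; exact: cmfun_ip.
by apply: mfun_inv; apply: mfun_orat => //; exact: mfun_vnorm2.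
Qed.

Lemma cmfun_pmean k : cmfun (fun v : vec R I => pmean v k).
Proof. by apply: mpm; exact: cmfun_cx. Qed.

Lemma cmfun_noise k i : cmfun (fun v : vec R I => noise v k i).
Proof. exact: cmfun_cx. Qed.

Lemma cmfun_fading k : cmfun (fun v : vec R I => fading v k).
Proof.
apply: cmfun_add; first exact: cmfun_pmean.
by apply: cmfun_opp; apply: cmfun_mul; [exact: cmfun_cst|exact: cmfun_cx].
Qed.

Lemma cmfun_received x k i : cmfun (fun v : vec R I => received v x k i).
Proof.
apply: cmfun_add; last exact: cmfun_noise.
by apply: cmfun_mul; [exact: cmfun_fading|exact: cmfun_cst].
Qed.

Section law.
Context d (T : measurableType d) (P : probability T R) (Z : I -> T -> R).
Hypothesis gZ : gfam P Z.

Section score_law.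
Variable psi : R -> \bar R.
Hypotheses (mpsi : measurable_fun setT psi) (psi0 : forall r, (0 <= psi r)%E).

Definition slot k i : slots := (k, Some (Some i)).

(* [y k i0] carries the whole signal: the noise has been rotated towards the codeword. *)
Definition aligned_score (m : 'I_l -> R[i]) (y : 'I_l -> 'I_n -> R[i]) : R :=
  \prod_k (gratio c (s ^+ 2) (m k) (y k i0) / orat (m k) (vnorm2 (y k))).

Lemma mfun_aligned d' (T' : measurableType d') (m : 'I_l -> T' -> R[i])
    (y : 'I_l -> 'I_n -> T' -> R[i]) :
  (forall k, cmfun (m k)) -> (forall k i, cmfun (y k i)) ->
  measurable_fun setT (fun t => aligned_score (m^~ t) (fun k i => y k i t)).
Proof.
move=> mm my; apply: mfun_prodT => k; apply: mfun_mul; first exact: mfun_gratio.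
by apply: mfun_inv; apply: mfun_orat => //; exact: mfun_vnorm2.
Qed.

Definition rotated v k i : R[i] :=
  if i == i0 then rC (Num.sqrt c) * fading v k + noise v k i else noise v k i.

Lemma cmfun_rotated k i : cmfun (fun v : vec R I => rotated v k i).
Proof.
rewrite /rotated; case: eqP => _; last exact: cmfun_noise.
apply: cmfun_add; last exact: cmfun_noise.
by apply: cmfun_mul; [exact: cmfun_cst|exact: cmfun_fading].
Qed.

(** In each block the noise is rotated so that the codeword points along [i0], while estimate and
    residual slots are untouched. The result no longer mentions [x], which is why the law is the
    same for all codewords. *)
Lemma score_align (x : 'I_l -> 'I_n -> R[i]) : (forall k, vnorm2 (x k) = c) ->
  (\int[P]_t psi (score (pmean (Z^~ t)) x (received (Z^~ t) x)) =
   \int[P]_t psi (aligned_score (pmean (Z^~ t)) (rotated (Z^~ t))))%E.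
Proof.
move=> xc.
pose F (v : vec R I) := psi (aligned_score (pmean v) (rotated v)).
have mF : measurable_fun setT F.
  apply: (measurableT_comp mpsi); apply: mfun_aligned => [k|k i]; first exact: cmfun_pmean.
  exact: cmfun_rotated.
pose u k (j : slots) : R[i] := if j.2 is Some (Some i) then x k i else 0.
have slot_inj k : injective (slot k) by move=> a b [].
have un k : uniq (map (slot k) (i0 :: rest i0)) by rewrite map_inj_uniq ?uniq_rest.
have disj a b (j : slots) : j \in map (slot a) (i0 :: rest i0) -> j \in map (slot b) (i0 :: rest i0) -> a = b.
  by move=> /mapP[i _ ->] /mapP[i' _ [->]].
have [ O [gO Or Oc Os]] := @gpres_reduce_blocks R _ 'I_l u (slot^~ i0)
  (fun k => map (slot k) (rest i0)) un disj.
have On v k b (o : option (option 'I_n)) : (forall i, o != Some (Some i)) -> O v ((k, o), b) = v ((k, o), b).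
  move=> h; apply: Oc => b'; rewrite -(map_cons (slot b') i0); apply/negP => /mapP[j _ [_ e]].
  by have := h j; rewrite e eqxx.
have Op v : pmean (O v) = pmean v.
  by apply/funext => k; rewrite /pmean (_ : cx (O v) _ = cx v (k, None))//; apply: cx_eq => b; exact: On.
have Of v : fading (O v) = fading v.
  apply/funext => k; rewrite /fading Op (_ : cx (O v) _ = cx v (k, Some None))//.
  by apply: cx_eq => b; exact: On.
have Oip v k : ip c (x k) (noise v k) = noise (O v) k i0.
  rewrite /ip; have := Or k v; rewrite -(map_cons (slot k) i0) !big_map !big_rest /=.
  rewrite [X in Num.sqrt X](xc k) => <-.
  by rewrite mulrA -rCM mulVf ?mul1r// gt_eqF// sqrtr_gt0.
have Ow v k : vnorm2 (noise (O v) k) = vnorm2 (noise v k).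
  by have := Os k v; rewrite -(map_cons (slot k) i0) !big_map !big_rest.
have FO v : F (O v) = psi (score (pmean v) x (received v x)).
  rewrite /F Op; apply: (congr1 psi); rewrite /aligned_score /score; apply: eq_bigr => k _.
  have -> : rotated (O v) k i0 = rC (Num.sqrt c) * fading v k + noise (O v) k i0 by rewrite /rotated eqxx Of.
  have -> : ip c (x k) (received v x k) = rC (Num.sqrt c) * fading v k + noise (O v) k i0.
    by rewrite -Oip; exact: (ip_out c0 _ _ (xc k)).
  apply: (congr1 (fun z => _ / orat _ z)).
  have -> : rotated (O v) k =
      fun i => if i == i0 then rC (Num.sqrt c) * fading v k + noise (O v) k i else noise (O v) k i.
    by apply/funext => i; rewrite /rotated Of.
  by rewrite -(vnorm2_out c0 (fading v k) (xc k) (Oip v k) (Ow v k)).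
rewrite -[RHS](gfam_transfer (gO.2 _ _ _ _ gZ) gZ mF (fun v => psi0 _)).
by apply: eq_integral => t _; exact: esym (FO (Z^~ t)).
Qed.

Definition aligned_out (m : 'I_l -> R[i]) (w : 'I_l -> 'I_n -> R[i]) k i : R[i] :=
  if i == i0 then m k * rC (Num.sqrt c) + rC (Num.sqrt (s ^+ 2 * c + 1)) * w k i else w k i.

Lemma cmfun_aligned_out d' (T' : measurableType d') (m : 'I_l -> T' -> R[i])
    (w : 'I_l -> 'I_n -> T' -> R[i]) k i :
  (forall k, cmfun (m k)) -> (forall k i, cmfun (w k i)) ->
  cmfun (fun t => aligned_out (m^~ t) (fun k i => w k i t) k i).
Proof.
move=> mm mw; rewrite /aligned_out; case: eqP => _ //.
by apply: cmfun_add; apply: cmfun_mul => //; exact: cmfun_cst.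
Qed.

(** On the axis [i0] the noise minus sqrt c s times the residual has variance 1 + c s^2; a unitary
    map turns this combination into a single noise slot, scaled as in [Wtilde]. *)
Lemma score_merge :
  (\int[P]_t psi (aligned_score (pmean (Z^~ t)) (rotated (Z^~ t))) =
   \int[P]_t psi (aligned_score (pmean (Z^~ t)) (aligned_out (pmean (Z^~ t)) (noise (Z^~ t)))))%E.
Proof.
pose F (v : vec R I) := psi (aligned_score (pmean v) (aligned_out (pmean v) (noise v))).
have mF : measurable_fun setT F.
  apply: (measurableT_comp mpsi); apply: mfun_aligned => [k|k i]; first exact: cmfun_pmean.
  by apply: (@cmfun_aligned_out _ (vec R I) (fun k v => pmean v k) (fun k i v => noise v k i));
    [exact: cmfun_pmean|exact: cmfun_noise].
pose u (k : 'I_l) (j : slots) : R[i] := if j.2 is Some (Some i) then 1 else rC (- (Num.sqrt c * s)).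
have un k : uniq [:: slot k i0; (k, Some None)] by rewrite /= inE xpair_eqE andbF.
have disj a b j : j \in [:: slot a i0; (a, Some None)] -> j \in [:: slot b i0; (b, Some None)] -> a = b.
  by rewrite !inE => /orP[]/eqP -> /orP[]/eqP [] ->.
have [ O [gO Or Oc Os]] := @gpres_reduce_blocks R _ 'I_l u (slot^~ i0) (fun k => [:: (k, Some None)]) un disj.
have Op v : pmean (O v) = pmean v.
  apply/funext => k; rewrite /pmean (_ : cx (O v) _ = cx v (k, None))//; apply: cx_eq => b; apply: Oc => b'.
  by rewrite !inE !xpair_eqE !andbF.
have Ow v k i : i != i0 -> noise (O v) k i = noise v k i.
  move=> ii; apply: cx_eq => b; apply: Oc => b'; rewrite !inE !xpair_eqE andbF orbF.
  by apply/negP => /andP[_ /eqP[e]]; rewrite e eqxx in ii.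
have O0 v k : rC (Num.sqrt (s ^+ 2 * c + 1)) * noise (O v) k i0 =
    noise v k i0 - rC (Num.sqrt c * s) * cx v (k, Some None).
  have := Or k v; rewrite !big_cons !big_nil !addr0 /u /= => H.
  have e : cnorm2 (1 : R[i]) + cnorm2 (rC (- (Num.sqrt c * s))) = s ^+ 2 * c + 1.
    rewrite cnorm2_rC sqrrN exprMn sqr_sqrtr ?(ltW c0)// addrC mulrC; congr (_ + _).
    by rewrite /cnorm2 /= expr1n expr0n addr0.
  have e1 : Complex 1 (- 0) = 1 :> R[i] by apply: complex_eq; rewrite /= ?oppr0.
  have e2 : Complex (- (Num.sqrt c * s)) (- 0) = - rC (Num.sqrt c * s) :> R[i].
    by apply: complex_eq; rewrite /= ?oppr0.
  by rewrite e e1 e2 mul1r mulNr in H.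
have FO v : F (O v) = psi (aligned_score (pmean v) (rotated v)).
  rewrite /F Op; apply: (congr1 (fun y => psi (aligned_score _ y))).
  apply/funext => k; apply/funext => i; rewrite /aligned_out /rotated.
  case: eqP => [->|/eqP ii]; last by rewrite Ow.
  by rewrite O0 /fading rCM; ring.
rewrite -[RHS](gfam_transfer (gO.2 _ _ _ _ gZ) gZ mF (fun v => psi0 _)).
by apply: eq_integral => t _; exact: esym (FO (Z^~ t)).
Qed.

Lemma score_law (x : 'I_l -> 'I_n -> R[i]) d' (T' : measurableType d') (P' : probability T' R)
    (Y : ('I_l * option 'I_n) * bool -> T' -> R) : gfam P' Y -> (forall k, vnorm2 (x k) = c) ->
  (\int[P]_t psi (score (pmean (Z^~ t)) x (received (Z^~ t) x)) =
   \int[P']_t psi (aligned_score (fun k => pm (cx (Y^~ t) (k, None)))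
     (aligned_out (fun k => pm (cx (Y^~ t) (k, None))) (fun k i => cx (Y^~ t) (k, Some i)))))%E.
Proof.
move=> gY xc; rewrite score_align// score_merge.
(* The residual slots have dropped out, so the estimate and noise slots alone match the index type
   of the variables of the bound. *)
pose e (j : ('I_l * option 'I_n) * bool) : I := ((j.1.1, if j.1.2 is Some i then Some (Some i) else None), j.2).
have einj : injective e.
  by move=> [[k [i|]] b] [[k' [i'|]] b'] //= []; [move=> -> -> ->|move=> -> ->].
pose F (w : vec R (('I_l * option 'I_n) * bool)%type) :=
  psi (aligned_score (fun k => pm (cx w (k, None)))
     (aligned_out (fun k => pm (cx w (k, None))) (fun k i => cx w (k, Some i)))).
have mF : measurable_fun setT F.
  apply: (measurableT_comp mpsi); apply: mfun_aligned => [k|k i].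
    by apply: mpm; exact: cmfun_cx.
  apply: (@cmfun_aligned_out _ (vec R (('I_l * option 'I_n) * bool)%type) (fun k w => pm (cx w (k, None))) (fun k i w => cx w (k, Some i))).
    by move=> k'; apply: mpm; exact: cmfun_cx.
  by move=> *; exact: cmfun_cx.
have F0 w : (0 <= F w)%E := psi0 _.
have H := gfam_transfer (gfam_reindex einj gZ) gY mF F0.
by rewrite -[RHS]H; apply: eq_integral => t _.
Qed.
End score_law.

(** Measurability is tested along every measurable parametrisation, which avoids choosing a
    sigma-algebra on arrays of complex numbers. *)
Definition mfunctional (Phi : ('I_l -> R[i]) -> ('I_l -> 'I_n -> R[i]) -> R) : Prop :=
  forall d' (T' : measurableType d') (m : 'I_l -> T' -> R[i]) (y : 'I_l -> 'I_n -> T' -> R[i]),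
  (forall k, cmfun (m k)) -> (forall k i, cmfun (y k i)) ->
  measurable_fun setT (fun t => Phi (m^~ t) (fun k i => y k i t)).

(** * From the channel output to pure noise *)

Section change_of_measure.
Variable Phi : ('I_l -> R[i]) -> ('I_l -> 'I_n -> R[i]) -> R.
Hypotheses (mPhi : mfunctional Phi) (Phi0 : forall m y, 0 <= Phi m y).
Variable x : 'I_l -> 'I_n -> R[i].
Hypothesis xc : forall k, vnorm2 (x k) = c.

(** The faded signal as a real shift of the data noise coordinates; [expo] collects the
    Cameron-Martin exponents of this shift over a block, as [sum_shift] confirms. *)
Let sh v (j : I) : R :=
  if j.1.2 is Some (Some i) then reim (fading v j.1.1 * x j.1.1 i) j.2 else 0.
Let expo v k : R := 2 * Num.sqrt c * complex.Re (((fading v k)^*)%C * ip c (x k) (noise v k)) -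
  c * cnorm2 (fading v k).

Lemma mfun_sh j : measurable_fun setT (fun v : vec R I => sh v j).
Proof.
rewrite /sh; case: j => [[k [[i|]|]] b] /=; try exact: measurable_cst.
have [h1 h2] : cmfun (fun v : vec R I => fading v k * x k i).
  by apply: cmfun_mul; [exact: cmfun_fading|exact: cmfun_cst].
by case: b.
Qed.

Lemma mfun_expo k : measurable_fun setT (fun v : vec R I => expo v k).
Proof.
have mi : cmfun (fun v : vec R I => ip c (x k) (noise v k)).
  by apply: (cmfun_ip (x := fun i _ => x k i)) => i; [exact: cmfun_cst|exact: cmfun_noise].
have [h1 _] := cmfun_mul (cmfun_conj (cmfun_fading k)) mi.
have h2 := mfun_cnorm2 (cmfun_fading k).
by rewrite /expo; mfun.
Qed.

Lemma sum_shift v : \sum_j (2 * sh v j * v j - sh v j ^+ 2) = \sum_k expo v k.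
Proof.
pose f (p : slots) b := 2 * sh v (p, b) * v (p, b) - sh v (p, b) ^+ 2.
have z k o : (forall i, o != Some (Some i)) -> \sum_b f (k, o) b = 0.
  move=> h; apply: big1 => b _; rewrite /f /sh /=; case: o h => [[i|]|] h.
  - by have := h i; rewrite eqxx.
  - by rewrite mulr0 mul0r expr0n subr0.
  - by rewrite mulr0 mul0r expr0n subr0.
rewrite (eq_bigr (fun j => f j.1 j.2)); last by case.
rewrite -(pair_bigA _ f) /=.
rewrite (eq_bigr (fun p => (fun k o => \sum_b f (k, o) b) p.1 p.2)); last by case.
rewrite -(pair_bigA _ (fun k o => \sum_b f (k, o) b)) /=.
apply: eq_bigr => k _; rewrite big_option z// add0r big_option z// add0r.
rewrite /expo -mulrA; have -> : Num.sqrt c * complex.Re (((fading v k)^*)%C * ip c (x k) (noise v k)) =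
    complex.Re (((fading v k)^*)%C * \sum_i ((x k i)^*)%C * noise v k i).
  rewrite -(ipE c0); move: (ip _ _ _) (fading v k) (Num.sqrt c) => [p q] [p' q'] r.
  by rewrite /=; ring.
rewrite mulr_sumr Re_sum mulr_sumr -{1}(xc k) /vnorm2 mulr_suml -sumrB.
apply: eq_bigr => i _; rewrite big_bool /f /sh /=.
rewrite /noise /cx; move: (v _) (v _) (fading v k) (x k i) => a b [p q] [p' q'].
by rewrite /cnorm2 /=; ring.
Qed.

(** True on the slots to be frozen, estimate and residual, and false on the data noise: the shift is
    then deterministic in the inner integral. *)
Let noisy (j : I) : bool := if j.1.2 is Some (Some _) then false else true.

Lemma shift_change :
  (\int[P]_t (Phi (pmean (Z^~ t)) (received (Z^~ t) x))%:E =
   \int[P]_t (Phi (pmean (Z^~ t)) (noise (Z^~ t)) * expR (\sum_k expo (Z^~ t) k))%:E)%E.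
Proof.
pose F1 (v : vec R I) := (Phi (pmean v) (received v x))%:E.
pose F2 (v : vec R I) := (Phi (pmean v) (noise v) * expR (\sum_j (2 * sh v j * v j - sh v j ^+ 2)))%:E.
have mPn : measurable_fun setT (fun v : vec R I => Phi (pmean v) (noise v)).
  apply: (@mPhi _ (vec R I) (fun k v => pmean v k) (fun k i v => noise v k i)).
    exact: cmfun_pmean.
  exact: cmfun_noise.
have mF1 : measurable_fun setT F1.
  apply: mfun_EFin.
  apply: (@mPhi _ (vec R I) (fun k v => pmean v k) (fun k i v => received v x k i)).
    exact: cmfun_pmean.
  exact: cmfun_received.
have msh := mfun_sh; have mc := @mfun_coord R I.
have mF2 : measurable_fun setT F2 by rewrite /F2; mfun.
have F10 v : (0 <= F1 v)%E by rewrite lee_fin.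
have F20 v : (0 <= F2 v)%E by rewrite lee_fin mulr_ge0 ?expR_ge0.
have mixp v w : pmean (mix noisy v w) = pmean v by [].
have mixf v w : fading (mix noisy v w) = fading v by [].
have mixn v w : noise (mix noisy v w) = noise w by [].
have mixs v w : sh (mix noisy v w) = sh v by [].
transitivity (\int[P]_t F2 (Z^~ t))%E; last first.
  by apply: eq_integral => t _; rewrite /F2 sum_shift.
transitivity (\int[P]_t F1 (Z^~ t))%E; first by [].
rewrite (gfam_split noisy gZ gZ mF1 F10) (gfam_split noisy gZ gZ mF2 F20).
apply: eq_integral => t _; move: (Z^~ t) => v.
pose G (w : vec R I) := (Phi (pmean v) (noise w))%:E.
have mG : measurable_fun setT G.
  apply: mfun_EFin.
  apply: (@mPhi _ (vec R I) (fun k _ => pmean v k) (fun k i w => noise w k i)).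
    by move=> k; exact: cmfun_cst.
  exact: cmfun_noise.
have G0 w : (0 <= G w)%E by rewrite lee_fin.
have H := @gfam_change _ _ _ _ _ _ gZ predT (fun j z => z + sh v j)
  (fun j z => expR (2 * sh v j * z - sh v j ^+ 2)) G.
transitivity (\int[P]_u G (fun j => if predT j then (Z j u + sh v j)%R else Z j u))%E.
  apply: eq_integral => u _; rewrite /F1 /G mixp /received mixf mixn.
  apply: (congr1 (fun y => (Phi (pmean v) y)%:E)).
  apply/funext => k; apply/funext => i; rewrite /noise /cx /sh /=.
  by apply: complex_eq; case: (fading v k) => p q; case: (x k i) => p' q' /=; rewrite addrC.
apply: etrans (H _ _ _ _ mG G0) _.
- by move=> j; mfun.
- by move=> j; mfun.
- by move=> j z; exact: expR_ge0.
- by move=> j f mf f0; exact: g1_shift.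
apply: eq_integral => u _; rewrite /F2 /G mixp mixn mixs -EFinM -expR_sum.
apply: (congr1 (fun y => (Phi (pmean v) (noise (Z^~ u)) * expR y)%:E)); apply: eq_bigr => j _.
rewrite /mix; case nj: (noisy j) => //; rewrite (_ : sh v j = 0) ?mulr0 ?mul0r//.
by move: nj; rewrite /noisy /sh; case: j.1.2 => [[]|].
Qed.

(** Freezes everything but the residual, which leaves the fading as the only randomness of the inner
    integral. *)
Let unfaded (j : I) : bool := if j.1.2 is Some None then false else true.

(** After the shift the exponent still contains the unknown fading. Its residual is independent of
    estimate and noise, and averaging it out block by block turns each factor into [gratio] by
    [gratioE]. *)
Lemma change_of_measure :
  (\int[P]_t (Phi (pmean (Z^~ t)) (received (Z^~ t) x))%:E =
   \int[P]_t (Phi (pmean (Z^~ t)) (noise (Z^~ t)) *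
     \prod_k gratio c (s ^+ 2) (pmean (Z^~ t) k) (ip c (x k) (noise (Z^~ t) k)))%:E)%E.
Proof.
rewrite shift_change.
pose F (v : vec R I) := (Phi (pmean v) (noise v) * expR (\sum_k expo v k))%:E.
have mPn : measurable_fun setT (fun v : vec R I => Phi (pmean v) (noise v)).
  apply: (@mPhi _ (vec R I) (fun k v => pmean v k) (fun k i v => noise v k i)).
    exact: cmfun_pmean.
  exact: cmfun_noise.
have me := mfun_expo.
have mF : measurable_fun setT F by rewrite /F; mfun.
have F0 v : (0 <= F v)%E by rewrite lee_fin mulr_ge0 ?expR_ge0.
transitivity (\int[P]_t F (Z^~ t))%E; first by [].
rewrite (gfam_split unfaded gZ gZ mF F0); apply: eq_integral => t _; move: (Z^~ t) => v.
pose psi k (w : vec R I) := (expR (2 * Num.sqrt c *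
    complex.Re (((pmean v k - rC s * cx w (k, Some None))^*)%C * ip c (x k) (noise v k)) -
  c * cnorm2 (pmean v k - rC s * cx w (k, Some None))))%:E.
have mcf k : cmfun (fun w : vec R I => pmean v k - rC s * cx w (k, Some None)).
  apply: cmfun_add; first exact: cmfun_cst.
  by apply: cmfun_opp; apply: cmfun_mul; [exact: cmfun_cst|exact: cmfun_cx].
have mpsi k : measurable_fun setT (psi k).
  have [h1 _] := cmfun_mul (cmfun_conj (mcf k)) (cmfun_cst _ (ip c (x k) (noise v k))).
  by have h2 := mfun_cnorm2 (mcf k); rewrite /psi; mfun.
have psi0 k w : (0 <= psi k w)%E by rewrite lee_fin expR_ge0.
have mpZ : measurable_fun setT (fun u => \prod_k psi k (Z^~ u))%E.
  by apply: mfun_eprod => k; exact: (measurableT_comp (mpsi k) (mX_vec gZ)).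
transitivity ((Phi (pmean v) (noise v))%:E * \int[P]_u \prod_k psi k (Z^~ u))%E.
  rewrite -ge0_integralZl_EFin; [|exact: measurableT| |exact: mpZ|exact: Phi0]; last first.
    by move=> u _; apply: prode_ge0 => k _; exact: psi0.
  apply: eq_integral => u _; rewrite /F /psi prodEFin -expR_sum -EFinM.
  apply: (congr1 (fun y => (Phi (pmean v) (noise v) * expR y)%:E)).
  exact: (eq_bigr _ (fun _ _ => erefl)).
rewrite EFinM; apply: (congr1 (fun z => _ * z)%E).
have H := @gfam_indep R I _ _ P Z gZ 'I_l (index_enum 'I_l) (fun k j => j.1 == (k, Some None)) psi
  (index_enum_uniq _) _ mpsi psi0.
apply: etrans (H _ _) _.
- by move=> j k i /eqP -> /eqP[].
- move=> k w w' ww'; rewrite /psi (_ : cx w (k, Some None) = cx w' (k, Some None))//.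
  by apply: cx_eq => b; apply: ww'; rewrite /= eqxx.
rewrite -prodEFin; apply: eq_bigr => k _.
pose Zk b := Z ((k, Some None), b).
have ik : injective (fun b : bool => ((k, Some None), b) : I) by move=> a b [].
have gZk : gfam P Zk := gfam_reindex ik gZ.
(* The residual enters [fading] with a minus sign, so [gratioE] is used with - s, which has the same
   square. *)
rewrite -(sqrrN s) -(gratioE (- s) (pmean v k) (ip c (x k) (noise v k)) gZk (ltW c0)).
apply: eq_integral => u _; rewrite /psi; apply: (congr1 (fun y => (expR y)%:E)).
rewrite !big_bool /= /Zk /cx.
move: (Num.sqrt c) (ip _ _ _) (pmean v k) (Z _ u) (Z _ u) => r [p q] [p' q'] a b.
by rewrite /cnorm2 /=; ring.
Qed.

End change_of_measure.

(** * Random codewords and their confusion probabilities *)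

Definition cword v k : 'I_n -> R[i] := sph i0 c (fun p => v ((k, Some (Some p.1)), p.2)).

Lemma vnorm2_cword v k : vnorm2 (cword v k) = c.
Proof. exact: vnorm2_sph. Qed.

Lemma cmfun_cword k i : cmfun (fun v : vec R I => cword v k i).
Proof.
apply: (cmfun_comp (f := fun w : vec R ('I_n * bool)%type => sph i0 c w i)
  (h := fun v : vec R I => (fun p => v ((k, Some (Some p.1)), p.2)) : vec R ('I_n * bool)%type)).
  by apply: mfun_vec => p; exact: mfun_coord.
exact: cmfun_sph.
Qed.

Lemma random_codeword (m : 'I_l -> R[i]) (y : 'I_l -> 'I_n -> R[i]) :
  (\int[P]_t (\prod_k gratio c (s ^+ 2) (m k) (ip c (cword (Z^~ t) k) (y k)))%:E =
   (\prod_k orat (m k) (vnorm2 (y k)))%:E)%E.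
Proof.
pose psi k (v : vec R I) := (gratio c (s ^+ 2) (m k) (ip c (cword v k) (y k)))%:E.
have mpsi k : measurable_fun setT (psi k).
  apply: mfun_EFin; apply: mfun_gratio; first exact: cmfun_cst.
  apply: (@cmfun_ip _ (vec R I) (fun i v => cword v k i) (fun i _ => y k i)) => i.
    exact: cmfun_cword.
  exact: cmfun_cst.
have psi0 k v : (0 <= psi k v)%E by rewrite lee_fin ltW// gratio_gt0// ltW.
have H := @gfam_indep R I _ _ P Z gZ 'I_l (index_enum 'I_l) (fun k j => j.1.1 == k) psi
  (index_enum_uniq _) _ mpsi psi0.
transitivity (\int[P]_t \prod_k psi k (Z^~ t))%E.
  by apply: eq_integral => t _; rewrite /psi prodEFin.
apply: etrans (H _ _) _.
- by move=> j k i /eqP -> /eqP.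
- move=> k v w vw; rewrite /psi (_ : cword v k = cword w k)//; rewrite /cword.
  by congr (sph _ _ _); apply/funext => p; apply: vw; rewrite /= eqxx.
rewrite -prodEFin; apply: eq_bigr => k _.
pose e (p : 'I_n * bool) : I := ((k, Some (Some p.1)), p.2).
have einj : injective e by move=> [i b] [i' b'] [-> ->].
apply: etrans (sph_ratio i0 c0 gX (m k) (y k) (gfam_reindex einj gZ) s20).
by apply: eq_integral => t _.
Qed.

Section random_coding.
Variable Phi : ('I_l -> R[i]) -> ('I_l -> 'I_n -> R[i]) -> R.
Hypotheses (mPhi : mfunctional Phi) (Phi0 : forall m y, 0 <= Phi m y).

(** The variables u and t are independent copies, one for the codeword and one for the channel.
    After the change of measure the output no longer depends on the codeword, so the average over u
    can be taken first, and it turns the [gratio] factors into output density ratios. *)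
Lemma random_coding :
  (\int[P]_u \int[P]_t (Phi (pmean (Z^~ t)) (received (Z^~ t) (cword (Z^~ u))))%:E =
   \int[P]_t (Phi (pmean (Z^~ t)) (noise (Z^~ t)) *
     \prod_k orat (pmean (Z^~ t) k) (vnorm2 (noise (Z^~ t) k)))%:E)%E.
Proof.
pose f (z : T * T) := (Phi (pmean (Z^~ z.2)) (noise (Z^~ z.2)) *
  \prod_k gratio c (s ^+ 2) (pmean (Z^~ z.2) k) (ip c (cword (Z^~ z.1) k) (noise (Z^~ z.2) k)))%:E.
have mZ := mX_vec gZ.
have mZ1 : measurable_fun setT ((fun z : T * T => Z^~ z.1) : _ -> vec R I) :=
  measurableT_comp mZ measurable_fst.
have mZ2 : measurable_fun setT ((fun z : T * T => Z^~ z.2) : _ -> vec R I) :=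
  measurableT_comp mZ measurable_snd.
have mp k : cmfun (fun z : T * T => pmean (Z^~ z.2) k) := cmfun_comp mZ2 (cmfun_pmean k).
have mn k i : cmfun (fun z : T * T => noise (Z^~ z.2) k i) := cmfun_comp mZ2 (cmfun_noise k i).
have mw k i : cmfun (fun z : T * T => cword (Z^~ z.1) k i) := cmfun_comp mZ1 (cmfun_cword k i).
have mPn : measurable_fun setT (fun z : T * T => Phi (pmean (Z^~ z.2)) (noise (Z^~ z.2))) := mPhi mp mn.
have mg : measurable_fun setT (fun z : T * T => \prod_k gratio c (s ^+ 2) (pmean (Z^~ z.2) k)
    (ip c (cword (Z^~ z.1) k) (noise (Z^~ z.2) k))).
  apply: mfun_prodT => k; apply: mfun_gratio; first exact: mp.
  exact: (cmfun_ip (mw k) (mn k)).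
have mf : measurable_fun setT f by rewrite /f; mfun.
have g0 v w : 0 <= \prod_k gratio c (s ^+ 2) (pmean w k) (ip c (cword v k) (noise w k)).
  by apply: prodr_ge0 => k _; rewrite ltW// gratio_gt0// ltW.
have f0 z : (0 <= f z)%E by rewrite lee_fin mulr_ge0.
transitivity (\int[P]_u \int[P]_t f (u, t))%E.
  apply: eq_integral => u _; apply: (change_of_measure mPhi Phi0) => k.
  exact: vnorm2_cword.
rewrite (fubini_tonelli (m1 := P) (m2 := P) f mf f0).
apply: eq_integral => t _; rewrite [RHS]EFinM -(random_codeword (pmean (Z^~ t)) (noise (Z^~ t))).
rewrite -ge0_integralZl_EFin; [|exact: measurableT|by move=> u _; rewrite lee_fin| |exact: Phi0].
  by apply: eq_integral => u _; rewrite -EFinM.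
apply: mfun_EFin; apply: mfun_prodT => k; apply: mfun_gratio; first exact: cmfun_cst.
apply: (cmfun_ip (x := fun i u => cword (Z^~ u) k i) (y := fun i _ => noise (Z^~ t) k i)) => i.
  exact: (cmfun_comp mZ (cmfun_cword k i)).
exact: cmfun_cst.
Qed.

Lemma measurable_random_coding :
  measurable_fun setT (fun u =>
    \int[P]_t (Phi (pmean (Z^~ t)) (received (Z^~ t) (cword (Z^~ u))))%:E)%E.
Proof.
have mZ := mX_vec gZ.
have mZ1 : measurable_fun setT ((fun z : T * T => Z^~ z.1) : _ -> vec R I) :=
  measurableT_comp mZ measurable_fst.
have mZ2 : measurable_fun setT ((fun z : T * T => Z^~ z.2) : _ -> vec R I) :=
  measurableT_comp mZ measurable_snd.
pose f (z : T * T) := (Phi (pmean (Z^~ z.2)) (received (Z^~ z.2) (cword (Z^~ z.1))))%:E.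
have mf : measurable_fun setT f.
  apply: mfun_EFin.
  apply: (@mPhi _ _ (fun k (z : T * T) => pmean (Z^~ z.2) k)
    (fun k i (z : T * T) => received (Z^~ z.2) (cword (Z^~ z.1)) k i)).
    by move=> k; exact: (cmfun_comp mZ2 (cmfun_pmean k)).
  move=> k i; apply: cmfun_add; last exact: (cmfun_comp mZ2 (cmfun_noise k i)).
  apply: cmfun_mul; first exact: (cmfun_comp mZ2 (cmfun_fading k)).
  exact: (cmfun_comp mZ1 (cmfun_cword k i)).
have f0 z : (0 <= f z)%E by rewrite lee_fin.
exact: (measurable_fun_fubini_tonelli_F (m2 := P) f mf f0).
Qed.

End random_coding.

Lemma mfun_gt d' (T' : measurableType d') (g : R) (f : T' -> R) : measurable_fun setT f ->
  measurable_fun setT (fun t => (g < f t)%R%:R : R).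
Proof.
move=> mf; rewrite (_ : (fun _ => _) = \1_[set` `]g, +oo[] \o f).
  by apply: measurableT_comp mf; apply: measurable_indic; exact: measurable_itv.
by apply/funext => t /=; rewrite indicE mem_setE in_itv/= andbT.
Qed.

Definition confusion (g : R) (x x' : 'I_l -> 'I_n -> R[i]) : \bar R :=
  (\int[P]_t (g < score (pmean (Z^~ t)) x (received (Z^~ t) x'))%R%:R%:E)%E.

Definition above (g : R) (x : 'I_l -> 'I_n -> R[i]) m y : R := (g < score m x y)%R%:R.

Lemma mfunctional_above g x : mfunctional (above g x).
Proof.
move=> d' T' m y mm my; apply: mfun_gt.
by apply: (mfun_score (x := fun k i _ => x k i)) => // k i; exact: cmfun_cst.
Qed.

Lemma confusion_ge0 g x x' : (0 <= confusion g x x')%E.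
Proof. by apply: integral_ge0 => t _; rewrite lee_fin. Qed.

Lemma measurable_confusion g x : measurable_fun setT (fun u => confusion g x (cword (Z^~ u))).
Proof. exact: (measurable_random_coding (mfunctional_above g x) (fun _ _ => ler0n _ _)). Qed.

Lemma mean_confusion g (x : 'I_l -> 'I_n -> R[i]) d' (T' : measurableType d')
    (P' : probability T' R) (Y : ('I_l * option 'I_n) * bool -> T' -> R) :
  0 <= g -> gfam P' Y -> (forall k, vnorm2 (x k) = c) ->
  (\int[P]_u confusion g x (cword (Z^~ u)) =
   \int[P']_t (fun r => ((g < r)%R%:R / r)%:E) (aligned_score (fun k => pm (cx (Y^~ t) (k, None)))
     (aligned_out (fun k => pm (cx (Y^~ t) (k, None))) (fun k i => cx (Y^~ t) (k, Some i)))))%E.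
Proof.
move=> g0 gY xc.
rewrite (random_coding (mfunctional_above g x) (fun _ _ => ler0n _ _)).
have mid : measurable_fun setT (fun r : R => (g < r)%R%:R : R) := mfun_gt g (@measurable_id _ R setT).
have mpsi : measurable_fun setT (fun r : R => ((g < r)%R%:R / r)%:E : \bar R).
  by apply: mfun_EFin; apply: mfun_mul mid _; apply: mfun_inv; exact: measurable_id.
have psi0 (r : R) : (0 <= ((g < r)%R%:R / r)%:E)%E.
  by rewrite lee_fin; case: (ltP g r) => gr; rewrite ?mul0r// mul1r invr_ge0 ltW// (le_lt_trans g0).
rewrite -(score_law mpsi psi0 gY xc).
(* Dividing the test by the score and changing measure with the fixed codeword [x] leaves the test
   times the product of [orat], which is the right-hand side of [random_coding]. *)
pose Phi m y := above g x m y / score m x y.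
have Phi0 m y : 0 <= Phi m y by rewrite divr_ge0 ?ler0n// ltW// score_gt0.
have mPhi : mfunctional Phi.
  move=> d1 T1 m y mm my; apply: mfun_mul; first exact: mfunctional_above.
  apply: mfun_inv.
  by apply: (mfun_score (x := fun k i _ => x k i)) => // k i; exact: cmfun_cst.
apply: esym; apply: etrans (change_of_measure mPhi Phi0 xc) _.
apply: eq_integral => t _; rewrite /Phi /score; apply: (congr1 EFin).
rewrite -mulrA; apply: (congr1 (fun z => _ * z)); rewrite prodf_div invf_div divfK//.
rewrite gt_eqF//; apply: prodr_gt0 => k _.
by rewrite gratio_gt0// ltW.
Qed.

Lemma law_below g (x : 'I_l -> 'I_n -> R[i]) d' (T' : measurableType d')
    (P' : probability T' R) (Y : ('I_l * option 'I_n) * bool -> T' -> R) :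
  gfam P' Y -> (forall k, vnorm2 (x k) = c) ->
  (\int[P]_t (1 - (g < score (pmean (Z^~ t)) x (received (Z^~ t) x))%R%:R)%:E =
   \int[P']_t (fun r => (1 - (g < r)%R%:R)%:E) (aligned_score (fun k => pm (cx (Y^~ t) (k, None)))
     (aligned_out (fun k => pm (cx (Y^~ t) (k, None))) (fun k i => cx (Y^~ t) (k, Some i)))))%E.
Proof.
move=> gY xc.
have mid : measurable_fun setT (fun r : R => (g < r)%R%:R : R) := mfun_gt g (@measurable_id _ R setT).
have mpsi : measurable_fun setT (fun r : R => (1 - (g < r)%R%:R)%:E : \bar R).
  by apply: mfun_EFin; apply: mfun_add; [exact: measurable_cst|apply: mfun_opp; exact: mid].
have psi0 (r : R) : (0 <= (1 - (g < r)%R%:R : R)%:E)%E.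
  by rewrite lee_fin subr_ge0; case: (g < r).
exact: (score_law mpsi psi0 gY xc).
Qed.

(** Given M codewords, the mean over a fresh random one of its total confusion with them is M B, so
    some codeword does no worse. A new codeword leaves the earlier constraints intact because each
    involves predecessors only. *)
Lemma greedy_code (g B : R) (M : nat) :
  (forall x : 'I_l -> 'I_n -> R[i], (forall k, vnorm2 (x k) = c) ->
    \int[P]_u confusion g x (cword (Z^~ u)) = B%:E)%E ->
  exists w : nat -> 'I_l -> 'I_n -> R[i],
    (forall j k, vnorm2 (w j k) = c) /\
    forall j, (j < M)%N -> (\sum_(i < j) confusion g (w i) (w j) <= (j%:R * B)%:E)%E.
Proof.
move=> HB; elim: M => [|M [w [wc wM]]].
  (* The sequence is total, so a codeword is needed even for M = 0; the sample space is inhabited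
     because it has mass 1. *)
  have [t0 _] : exists t0 : T, True.
    have := probability_setT P; case: (pselect (exists t0 : T, True)) => // h.
    rewrite (_ : [set: T] = set0) ?measure0; first by move=> /esym/eqP; rewrite onee_eq0.
    by apply/seteqP; split => // t _; apply: h; exists t.
  exists (fun=> cword (Z^~ t0)); split=> // j k; exact: vnorm2_cword.
have [u hu] : exists u, (\sum_(i < M) confusion g (w i) (cword (Z^~ u)) <= (M%:R * B)%:E)%E.
  apply: (@exists_le_mean _ _ _ P).
  - by apply: emeasurable_sum => i; exact: measurable_confusion.
  - by move=> u; apply: sume_ge0 => i _; exact: confusion_ge0.
  rewrite ge0_integral_sum//; last by move=> i u _; exact: confusion_ge0.
    rewrite (eq_bigr (fun=> B%:E)) => [|i _]; last exact: HB.
    by rewrite sumEFin sumr_const card_ord mulr_natl.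
  by move=> i; exact: measurable_confusion.
pose w' j := if (j < M)%N then w j else cword (Z^~ u).
have w'lt j : (j < M)%N -> w' j = w j by rewrite /w' => ->.
have w'M : w' M = cword (Z^~ u) by rewrite /w' ltnn.
exists w'; split; first by move=> j k; rewrite /w'; case: ifP => _; rewrite ?wc ?vnorm2_cword.
move=> j; rewrite ltnS leq_eqVlt => /orP[/eqP ->|jM].
  apply: le_trans hu; rewrite w'M le_eqVlt; apply/orP; left; apply/eqP.
  by apply: eq_bigr => i _; rewrite w'lt.
apply: le_trans (wM _ jM); rewrite (w'lt _ jM) le_eqVlt; apply/orP; left; apply/eqP.
by apply: eq_bigr => i _; rewrite w'lt// (ltn_trans (ltn_ord i) jM).
Qed.

End law.
End channel.

(** * Threshold decoding *)

Section first_above.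
Variables (M : nat) (j0 : 'I_M).

(** [find] returns M when no test succeeds, and [insubd] then falls back on [j0]. *)
Definition first_above (p : nat -> bool) : 'I_M := insubd j0 (find p (iota 0 M)).

Lemma eq_first_above p q : (forall i, (i < M)%N -> p i = q i) -> first_above p = first_above q.
Proof.
move=> pq; rewrite /first_above (@eq_in_find _ p q)// => i.
by rewrite mem_iota => /andP[_]; exact: pq.
Qed.

Lemma first_aboveP (p : nat -> bool) (j : 'I_M) : p j -> (forall i, (i < j)%N -> ~~ p i) -> first_above p = j.
Proof.
move=> pj pi; apply: val_inj; rewrite /first_above val_insubd.
have hp : has p (iota 0 M) by apply/hasP; exists (val j) => //; rewrite mem_iota/=.
have fM : (find p (iota 0 M) < M)%N by rewrite -{2}(size_iota 0 M) -has_find.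
have pf := nth_find 0%N hp; rewrite nth_iota// add0n in pf.
rewrite fM; apply/eqP; rewrite eqn_leq; apply/andP; split; rewrite leqNgt; apply/negP => h.
  by have := before_find 0%N h; rewrite nth_iota ?ltn_ord// ?add0n pj.
by have := pi _ h; rewrite pf.
Qed.

(** Union bound in pointwise form, ready to be integrated; only tests below [j] can pre-empt its
    own. *)
Lemma first_above_neq (R : realType) (p : nat -> bool) (j : 'I_M) :
  (first_above p != j)%:R <= 1 - (p j)%:R + \sum_(i < j) (p i)%:R :> R.
Proof.
have s0 : 0 <= \sum_(i < j) (p i)%:R :> R by apply: sumr_ge0.
case pj: (p j); last by rewrite subr0 -[leLHS]addr0 lerD// lern1 leq_b1.
rewrite subrr add0r; have [h|/existsP[i pi]] := boolP [forall i : 'I_j, ~~ p i].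
  rewrite (first_aboveP pj) ?eqxx// => i ij.
  by move/forallP: h => /(_ (Ordinal ij)).
rewrite negbK in pi; rewrite (bigD1 i)//= pi; apply: le_trans (_ : 1 <= _).
  by rewrite lern1 leq_b1.
by rewrite lerDl sumr_ge0.
Qed.

End first_above.

(** A predicate of the first M tests is a finite Boolean combination of them, by splitting on the
    last one. Error events thus become measurable with no measurability of the decoder on the output
    space. *)
Lemma measurable_bool_combination d (T : measurableType d) (M : nat) (q : nat -> T -> bool)
    (F : (nat -> bool) -> Prop) :
  (forall i, measurable [set t | q i t]) ->
  (forall p p', (forall i, (i < M)%N -> p i = p' i) -> F p -> F p') ->
  measurable [set t | F (q^~ t)].
Proof.
move=> mq; elim: M F => [|M IH] F hF.
  have [F0|nF0] := pselect (F xpredT).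
    rewrite (_ : [set t | _] = setT); first exact: measurableT.
    by apply/seteqP; split => // t _; exact: hF F0.
  rewrite (_ : [set t | _] = set0); first exact: measurable0.
  by apply/seteqP; split => // t /= Ft; apply: nF0; exact: hF Ft.
pose G b (p : nat -> bool) := F (fun i => if i == M then b else p i).
have mG b : measurable [set t | G b (q^~ t)].
  apply: IH => p p' pp'; apply: hF => i; rewrite ltnS leq_eqVlt.
  by case: eqP => //= _; exact: pp'.
rewrite (_ : [set t | F (q^~ t)] =
  ([set t | q M t] `&` [set t | G true (q^~ t)]) `|` (~` [set t | q M t] `&` [set t | G false (q^~ t)])).
  by apply: measurableU; apply: measurableI => //; exact: measurableC.
have GE t : F (q^~ t) <-> G (q M t) (q^~ t).
  by split; apply: hF => i _; case: eqP => // ->.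
apply/seteqP; split => t /=.
  by move=> /GE; case: (q M t) => h; [left|right].
by move=> [[qt h]|[qt h]]; apply/GE; [rewrite qt|move/negP/negbTE: qt => ->].
Qed.

Lemma sum_ord_half (R : realType) (M : nat) : (\sum_(j < M) j%:R : R) = M%:R * ((M%:R - 1) / 2).
Proof.
elim: M => [|M IH]; first by rewrite big_ord0 mul0r.
by rewrite big_ord_recr/= IH -(natr1 M); move: (M%:R : R) => x; field.
Qed.

(** Pointwise, exp (- [E - ln g]^+) = min (1, g / S), equal to 1 up to the threshold and to g / S
    above it. [A] and [B] exist as reals because their integrands are bounded by 1 and 1 / g. *)
Lemma soft_threshold (R : realType) d (T : measurableType d) (P : probability T R)
    (E S : T -> R) (g : R) : 0 < g -> measurable_fun setT S -> (forall t, S t = expR (E t)) ->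
  exists A B : R,
  [/\ (\int[P]_t (1 - (g < S t)%R%:R)%:E = A%:E)%E,
      (\int[P]_t ((g < S t)%R%:R / S t)%:E = B%:E)%E &
      (\int[P]_t (expR (- Num.max 0 (E t - ln g)))%:E = (A + g * B)%:E)%E].
Proof.
move=> g0 mS SE; have mi := mfun_gt g mS.
have S0 t : 0 < S t by rewrite SE expR_gt0.
have ma : measurable_fun setT (fun t => (1 - (g < S t)%R%:R : R)%:E).
  by apply: mfun_EFin; apply: mfun_add; [exact: measurable_cst|apply: mfun_opp; exact: mi].
have mb : measurable_fun setT (fun t => ((g < S t)%R%:R / S t : R)%:E).
  by apply: mfun_EFin; apply: mfun_mul; [exact: mi|exact: mfun_inv].
have a0 t : (0 <= (1 - (g < S t)%R%:R : R)%:E)%E by rewrite lee_fin subr_ge0 lern1 leq_b1.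
have b0 t : (0 <= ((g < S t)%R%:R / S t : R)%:E)%E by rewrite lee_fin divr_ge0// ltW.
have fin (f : T -> \bar R) (K : R) : measurable_fun setT f -> (forall t, 0 <= f t)%E ->
    (forall t, f t <= K%:E)%E -> (\int[P]_t f t = (fine (\int[P]_t f t))%:E)%E.
  move=> mf f0 fK; rewrite fineK// ge0_fin_numE; last by apply: integral_ge0 => t _.
  apply: (@le_lt_trans _ _ (\int[P]_t (cst K%:E) t)%E).
    by apply: ge0_le_integral => //= t _; apply: le_trans (fK t).
  by rewrite integral_cst// [X in (_ * X)%E](probability_setT P) mule1 ltry.
have Af := fin _ 1 ma a0; have Bf := fin _ g^-1 mb b0.
exists (fine (\int[P]_t (1 - (g < S t)%R%:R)%:E)%E), (fine (\int[P]_t ((g < S t)%R%:R / S t)%:E)%E).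
split.
- by apply: Af => t; rewrite lee_fin lerBlDr lerDl.
- apply: Bf => t; rewrite lee_fin; case: ltP => h; last by rewrite mul0r invr_ge0 ltW.
  by rewrite mul1r lef_pV2 ?posrE// ltW.
rewrite EFinD EFinM -Af; last by move=> t; rewrite lee_fin lerBlDr lerDl.
rewrite -Bf; last first.
  move=> t; rewrite lee_fin; case: ltP => h; last by rewrite mul0r invr_ge0 ltW.
  by rewrite mul1r lef_pV2 ?posrE// ltW.
rewrite -(ge0_integralZl_EFin P measurableT (fun t _ => b0 t) mb (ltW g0)).
have mgb : measurable_fun setT (fun t => g%:E * ((g < S t)%R%:R / S t : R)%:E)%E.
  by apply: mfun_emul mb; exact: measurable_cst.
have gb0 t : (0 <= g%:E * ((g < S t)%R%:R / S t : R)%:E)%E by rewrite mule_ge0// lee_fin ltW.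
rewrite -(ge0_integralD P measurableT (fun t _ => a0 t) ma (fun t _ => gb0 t) mgb).
apply: eq_integral => t _; rewrite -EFinM -EFinD; apply: (congr1 EFin).
have lnS : E t = ln (S t) by rewrite SE expRK.
rewrite lnS; case: ltP => h.
  rewrite max_r; last by rewrite subr_ge0 ler_ln ?posrE// ltW.
  by rewrite opprB expRD expRN !lnK ?posrE// subrr add0r mul1r.
rewrite max_l; first by rewrite (_ : false%:R = 0)// oppr0 expR0 addr0 mul0r mulr0 addr0.
by rewrite subr_le0 ler_ln ?posrE.
Qed.

(** * The score of the variables of the bound, and the pilot code *)

Section link.
Variables (R : realType) (l nc np : nat) (kappa rho : R).
Hypotheses (rho0 : 0 < rho) (np0 : (0 < np)%N) (kappa0 : 0 <= kappa).
Local Notation n := (nc - np)%N.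

Definition post_mean (z : R[i]) : R[i] := Defs.mup kappa np rho
  (rC (muH kappa) + rC (Num.sqrt (sigmaH2 kappa + sigmae2 np rho)) * z).

Lemma cmfun_post_mean d (T : measurableType d) (f : T -> R[i]) : cmfun f -> cmfun (post_mean \o f).
Proof.
move=> mf; apply: cmfun_mul; last exact: cmfun_cst.
apply: cmfun_add; last exact: cmfun_cst.
apply: cmfun_mul; first exact: cmfun_cst.
apply: cmfun_add; first exact: cmfun_cst.
by apply: cmfun_mul mf; exact: cmfun_cst.
Qed.

(** [aligned_out] is [Wtilde] with the posterior mean of each block, so [expR_Sfun] applies
    blockwise and the product of ratios becomes the exponential of a sum. *)
Lemma expR_Sbar (i0 : 'I_n) dX (TX : measurableType dX) (PX : probability TX R)
    (X : 'I_n * bool -> TX -> R) d (T : measurableType d)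
    (HHre HHim : 'I_l -> T -> R) (Vre Vim : 'I_l -> 'I_n -> T -> R)
    (Y : ('I_l * option 'I_n) * bool -> T -> R) t : i0 = 0%N :> nat -> gfam PX X ->
  (forall k t, mkC (HHre k t) (HHim k t) =
     rC (muH kappa) + rC (Num.sqrt (sigmaH2 kappa + sigmae2 np rho)) * cx (Y^~ t) (k, None)) ->
  (forall k i t, mkC (Vre k i t) (Vim k i t) = cx (Y^~ t) (k, Some i)) ->
  aligned_score i0 (n%:R * rho) (Num.sqrt (sigmap2 kappa np rho)) PX X
    (fun k => post_mean (cx (Y^~ t) (k, None)))
    (aligned_out i0 (n%:R * rho) (Num.sqrt (sigmap2 kappa np rho))
      (fun k => post_mean (cx (Y^~ t) (k, None))) (fun k i => cx (Y^~ t) (k, Some i))) =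
  expR (\sum_(k < l) Sbar kappa rho HHre HHim Vre Vim k t).
Proof.
move=> i00 gX HE VE; rewrite expR_sum; apply: eq_bigr => k _.
have sp0 := sigmap2_gt0 np0 rho0 kappa0.
set s := Num.sqrt _; have s0 : 0 < s by rewrite sqrtr_gt0.
rewrite /Sbar HE -/(post_mean _).
have -> : (fun i => mkC (Vre k i t) (Vim k i t)) = fun i => cx (Y^~ t) (k, Some i).
  by apply/funext => i; rewrite VE.
have -> : sigmap2 kappa np rho = s ^+ 2 by rewrite sqr_sqrtr// ltW.
rewrite (expR_Sfun i00 gX _ _ rho0 s0).
have -> // : Wtilde rho (post_mean (cx (Y^~ t) (k, None))) (s ^+ 2) (fun i => cx (Y^~ t) (k, Some i)) =
  aligned_out i0 (n%:R * rho) s (fun k => post_mean (cx (Y^~ t) (k, None)))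
    (fun k i => cx (Y^~ t) (k, Some i)) k.
apply/funext => i; rewrite /Wtilde /aligned_out -val_eqE /= i00.
by rewrite mulrA.
Qed.

End link.

Theorem theorem3 (R : realType) (l nc np : nat) (eps rho kappa : R) :
  (1 <= l)%N -> (2 <= nc)%N -> (1 <= np)%N -> (np <= nc - 1)%N ->
  0 < eps < 1 -> 0 < rho -> 0 <= kappa ->
  forall (d : measure_display) (T : measurableType d) (P : probability T R)
         (Hre Him : 'I_l -> T -> R) (Wre Wim : 'I_l -> 'I_nc -> T -> R),
  rician_model P (muH kappa) (sigmaH2 kappa) Hre Him Wre Wim ->
  forall (d' : measure_display) (T' : measurableType d') (P' : probability T' R)
         (HHre HHim : 'I_l -> T' -> R) (Vre Vim : 'I_l -> 'I_(nc - np) -> T' -> R),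
  bound_model P' kappa rho HHre HHim Vre Vim ->
  forall M : nat, (2 <= M)%N ->
  (eps_ub P' kappa rho HHre HHim Vre Vim M <= eps%:E)%E ->
  ((log2 M%:R / (nc * l)%:R)%:E <= Rstar P Hre Him Wre Wim eps rho)%E.
Proof.
move=> l1 nc2 np0 npc1 _ rho0 kappa0 d T P Hre Him Wre Wim model.
move=> d' T' P' HHre HHim Vre Vim bound M M2 epsM.
have npc : (np <= nc)%N := leq_trans npc1 (leq_subr _ _).
have n0 : (0 < nc - np)%N by rewrite subn_gt0 (leq_ltn_trans npc1)// subn1 prednK// ltnW.
have M0 : (0 < M)%N := ltnW M2.
have [Z [gZ Zout]] := channel_normal_form np0 npc rho0 kappa0 model.
have sH0 := sigmaH2_gt0 kappa0; have se0 := sigmae2_gt0 np0 rho0.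
have tau0 : 0 < sigmaH2 kappa + sigmae2 np rho by rewrite addr_gt0.
have [Y [gY YH YV]] : exists Y : ('I_l * option 'I_(nc - np)) * bool -> T' -> R,
  [/\ gfam P' Y,
      forall k t, mkC (HHre k t) (HHim k t) =
        rC (muH kappa) + rC (Num.sqrt (sigmaH2 kappa + sigmae2 np rho)) * cx (Y^~ t) (k, None) &
      forall k i t, mkC (Vre k i t) (Vim k i t) = cx (Y^~ t) (k, Some i)].
  apply: (rician_gfam (s := Num.sqrt (sigmaH2 kappa + sigmae2 np rho))); first by rewrite sqrtr_gt0.
  by rewrite sqr_sqrtr// ltW.
pose i0 : 'I_(nc - np) := Ordinal n0; pose k0 : 'I_l := Ordinal l1.
pose slot0 (p : 'I_(nc - np) * bool) : ('I_l * option (option 'I_(nc - np))) * bool :=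
  ((k0, Some (Some p.1)), p.2).
have slot0_inj : injective slot0 by move=> [i b] [i' b'] [-> ->].
(* [out_ratio] averages over some Gaussian family indexed by one data block; the data noise of block
   [k0] provides it. *)
pose X p := Z (slot0 p); have gX : gfam P X := gfam_reindex slot0_inj gZ.
pose c : R := (nc - np)%:R * rho; have c0 : 0 < c by rewrite mulr_gt0// ltr0n.
pose s := Num.sqrt (sigmap2 kappa np rho).
pose pm := post_mean np kappa rho.
have mpm d1 (T1 : measurableType d1) (f : T1 -> R[i]) : cmfun f -> cmfun (pm \o f).
  exact: cmfun_post_mean.
pose g : R := (M%:R - 1) / 2.
have g0 : 0 < g by rewrite divr_gt0// subr_gt0 ltr1n.
pose m' t (k : 'I_l) := pm (cx (Y^~ t) (k, None)).
pose S t := aligned_score i0 c s P X (m' t) (aligned_out i0 c s (m' t) (fun k i => cx (Y^~ t) (k, Some i))).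
have mY := mX_vec gY.
have mS : measurable_fun setT S.
  apply: (mfun_aligned i0 s c0 gX (m := fun k t => m' t k)
    (y := fun k i t => aligned_out i0 c s (m' t) (fun k i => cx (Y^~ t) (k, Some i)) k i)).
    by move=> k; apply: mpm; exact: (cmfun_comp mY (cmfun_cx _ (k, None))).
  move=> k i; apply: (cmfun_aligned_out i0 c s (m := fun k t => m' t k)
    (w := fun k i t => cx (Y^~ t) (k, Some i))).
    by move=> k'; apply: mpm; exact: (cmfun_comp mY (cmfun_cx _ (k', None))).
  by move=> k' i'; exact: (cmfun_comp mY (cmfun_cx _ (k', Some i'))).
have SE t : S t = expR (\sum_(k < l) Sbar kappa rho HHre HHim Vre Vim k t).
  exact: (expR_Sbar rho0 np0 kappa0 t (erefl : i0 = 0%N :> nat) gX YH YV).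
have [A [B [EA EB EAB]]] := soft_threshold P' g0 mS SE.
have [w [wc wM]] := greedy_code c0 mpm gX gZ M (fun x xc =>
  etrans (mean_confusion i0 s c0 mpm gX gZ (ltW g0) gY xc) EB).
(* The tests act on raw channel outputs, by pilot estimate and data part; [qE] identifies them with
   the tests of the reduced channel. *)
pose q y (i : nat) := g < score i0 c s P X (fun k => Defs.mup kappa np rho (pilot_est rho npc y k))
  (w i) (data_out npc y).
pose C := @Code R l nc M (fun j : 'I_M => with_pilots rho npc (w j))
  (fun y => first_above (Ordinal M0) (q y)).
pose qt (j : 'I_M) i t := g < score i0 c s P X (pmean pm (Z^~ t)) (w i) (received s pm (Z^~ t) (w j)).
have mZ := mX_vec gZ.
have qE (j : 'I_M) i t : q (chan_out Hre Him Wre Wim (codeword C j) t) i = qt j i t.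
  have e1 : (fun k => Defs.mup kappa np rho (pilot_est rho npc
      (chan_out Hre Him Wre Wim (with_pilots rho npc (w j)) t) k)) = pmean pm (Z^~ t).
    by apply/funext => k; have [-> _] := Zout (w j) t k.
  have e2 : data_out npc (chan_out Hre Him Wre Wim (with_pilots rho npc (w j)) t) =
      received s pm (Z^~ t) (w j).
    by apply/funext => k; apply/funext => i'; have [_ ->] := Zout (w j) t k.
  by rewrite /q /qt e1 e2.
have mqt (j : 'I_M) i : measurable_fun setT (fun t => (qt j i t)%:R : R).
  apply: mfun_gt; apply: (mfun_score i0 s c0 gX (m := fun k t => pmean pm (Z^~ t) k)
    (x := fun k i' _ => w i k i') (y := fun k i' t => received s pm (Z^~ t) (w j) k i')).
  - by move=> k; exact: (cmfun_comp mZ (cmfun_pmean _ mpm k)).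
  - by move=> k i'; exact: cmfun_cst.
  - by move=> k i'; exact: (cmfun_comp mZ (cmfun_received s mpm (w j) k i')).
have errE (j : 'I_M) : err_event Hre Him Wre Wim C j =
    [set t | first_above (Ordinal M0) (fun i => qt j i t) != j].
  have D t : decoder C (chan_out Hre Him Wre Wim (codeword C j) t) =
      first_above (Ordinal M0) (fun i => qt j i t).
    exact: (eq_first_above (Ordinal M0) (fun i _ => qE j i t)).
  by apply/funext => t; exact: (congr1 (fun z => is_true (z != j)) (D t)).
have merr (j : 'I_M) : measurable (err_event Hre Him Wre Wim C j).
  rewrite errE; apply: (measurable_bool_combination (M := M) (q := qt j)
    (F := fun p => first_above (Ordinal M0) p != j)).
    move=> i; rewrite (_ : [set t | qt j i t] = setT `&` (fun t => (qt j i t)%:R : R) @^-1` [set 1]).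
      exact: mqt.
    by rewrite setTI; apply/seteqP; split => t /=; case: (qt j i t) => //= /esym/eqP; rewrite oner_eq0.
  by move=> p p' pp'; rewrite (eq_first_above _ pp').
have perr (j : 'I_M) : (P (err_event Hre Him Wre Wim C j) <= (A + j%:R * B)%:E)%E.
  have mown : measurable_fun setT (fun t => (1 - (qt j j t)%:R : R)%:E).
    by apply: mfun_EFin; apply: mfun_add; [exact: measurable_cst|apply: mfun_opp; exact: mqt].
  have moth (i : 'I_j) : measurable_fun setT (fun t => ((qt j i t)%:R : R)%:E).
    by apply: mfun_EFin; exact: mqt.
  have own0 t : (0 <= (1 - (qt j j t)%:R : R)%:E)%E by rewrite lee_fin subr_ge0 lern1 leq_b1.
  have oth0 (i : 'I_j) t : (0 <= ((qt j i t)%:R : R)%:E)%E by rewrite lee_fin.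
  rewrite -[X in P X]setIT -integral_indic//.
  apply: (@le_trans _ _ (\int[P]_t ((1 - (qt j j t)%:R : R)%:E + \sum_(i < j) ((qt j i t)%:R : R)%:E)))%E.
    apply: ge0_le_integral => //.
    - by apply: mfun_EFin; exact: measurable_indic.
    - by apply: emeasurable_funD => //; apply: emeasurable_sum.
    move=> t _; rewrite sumEFin -EFinD lee_fin indicE errE.
    have F := first_above_neq (Ordinal M0) R (fun i => qt j i t) j.
    case: (boolP (t \in _)) => tE; last by apply: le_trans F; rewrite ler0n.
    by move: tE; rewrite inE /= => tE; rewrite tE in F.
  rewrite ge0_integralD//; last 2 first.
  - by move=> t _; rewrite sume_ge0.
  - by apply: emeasurable_sum.
  rewrite EFinD; apply: leeD.
    by rewrite (etrans (law_below i0 s c0 mpm gX gZ g gY (wc j)) EA).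
  rewrite ge0_integral_sum//; exact: wM.
apply: ereal_sup_ubound; exists M; last by rewrite mulnC.
split=> //; exists C; split; [|split] => //.
  by move=> j k; apply: vnorm2_with_pilots => //; exact: wc.
apply: le_trans epsM; rewrite /eps_ub EAB.
apply: (@le_trans _ _ ((M%:R^-1)%:E * \sum_(j < M) (A + j%:R * B)%:E)%E).
  by apply: lee_wpmul2l; [rewrite lee_fin invr_ge0|apply: lee_sum => j _; exact: perr].
(* The mean of A + j B over the messages is A + g B, since the indices average to (M - 1) / 2; by
   [EAB] this is [eps_ub]. *)
rewrite sumEFin -EFinM lee_fin big_split/= sumr_const card_ord -mulr_suml sum_ord_half -/g.
have MR : M%:R != 0 :> R by rewrite pnatr_eq0 -lt0n.
rewrite -(mulr_natl A M) -(mulrA M%:R) -mulrDr mulrA mulVf// mul1r.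
by [].
Qed.
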